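(* Let $(W,S)$ be a Coxeter system, $\mathfrak o$ a right $W$-set, and $\mathfrak h$ a reflection-balanced reflection-stable Abe realization of $(W,S)$ over $\Bbbk$. For every $\mathcal L\in\mathfrak o$ there is an equivalence of monoidal categories $$\Psi_{\mathcal L}^{\mathrm{alg}}:\ \mathcal A^{\oplus}(\mathfrak h,W_{\mathcal L}^{\circ})\ \xrightarrow{\ \sim\ }\ {}_{\mathcal L}\mathcal A^{\oplus,\circ}_{\mathcal L}(\mathfrak h,W,\mathfrak o)$$ such that $\Psi^{\mathrm{alg}}_{\mathcal L}(B_{\underline x})\cong B^{\mathcal L}_{\underline x'}$ for every $\underline x\in\mathrm{Exp}(W_{\mathcal L}^\circ)$, where $\underline x'\in\mathrm{Exp}(W)$ is obtained from $\underline x$ by replacing each element of $S_{\mathcal L}^\circ$ by a reduced expression for it in $W$.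
   Context: **Coxeter data.** $\ell$ is the length function of $(W,S)$, $m_{s,t}$ the order of $st$, $\mathscr R(W)=\{wsw^{-1}:w\in W,s\in S\}$. $\mathrm{Exp}(W)$ is the set of finite sequences $\underline w=(s_1,\dots,s_k)$ in $S$. For $\mathcal L\in\mathfrak o$ put $\mathcal L\underline w=\mathcal Ls_1\cdots s_k$, ${}_{\mathcal L}W_{\mathcal L'}=\{w\in W:\mathcal Lw=\mathcal L'\}$, $K(\underline w,\mathcal L)=\{i:\mathcal Ls_1\cdots s_i=\mathcal Ls_1\cdots s_{i-1}\}$. Let $b_{\mathcal L}(\underline w)\in W$ be the product, in order, of the $s_i$ with $i\notin K(\underline w,\mathcal L)$; it depends only on $w=s_1\cdots s_k$, write $b_{\mathcal L}(w)$. Let $\ell_{\mathcal L}(w)=\#K(\underline w,\mathcal L)$ for a reduced expression $\underline w$ of $w$ (independent of choice). $W_{\mathcal L}^\circ=\{w:\mathcal Lw=\mathcal L,\ b_{\mathcal L}(w)=e\}$ and $S_{\mathcal L}^\circ=\{w\in W_{\mathcal L}^\circ:\ell_{\mathcal L}(w)=1\}$; $(W_{\mathcal L}^\circ,S_{\mathcal L}^\circ)$ is a Coxeter system and $S_{\mathcal L}^\circ$ consists of reflections of $W$. **Realizations.** $\Bbbk$ is an integral domain. A pre-realization is a free finite-rank $\Bbbk$-module $\mathfrak h$ with $\alpha_s^\vee\in\mathfrak h$, $\alpha_s\in\mathfrak h^*$ ($s\in S$) such that $\langle\alpha_s^\vee,\alpha_s\rangle=2$, $s(v)=v-\langle v,\alpha_s\rangle\alpha_s^\vee$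 defines a $W$-action on $\mathfrak h$, and $\alpha_s:\mathfrak h\to\Bbbk$, $\alpha_s^\vee:\mathfrak h^*\to\Bbbk$ are surjective. Put $a_{s,t}=\langle\alpha_s^\vee,\alpha_t\rangle$. In $\mathbb Z[x,y]$ set $[0]_x=[0]_y=0$, $[1]_x=[1]_y=1$, $[2]_x=x$, $[2]_y=y$, $[n+1]_x=[2]_x[n]_y-[n-1]_x$, $[n+1]_y=[2]_y[n]_x-[n-1]_y$; $x(d)=[d+1]_x-[d-1]_x$, $y(d)=[d+1]_y-[d-1]_y$; $[n]_{x(d)}$, $[n]_{y(d)}$ are obtained from $[n]_x,[n]_y$ by substituting $x\mapsto x(d)$, $y\mapsto y(d)$; and $\binom nk_{x(d)}=\frac{[n]_{x(d)}\cdots[n-k+1]_{x(d)}}{[1]_{x(d)}\cdots[k]_{x(d)}}\in\mathbb Z[x,y]$, similarly with $y(d)$. $\mathfrak h$ is a *reflection-stable Abe realization* if for all distinct $s,t\in S$ with $m=m_{s,t}<\infty$, all $v>1$ dividing $m$ and $1\le k\le v-1$, $\binom vk_{x(m/v)}$ and $\binom vk_{y(m/v)}$ vanish at $(x,y)=(a_{s,t},a_{t,s})$. It is *reflection-balanced* if for all such $s,t$ and all divisors $1\le d<m$ of $m$, $[m/d-1]_{x(d)}$ and $[m/d-1]_{y(d)}$ take the value $1$ at $(x,y)=(-a_{s,t},-a_{t,s})$. **Bimodules.** $R=\mathrm{Sym}(\mathfrak h^* )$, graded with $\mathfrak h^*$ in degree 2. For $r=xsx^{-1}\in\mathscr R(W)$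 with $s\in S$, $xs>x$, put $\alpha_r=x\alpha_s$ (well defined by balancedness); $Q=R[\alpha_r^{-1}:r\in\mathscr R(W)]$. $M(n)^i=M^{n+i}$. ${}_{\mathcal L}\mathcal C_{\mathcal L'}(\mathfrak h,W,\mathfrak o)$ has objects $(M,(M_Q^w)_{w\in W},\xi_M)$: $M$ a graded $R$-bimodule, finitely generated as a bimodule and flat as a right $R$-module; $M^w_Q$ graded $(R,Q)$-bimodules with $m\cdot f=w(f)\cdot m$ for $f\in R$, nonzero for only finitely many $w$ and zero unless $w\in{}_{\mathcal L}W_{\mathcal L'}$; $\xi_M:M\otimes_RQ\cong\bigoplus_wM_Q^w$ an isomorphism of graded $(R,Q)$-bimodules. Morphisms are $R$-bimodule maps (of any degree) $\varphi:M\to N$ such that $\xi_N(\varphi\otimes Q)\xi_M^{-1}$ maps $M_Q^w$ into $N_Q^w$ for all $w$. Tensor product over $R$, with $(M\otimes_RN)_Q^w=\bigoplus_{xy=w}M_Q^x\otimes_QN_Q^y$, gives composition functors ${}_{\mathcal L}\mathcal C_{\mathcal L'}\times{}_{\mathcal L'}\mathcal C_{\mathcal L''}\to{}_{\mathcal L}\mathcal C_{\mathcal L''}$. $R_w$ is $R$ with right action $m\cdot f=w(f)m$, localized only at $w$. For a reflection $s$ in $S$ (or $S_{\mathcal L}^\circ$), $C_s=R\otimes_{R^s}R(1)$, whose localization has nonzero components only at $e$ and $s$, generated over $Q$ by $\delta\otimes1-1\otimes s(\delta)$ and $\delta\otimes1-1\otimes\delta$ respectively, where $\delta\in\mathfrak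 h^*$, $\langle\alpha_s^\vee,\delta\rangle=1$. Set $B_s^{\mathcal L}=C_s$ if $\mathcal Ls=\mathcal L$, $B_s^{\mathcal L}=R_s$ if $\mathcal Ls\ne\mathcal L$, and $B_{\underline w}^{\mathcal L}=B_{s_1}^{\mathcal L}\otimes_RB_{s_2}^{\mathcal Ls_1}\otimes_R\cdots\otimes_RB_{s_k}^{\mathcal Ls_1\cdots s_{k-1}}$. ${}_{\mathcal L}\mathcal A_{\mathcal L}^{\oplus,\circ}(\mathfrak h,W,\mathfrak o)$ (the neutral block) is the full monoidal subcategory of ${}_{\mathcal L}\mathcal C_{\mathcal L}$ of objects isomorphic to finite direct sums of $B_{\underline w}^{\mathcal L}$ with $\underline w$ an expression of an element of $W_{\mathcal L}^\circ$. $\mathcal A^\oplus(\mathfrak h,W_{\mathcal L}^\circ)$ is the category obtained by the same construction from the Coxeter system $(W_{\mathcal L}^\circ,S_{\mathcal L}^\circ)$, the one-point set of parameters, and $\mathfrak h$ with $\alpha_{s'}=x\alpha_s$, $\alpha^\vee_{s'}=x\alpha_s^\vee$ for $s'=xsx^{-1}\in S_{\mathcal L}^\circ$ ($s\in S$, $xs>x$); thus $B_{s'}=C_{s'}$ for all $s'\in S_{\mathcal L}^\circ$, and $B_{\underline x}$ is the tensor product of the $C_{s'}$ along $\underline x$. *)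

(* Defs.v *)
From HB Require Import structures.
From mathcomp Require Import all_boot all_order all_algebra.
From mathcomp Require Import generic_quotient fraction.
From mathcomp.classical Require Import boolp.
From mathcomp Require Import mpoly.

Set Implicit Arguments.
Unset Strict Implicit.
Unset Printing Implicit Defensive.

Import GRing.Theory.
Local Open Scope ring_scope.
Local Open Scope quotient_scope.

Section Words.
Variables (W : groupType) (S : {pred W}).

Definition gens := {s : W | s \in S}.

Definition wprod (u : seq gens) : W := foldr (fun s w => val s * w)%g 1%g u.

Definition has_length (w : W) (n : nat) : Prop :=
  exists u : seq gens, wprod u = w /\ size u = n.

(* The value 0 outside the subgroup generated by S is never used. *)
Definition ell (w : W) : nat :=
  if pselect (exists n, `[< has_length w n >]) is left h then ex_minn h else 0.

Definition reduced (u : seq gens) : Prop := size u = ell (wprod u).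

(* The order of s * t in W being m_{s,t}, the relations imposed on f below are
   the consequences (f s * f t) ^ n = 1, m_{s,t} | n, of the Coxeter relations
   (for s = t and n = 1 this is f s ^ 2 = 1). *)
Definition coxeter_system : Prop :=
  [/\ forall s, s \in S -> s <> 1%g /\ (s * s = 1)%g,
      forall w, exists u, wprod u = w
    & forall (G : groupType) (f : W -> G),
        (forall s t n, s \in S -> t \in S ->
           ((s * t) ^+ n = 1)%g -> ((f s * f t) ^+ n = 1)%g) ->
        exists g : W -> G, (forall x y, g (x * y)%g = (g x * g y)%g) /\
                           (forall s, s \in S -> g s = f s)].

Definition has_order (w : W) (m : nat) : Prop :=
  [/\ (0 < m)%N, (w ^+ m = 1)%g
    & forall n, (0 < n < m)%N -> (w ^+ n <> 1)%g].

End Words.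

Record wset (W : groupType) := WSet {
  ws_car :> Type;
  ws_act : ws_car -> W -> ws_car;
  ws_act1 : forall L, ws_act L 1%g = L;
  ws_actM : forall L x y, ws_act L (x * y)%g = ws_act (ws_act L x) y
}.

Definition pt_wset (W : groupType) : wset W :=
  @WSet W unit (fun L _ => L) (fun _ => erefl) (fun _ _ _ => erefl).

Section Neutral.
Variables (W : groupType) (S : {pred W}) (o : wset W).

(* The i-th bit tells whether i belongs to K(u, L). *)
Fixpoint stays (L : o) (u : seq (gens S)) : bitseq :=
  if u is s :: u' then
    `[< ws_act L (val s) = L >] :: stays (ws_act L (val s)) u'
  else [::].

Definition bword (L : o) (u : seq (gens S)) : W :=
  wprod (mask (map negb (stays L u)) u).

Definition ellL_word (L : o) (u : seq (gens S)) : nat :=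
  count_mem true (stays L u).

(* b_L(w) is computed on some expression of w, being independent of it. *)
Definition neutral (L : o) (w : W) : Prop :=
  ws_act L w = L /\ exists u : seq (gens S), wprod u = w /\ bword L u = 1%g.

End Neutral.

Section NeutralGroup.
Variables (W : groupType) (S : {pred W}) (cox : coxeter_system S).
Variables (o : wset W) (L : o).

Lemma wprod_cat (u v : seq (gens S)) : wprod (u ++ v) = (wprod u * wprod v)%g.
Proof. by elim: u => [|s u IH] /=; rewrite ?mul1g // IH mulgA. Qed.

Lemma stays_cat (M : o) (u v : seq (gens S)) :
  stays M (u ++ v) = stays M u ++ stays (ws_act M (wprod u)) v.
Proof. by elim: u M => [|s u IH] M /=; rewrite ?ws_act1 // IH ws_actM. Qed.

Lemma size_stays (M : o) (u : seq (gens S)) : size (stays M u) = size u.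
Proof. by elim: u M => [|s u IH] M //=; rewrite IH. Qed.

Lemma bword_cat (M : o) (u v : seq (gens S)) :
  bword M (u ++ v) = (bword M u * bword (ws_act M (wprod u)) v)%g.
Proof.
by rewrite /bword stays_cat map_cat mask_cat ?size_map ?size_stays // wprod_cat.
Qed.

Lemma gensK (s : gens S) : (val s * val s = 1)%g.
Proof. by case: cox => h _ _; case: (h _ (valP s)). Qed.

Lemma ws_gensK (M : o) (s : gens S) : ws_act (ws_act M (val s)) (val s) = M.
Proof. by rewrite -ws_actM gensK ws_act1. Qed.

Lemma wprod_rev (u : seq (gens S)) : wprod (rev u) = (wprod u)^-1%g.
Proof.
elim: u => [|s u IH] /=; first by rewrite invg1.
rewrite rev_cons -cats1 wprod_cat IH /= mulg1 invgM; congr (_ * _)%g.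
by apply: (mulgI (val s)); rewrite gensK mulgV.
Qed.

Lemma bword_rev (M : o) (u : seq (gens S)) :
  bword (ws_act M (wprod u)) (rev u) = (bword M u)^-1%g.
Proof.
elim: u M => [|s u IH] M; first by rewrite /bword /= invg1.
rewrite rev_cons -cats1 bword_cat /= ws_actM IH wprod_rev -ws_actM mulgV ws_act1.
rewrite /bword /= ws_gensK.
have -> : `[< M = ws_act M (val s) >] = `[< ws_act M (val s) = M >].
  by apply/asboolP/asboolP.
case: asboolP => _ /=; rewrite ?mulg1 // invgM; congr (_ * _)%g.
by apply: (mulgI (val s)); rewrite gensK mulgV.
Qed.

(* The argument is only there for the group structure, whose inverse needs
   s ^ 2 = 1. *)
Definition neutral_group of coxeter_system S := {w : W | `[< neutral S L w >]}.

HB.instance Definition _ := [isSub of neutral_group cox for @sval _ _].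
HB.instance Definition _ := [Choice of neutral_group cox by <:].

Lemma neutral_closed : group_closed (fun w : W => `[< neutral S L w >]).
Proof.
split.
  by apply/asboolP; split; [rewrite ws_act1 | exists [::]].
move=> x y /asboolP[Lx [u [ux bu]]] /asboolP[Ly [v [vy bv]]].
have LV : ws_act L y^-1%g = L by rewrite -{1}Ly -ws_actM mulgV ws_act1.
apply/asboolP; split; first by rewrite ws_actM Lx.
exists (u ++ rev v); rewrite wprod_cat wprod_rev ux vy; split=> //.
by rewrite bword_cat bu mul1g ux Lx -{1}Ly -vy bword_rev bv invg1.
Qed.

HB.instance Definition _ :=
  SubChoice_isSubGroup.Build W _ (neutral_group cox) neutral_closed.

Definition neutral_gens : {pred neutral_group cox} := fun w =>
  `[< exists u : seq (gens S),
        [/\ reduced u, wprod u = val w & ellL_word L u = 1%N] >].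

End NeutralGroup.

Arguments neutral_group {W S o} L cox.
Arguments neutral_gens {W S} cox {o} L _.

(* Only the data; the conditions on them are [prerealization] below.  The
   module is free of finite rank by definition of [vectType]. *)
Record realdata (k : idomainType) (W : groupType) (S : {pred W}) := RealData {
  hspace : vectType k;
  hact : W -> 'End(hspace);
  root : gens S -> 'Hom(hspace, k^o);
  coroot : gens S -> hspace
}.

Section Realization.
Variables (k : idomainType) (W : groupType) (S : {pred W}).
Variable D : realdata k S.

Definition cartan (s t : gens S) : k := root D t (coroot D s).

Definition prerealization : Prop :=
  (forall s, cartan s s = 2%:R) /\
  [/\ hact D 1%g = \1%VF,
      forall x y, hact D (x * y)%g = (hact D x \o hact D y)%VF,
      forall s v, hact D (val s) v = v - (root D s v : k) *: coroot D s,
      forall s (c : k), exists v, root D s v = c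
    & forall s (c : k), exists l : 'Hom(hspace D, k^o), l (coroot D s) = c].

Definition wdual (w : W) (l : 'Hom(hspace D, k^o)) : 'Hom(hspace D, k^o) :=
  (l \o hact D w^-1%g)%VF.

End Realization.

(* x and y are ['X_0] and ['X_1]. *)

Definition Zxy := {mpoly int[2]}.
Definition qvar (c : bool) : Zxy := 'X_(if c then ord_max else ord0).

(* [qnum false n] is [n]_x and [qnum true n] is [n]_y. *)
Fixpoint qnum (c : bool) (n : nat) : Zxy :=
  match n with
  | 0 => 0
  | 1 => 1
  | (n''.+1 as n').+1 => qvar c * qnum (~~ c) n' - qnum c n''
  end.

(* x(d) and y(d), for 0 < d. *)
Definition qvar_at (d : nat) (c : bool) : Zxy := qnum c d.+1 - qnum c d.-1.

(* [n]_{x(d)} and [n]_{y(d)}. *)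
Definition qnum_at (d : nat) (c : bool) (n : nat) : Zxy :=
  qnum c n \mPo [tuple qvar_at d false; qvar_at d true].

(* b is the quotient defining the binomial coefficient of n and j at x(d),
   resp. y(d); it is unique since the denominator is nonzero. *)
Definition is_qbinom (d : nat) (c : bool) (n j : nat) (b : Zxy) : Prop :=
  b * \prod_(i < j) qnum_at d c i.+1 = \prod_(i < j) qnum_at d c (n - i).

Definition eval_xy (k : idomainType) (a b : k) (p : Zxy) : k :=
  mmap (intr : int -> k) (fun i : 'I_2 => if i == ord0 then a else b) p.

Section AbeConditions.
Variables (k : idomainType) (W : groupType) (S : {pred W}).
Variable D : realdata k S.

Definition reflection_stable_Abe : Prop :=
  prerealization D /\
  forall (s t : gens S) (m : nat), s <> t -> has_order (val s * val t)%g m ->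
  forall (v j : nat) (c : bool), (1 < v)%N -> (v %| m)%N -> (1 <= j <= v.-1)%N ->
    exists b, is_qbinom (m %/ v) c v j b /\
              eval_xy (cartan D s t) (cartan D t s) b = 0.

Definition reflection_balanced : Prop :=
  forall (s t : gens S) (m : nat), s <> t -> has_order (val s * val t)%g m ->
  forall (d : nat) (c : bool), (1 <= d < m)%N -> (d %| m)%N ->
    eval_xy (- cartan D s t) (- cartan D t s)
            (qnum_at d c (m %/ d).-1) = 1.

End AbeConditions.

Section SymmetricAlgebra.
Variables (k : idomainType) (W : groupType) (S : {pred W}).
Variable D : realdata k S.

(* Sym(h^* ) is the polynomial ring on the dual of the basis of h provided by
   the [vectType] structure; [lin] is the inclusion of h^*. *)
Definition Sym := {mpoly k[vector.dim (hspace D)]}.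

HB.instance Definition _ := GRing.IntegralDomain.on Sym.

Definition hbasis (i : 'I_(vector.dim (hspace D))) : hspace D :=
  VectorInternalTheory.r2v (delta_mx 0 i).

Definition hcoord (i : 'I_(vector.dim (hspace D))) : 'Hom(hspace D, k^o) :=
  linfun (fun v => VectorInternalTheory.v2r v 0 i : k^o).

Definition lin (l : 'Hom(hspace D, k^o)) : Sym :=
  \sum_i (l (hbasis i) : k) *: 'X_i.

Definition Sact (w : W) : {rmorphism Sym -> Sym} :=
  @comp_mpoly _ _ _
    [tuple lin (wdual w (hcoord i)) | i < vector.dim (hspace D)].

Definition SymGr (i : int) (f : Sym) : Prop :=
  f = 0 \/ exists2 d : nat, i = (d.*2)%:Z & f \is d.-homog.

(* The elements alpha_r, r a reflection; xs > x means l(xs) > l(x). *)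
Definition is_alpha (f : Sym) : Prop :=
  exists (x : W) (s : gens S),
    (ell S x < ell S (x * val s)%g)%N /\ f = lin (wdual x (root D s)).

End SymmetricAlgebra.

Local Notation "x %:F" := (tofrac x).

Section Localization.
Variables (R : idomainType) (A : R -> Prop).

(* loc is the subring R[a^-1 : a \in A] of the field of fractions. *)
Definition in_loc (q : {fraction R}) : Prop :=
  forall P : {fraction R} -> Prop,
    (forall f, P f%:F) -> (forall f, A f -> P (f%:F)^-1) ->
    (forall p q, P p -> P q -> P (p - q)) ->
    (forall p q, P p -> P q -> P (p * q)) -> P q.

Definition loc := {q : {fraction R} | `[< in_loc q >]}.

HB.instance Definition _ := [isSub of loc for @sval _ _].
HB.instance Definition _ := [Choice of loc by <:].

Lemma loc_closed : subring_closed (fun q : {fraction R} => `[< in_loc q >]).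
Proof.
split.
- by apply/asboolP=> P h1 *; rewrite -tofrac1; apply: h1.
- move=> p q /asboolP hp /asboolP hq; apply/asboolP=> P h1 h2 h3 h4.
  by apply: (h3 _ _ (hp P h1 h2 h3 h4) (hq P h1 h2 h3 h4)).
- move=> p q /asboolP hp /asboolP hq; apply/asboolP=> P h1 h2 h3 h4.
  by apply: (h4 _ _ (hp P h1 h2 h3 h4) (hq P h1 h2 h3 h4)).
Qed.

HB.instance Definition _ :=
  GRing.SubChoice_isSubComNzRing.Build {fraction R} _ loc loc_closed.

Lemma in_loc_frac (f : R) : `[< in_loc f%:F >].
Proof. by apply/asboolP=> P h *; apply: h. Qed.

Definition toloc (f : R) : loc :=
  exist (fun q => `[< in_loc q >]) f%:F (in_loc_frac f).

Lemma toloc_zmod : zmod_morphism toloc.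
Proof. by move=> f g; apply: val_inj; rewrite rmorphB /= tofracB. Qed.
Lemma toloc_monoid : monoid_morphism toloc.
Proof.
split=> [|f g]; apply: val_inj; first by rewrite rmorph1 /= tofrac1.
by rewrite rmorphM /= tofracM.
Qed.
HB.instance Definition _ := GRing.isZmodMorphism.Build R loc toloc toloc_zmod.
HB.instance Definition _ :=
  GRing.isMonoidMorphism.Build R loc toloc toloc_monoid.

End Localization.

Section InvariantsAndQ.
Variables (k : idomainType) (W : groupType) (S : {pred W}).
Variable D : realdata k S.

Definition locQ := loc (@is_alpha k W S D).
HB.instance Definition _ := GRing.ComNzRing.on locQ.

Definition toQ : {rmorphism Sym D -> locQ} := @toloc _ _.

Definition QGr (i : int) (q : locQ) : Prop :=
  q = 0 \/ exists (f g : Sym D) (d e : nat),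
    [/\ i = (d.*2)%:Z - (e.*2)%:Z, f \is d.-homog, g \is e.-homog, g != 0
      & val q = f%:F / g%:F].

Definition invR (w : W) := {f : Sym D | Sact D w f == f}.

HB.instance Definition _ w := [isSub of invR w for @sval _ _].
HB.instance Definition _ w := [Choice of invR w by <:].

Lemma invR_closed w : subring_closed (fun f : Sym D => Sact D w f == f).
Proof.
split; rewrite /in_mem /=.
- by rewrite rmorph1.
- by move=> f g /eqP hf /eqP hg; apply/eqP; rewrite rmorphB /= hf hg.
- by move=> f g /eqP hf /eqP hg; apply/eqP; rewrite rmorphM /= hf hg.
Qed.

HB.instance Definition _ w :=
  GRing.SubChoice_isSubComNzRing.Build (Sym D) _ (invR w) (invR_closed w).

Definition invR_val w : {rmorphism invR w -> Sym D} := val.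

End InvariantsAndQ.

#[local] Obligation Tactic := idtac.

Record bimod (A B : comNzRingType) := Bimod {
  bm_car :> zmodType;
  lmul : A -> bm_car -> bm_car;
  rmul : bm_car -> B -> bm_car;
  lmulDr : forall a m n, lmul a (m + n) = lmul a m + lmul a n;
  lmulDl : forall a b m, lmul (a + b) m = lmul a m + lmul b m;
  lmul1 : forall m, lmul 1 m = m;
  lmulA : forall a b m, lmul a (lmul b m) = lmul (a * b) m;
  rmulDl : forall m n b, rmul (m + n) b = rmul m b + rmul n b;
  rmulDr : forall m a b, rmul m (a + b) = rmul m a + rmul m b;
  rmul1 : forall m, rmul m 1 = m;
  rmulA : forall m a b, rmul (rmul m a) b = rmul m (a * b);
  lrmulA : forall a m b, rmul (lmul a m) b = lmul a (rmul m b)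
}.

Notation "a *< m" := (lmul a m) (at level 40, left associativity) : ring_scope.
Notation "m >* b" := (rmul m b) (at level 40, left associativity) : ring_scope.

Record bhom (A B : comNzRingType) (M N : bimod A B) := BHom {
  bh_fun :> M -> N;
  bhD : forall m n, bh_fun (m + n) = bh_fun m + bh_fun n;
  bhl : forall a m, bh_fun (a *< m) = a *< bh_fun m;
  bhr : forall m b, bh_fun (m >* b) = bh_fun m >* b
}.

Lemma additive_0 (U V : zmodType) (f : U -> V) :
  (forall x y, f (x + y) = f x + f y) -> f 0 = 0.
Proof. by move=> fD; apply: (addrI (f 0)); rewrite -fD !addr0. Qed.

Lemma additive_N (U V : zmodType) (f : U -> V) :
  (forall x y, f (x + y) = f x + f y) -> forall x, f (- x) = - f x.
Proof.
move=> fD x; apply: (addrI (f x)).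
by rewrite -fD !subrr (additive_0 fD).
Qed.

Section BimodTheory.
Variables A B : comNzRingType.

Section One.
Variable M : bimod A B.

Lemma lmul0r (a : A) : a *< (0 : M) = 0.
Proof. exact: (@additive_0 M M _ (lmulDr a)). Qed.
Lemma lmulNr (a : A) (m : M) : a *< (- m) = - (a *< m).
Proof. exact: (@additive_N M M _ (lmulDr a)). Qed.
Lemma rmul0l (b : B) : (0 : M) >* b = 0.
Proof. exact: (@additive_0 M M _ (fun m n => rmulDl m n b)). Qed.
Lemma rmulNl (m : M) (b : B) : (- m) >* b = - (m >* b).
Proof. exact: (@additive_N M M _ (fun m n => rmulDl m n b)). Qed.
Lemma lmul0l (m : M) : (0 : A) *< m = 0.
Proof. exact: (@additive_0 A M _ (fun a b => lmulDl a b m)). Qed.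
Lemma rmul0r (m : M) : m >* (0 : B) = 0.
Proof. exact: (@additive_0 B M _ (rmulDr m)). Qed.
End One.

Lemma bhP (M N : bimod A B) (f g : bhom M N) : (forall m, f m = g m) -> f = g.
Proof.
case: f g => [f fD fl fr] [g gD gl gr] /= /funext E.
by move: gD gl gr; rewrite -E => *; congr BHom; apply: Prop_irrelevance.
Qed.

Lemma bh0 (M N : bimod A B) (f : bhom M N) : f 0 = 0.
Proof. exact: (additive_0 (bhD f)). Qed.
Lemma bhN (M N : bimod A B) (f : bhom M N) m : f (- m) = - f m.
Proof. exact: (additive_N (bhD f)). Qed.

Definition bhid (M : bimod A B) : bhom M M :=
  @BHom A B M M id (fun _ _ => erefl) (fun _ _ => erefl) (fun _ _ => erefl).

Program Definition bhcomp (M N P : bimod A B) (g : bhom N P) (f : bhom M N) :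
  bhom M P := @BHom A B M P (fun m => g (f m)) _ _ _.
Next Obligation. by move=> * /=; rewrite !bhD. Qed.
Next Obligation. by move=> * /=; rewrite !bhl. Qed.
Next Obligation. by move=> * /=; rewrite !bhr. Qed.

Definition subbimod (M : bimod A B) (P : M -> Prop) : Prop :=
  [/\ P 0, forall m n, P m -> P n -> P (m - n),
      forall a m, P m -> P (a *< m) & forall m b, P m -> P (m >* b)].

End BimodTheory.

(* T as an (A, B)-bimodule through f : A -> T and g : B -> T. *)
Program Definition ring_bimod (A B T : comNzRingType)
    (f : {rmorphism A -> T}) (g : {rmorphism B -> T}) : bimod A B :=
  @Bimod A B T (fun a t => f a * t) (fun t b => t * g b)
         _ _ _ _ _ _ _ _ _.
Next Obligation. by move=> * /=; rewrite mulrDr. Qed.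
Next Obligation. by move=> * /=; rewrite rmorphD mulrDl. Qed.
Next Obligation. by move=> * /=; rewrite rmorph1 mul1r. Qed.
Next Obligation. by move=> * /=; rewrite rmorphM mulrA. Qed.
Next Obligation. by move=> * /=; rewrite mulrDl. Qed.
Next Obligation. by move=> * /=; rewrite rmorphD mulrDr. Qed.
Next Obligation. by move=> * /=; rewrite rmorph1 mulr1. Qed.
Next Obligation. by move=> * /=; rewrite rmorphM mulrA. Qed.
Next Obligation. by move=> * /=; rewrite mulrA. Qed.

Program Definition restr (A B A' B' : comNzRingType)
    (f : {rmorphism A' -> A}) (g : {rmorphism B' -> B}) (M : bimod A B) :
    bimod A' B' :=
  @Bimod A' B' M (fun a m => f a *< m) (fun m b => m >* g b)
         _ _ _ _ _ _ _ _ _.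
Next Obligation. by move=> * /=; rewrite lmulDr. Qed.
Next Obligation. by move=> * /=; rewrite rmorphD lmulDl. Qed.
Next Obligation. by move=> * /=; rewrite rmorph1 lmul1. Qed.
Next Obligation. by move=> * /=; rewrite rmorphM lmulA. Qed.
Next Obligation. by move=> * /=; rewrite rmulDl. Qed.
Next Obligation. by move=> * /=; rewrite rmorphD rmulDr. Qed.
Next Obligation. by move=> * /=; rewrite rmorph1 rmul1. Qed.
Next Obligation. by move=> * /=; rewrite rmorphM rmulA. Qed.
Next Obligation. by move=> * /=; rewrite lrmulA. Qed.

Inductive addspan (V : zmodType) (P : V -> Prop) : V -> Prop :=
| Span0 : addspan P 0
| SpanG v : P v -> addspan P v
| SpanB v w : addspan P v -> addspan P w -> addspan P (v - w).

Lemma addspanD (V : zmodType) (P : V -> Prop) v w :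
  addspan P v -> addspan P w -> addspan P (v + w).
Proof.
move=> hv hw; rewrite -[w]opprK; apply: SpanB => //.
by rewrite -sub0r; apply: SpanB => //; apply: Span0.
Qed.

Lemma addspan_map (U V : zmodType) (P : U -> Prop) (Q : V -> Prop) (f : U -> V) :
  (forall x y, f (x + y) = f x + f y) ->
  Q 0 -> (forall x y, Q x -> Q y -> Q (x - y)) ->
  (forall u, P u -> Q (f u)) -> forall u, addspan P u -> Q (f u).
Proof.
move=> fD Q0 QB PQ u; elim=> [|v /PQ //|v w _ hv _ hw].
  by rewrite (additive_0 fD).
by rewrite fD (additive_N fD); apply: QB.
Qed.

Section Tensor.
Variables A B C : comNzRingType.
Variables (M : bimod A B) (N : bimod B C).

Definition balanced (G : zmodType) (f : M -> N -> G) : Prop :=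
  [/\ forall m m' n, f (m + m') n = f m n + f m' n,
      forall m n n', f m (n + n') = f m n + f m n'
    & forall m b n, f (m >* b) n = f m (b *< n)].

Definition fsum (G : zmodType) (f : M -> N -> G) (u : seq (M * N)) : G :=
  \sum_(p <- u) f p.1 p.2.

(* The tensor product is made of the formal sums of pairs, two of them being
   identified when no balanced map tells them apart. *)
Definition tens_eqv (u v : seq (M * N)) : bool :=
  `[< forall (G : zmodType) (f : M -> N -> G), balanced f ->
        fsum f u = fsum f v >].

Lemma tens_eqv_equiv : equiv_class_of tens_eqv.
Proof.
split.
- by move=> u; apply/asboolP.
- by move=> u v; apply/asboolP/asboolP => h G f bf; rewrite h.
- move=> v u w /asboolP huv /asboolP hvw; apply/asboolP => G f bf.
  by rewrite huv // hvw.
Qed.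

Canonical tens_equiv := EquivRelPack tens_eqv_equiv.

Definition tens_car := {eq_quot tens_equiv}.

HB.instance Definition _ := Choice.on tens_car.
HB.instance Definition _ := EqQuotient.on tens_car.

Definition tens_rec (G : zmodType) (f : M -> N -> G) (x : tens_car) : G :=
  fsum f (repr x).

Lemma tens_recE (G : zmodType) (f : M -> N -> G) u : balanced f ->
  tens_rec f (\pi_tens_car u) = fsum f u.
Proof.
move=> bf; rewrite /tens_rec; case: piP => v /eqmodP /asboolP h.
by rewrite h.
Qed.

Lemma tens_recP (x y : tens_car) :
  (forall (G : zmodType) (f : M -> N -> G), balanced f ->
     tens_rec f x = tens_rec f y) -> x = y.
Proof.
elim/quotW: x => u; elim/quotW: y => v h.
apply/eqmodP/asboolP => G f bf.
by rewrite -!tens_recE // h.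
Qed.

Definition tzero : tens_car := \pi_tens_car [::].
Definition tadd (x y : tens_car) : tens_car := \pi_tens_car (repr x ++ repr y).
Definition topp (x : tens_car) : tens_car :=
  \pi_tens_car [seq (- p.1, p.2) | p <- repr x].

Lemma tens_rec_zero (G : zmodType) (f : M -> N -> G) :
  balanced f -> tens_rec f tzero = 0.
Proof. by move=> bf; rewrite tens_recE // /fsum big_nil. Qed.

Lemma tens_rec_add (G : zmodType) (f : M -> N -> G) x y :
  balanced f -> tens_rec f (tadd x y) = tens_rec f x + tens_rec f y.
Proof. by move=> bf; rewrite tens_recE // /fsum big_cat. Qed.

Lemma tens_rec_opp (G : zmodType) (f : M -> N -> G) x :
  balanced f -> tens_rec f (topp x) = - tens_rec f x.
Proof.
move=> bf; rewrite tens_recE // /fsum big_map -sumrN.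
by apply: eq_bigr => p _ /=; case: bf => h _ _;
  rewrite (additive_N (fun m m' => h m m' p.2)).
Qed.

Lemma taddA : associative tadd.
Proof. by move=> x y z; apply: tens_recP => G f bf; rewrite !tens_rec_add // addrA. Qed.
Lemma taddC : commutative tadd.
Proof. by move=> x y; apply: tens_recP => G f bf; rewrite !tens_rec_add // addrC. Qed.
Lemma tadd0 : left_id tzero tadd.
Proof.
by move=> x; apply: tens_recP => G f bf; rewrite tens_rec_add // tens_rec_zero ?add0r.
Qed.
Lemma taddN : left_inverse tzero topp tadd.
Proof.
move=> x; apply: tens_recP => G f bf.
by rewrite tens_rec_add // tens_rec_opp // tens_rec_zero ?addNr.
Qed.

HB.instance Definition _ :=
  GRing.isZmodule.Build tens_car taddA taddC tadd0 taddN.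

Definition pure (m : M) (n : N) : tens_car := \pi_tens_car [:: (m, n)].

Lemma tens_rec_pure (G : zmodType) (f : M -> N -> G) m n :
  balanced f -> tens_rec f (pure m n) = f m n.
Proof. by move=> bf; rewrite tens_recE // /fsum big_seq1. Qed.

Lemma tens_recD (G : zmodType) (f : M -> N -> G) (bf : balanced f) x y :
  tens_rec f (x + y) = tens_rec f x + tens_rec f y.
Proof. exact: tens_rec_add. Qed.

Lemma pure_balanced : balanced pure.
Proof.
split=> *; apply: tens_recP => G f bf;
  rewrite ?(tens_recD bf) !tens_rec_pure //; by case: bf.
Qed.

Lemma pureDl m m' n : pure (m + m') n = pure m n + pure m' n.
Proof. by case: pure_balanced. Qed.
Lemma pureDr m n n' : pure m (n + n') = pure m n + pure m n'.
Proof. by case: pure_balanced. Qed.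
Lemma pureA m b n : pure (m >* b) n = pure m (b *< n).
Proof. by case: pure_balanced. Qed.

Lemma tens_ind (P : tens_car -> Prop) :
  (forall m n, P (pure m n)) -> (forall x y, P x -> P y -> P (x + y)) ->
  forall x, P x.
Proof.
move=> hp hD; elim/quotW => u.
have h0 : P 0.
  have <- : pure 0 0 = 0; last exact: hp.
  exact: (additive_0 (fun m m' => pureDl m m' 0)).
elim: u => [|[m n] u IH]; first exact: h0.
suff -> : \pi_tens_car ((m, n) :: u) = pure m n + \pi_tens_car u by apply: hD.
apply: tens_recP => G f bf.
by rewrite (tens_recD bf) tens_rec_pure // !tens_recE // /fsum big_cons.
Qed.

Lemma tens_ext (G : zmodType) (f g : tens_car -> G) :
  (forall x y, f (x + y) = f x + f y) -> (forall x y, g (x + y) = g x + g y) ->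
  (forall m n, f (pure m n) = g (pure m n)) -> forall x, f x = g x.
Proof.
move=> fD gD E; elim/tens_ind => // x y hx hy; by rewrite fD gD hx hy.
Qed.

Definition tens_lmul (a : A) : tens_car -> tens_car :=
  tens_rec (fun m n => pure (a *< m) n).
Definition tens_rmul (x : tens_car) (c : C) : tens_car :=
  tens_rec (fun m n => pure m (n >* c)) x.

Lemma tens_lmul_bal a : balanced (fun m n => pure (a *< m) n).
Proof.
by split=> *; rewrite ?lmulDr ?lrmulA ?pureDl ?pureDr -?lrmulA ?pureA.
Qed.
Lemma tens_rmul_bal c : balanced (fun m n => pure m (n >* c)).
Proof.
by split=> *; rewrite ?rmulDl ?pureDl ?pureDr ?pureA -?lrmulA.
Qed.

Lemma tens_lmul_pure a m n : tens_lmul a (pure m n) = pure (a *< m) n.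
Proof. exact: tens_rec_pure (tens_lmul_bal a). Qed.
Lemma tens_rmul_pure c m n : tens_rmul (pure m n) c = pure m (n >* c).
Proof. exact: tens_rec_pure (tens_rmul_bal c). Qed.
Lemma tens_lmulD a x y : tens_lmul a (x + y) = tens_lmul a x + tens_lmul a y.
Proof. exact: tens_recD (tens_lmul_bal a) x y. Qed.
Lemma tens_rmulD c x y : tens_rmul (x + y) c = tens_rmul x c + tens_rmul y c.
Proof. exact: tens_recD (tens_rmul_bal c) x y. Qed.

Program Definition tens : bimod A C :=
  @Bimod A C tens_car tens_lmul tens_rmul _ _ _ _ _ _ _ _ _.
Next Obligation. exact: tens_lmulD. Qed.
Next Obligation.
move=> a b; apply: tens_ind => [m n|x y hx hy].
  by rewrite !tens_lmul_pure lmulDl pureDl.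
by rewrite !tens_lmulD hx hy addrACA.
Qed.
Next Obligation.
apply: tens_ind => [m n|x y hx hy].
  by rewrite !tens_lmul_pure lmul1.
by rewrite !tens_lmulD hx hy.
Qed.
Next Obligation.
move=> a b; apply: tens_ind => [m n|x y hx hy].
  by rewrite !tens_lmul_pure lmulA.
by rewrite !tens_lmulD hx hy.
Qed.
Next Obligation. by move=> *; apply: tens_rmulD. Qed.
Next Obligation.
move=> x a b; elim/tens_ind: x => [m n|x y hx hy].
  by rewrite !tens_rmul_pure rmulDr pureDr.
by rewrite !tens_rmulD hx hy addrACA.
Qed.
Next Obligation.
apply: tens_ind => [m n|x y hx hy].
  by rewrite !tens_rmul_pure rmul1.
by rewrite !tens_rmulD hx hy.
Qed.
Next Obligation.
move=> x a b; elim/tens_ind: x => [m n|x y hx hy].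
  by rewrite !tens_rmul_pure rmulA.
by rewrite !tens_rmulD hx hy.
Qed.
Next Obligation.
move=> a x b; elim/tens_ind: x => [m n|x y hx hy].
  by rewrite !(tens_rmul_pure, tens_lmul_pure).
by rewrite !(tens_rmulD, tens_lmulD) hx hy.
Qed.

Definition tpure (m : M) (n : N) : tens := pure m n.

Lemma tind (P : tens -> Prop) :
  (forall m n, P (tpure m n)) -> (forall x y, P x -> P y -> P (x + y)) ->
  forall x, P x.
Proof. exact: tens_ind. Qed.

Lemma text (G : zmodType) (f g : tens -> G) :
  (forall x y, f (x + y) = f x + f y) -> (forall x y, g (x + y) = g x + g y) ->
  (forall m n, f (tpure m n) = g (tpure m n)) -> forall x, f x = g x.
Proof. exact: tens_ext. Qed.

Lemma tpureDl m m' n : tpure (m + m') n = tpure m n + tpure m' n.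
Proof. exact: pureDl. Qed.
Lemma tpureDr m n n' : tpure m (n + n') = tpure m n + tpure m n'.
Proof. exact: pureDr. Qed.
Lemma tpureA m b n : tpure (m >* b) n = tpure m (b *< n).
Proof. exact: pureA. Qed.
Lemma tpure_l a m n : a *< tpure m n = tpure (a *< m) n.
Proof. exact: tens_lmul_pure. Qed.
Lemma tpure_r m n c : tpure m n >* c = tpure m (n >* c).
Proof. exact: tens_rmul_pure. Qed.

Program Definition tens_hom (P : bimod A C) (f : M -> N -> P) (bf : balanced f)
    (fl : forall a m n, f (a *< m) n = a *< f m n)
    (fr : forall m n c, f m (n >* c) = f m n >* c) : bhom tens P :=
  @BHom A C tens P (tens_rec f) (tens_recD bf) _ _.
Next Obligation.
move=> P f bf fl fr a; apply: tens_ind => [m n|x y hx hy].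
  by rewrite (tpure_l a m n) !tens_rec_pure.
by rewrite lmulDr !(tens_recD bf) hx hy lmulDr.
Qed.
Next Obligation.
move=> P f bf fl fr x c; elim/tens_ind: x => [m n|x y hx hy].
  by rewrite (tpure_r m n c) !tens_rec_pure.
by rewrite rmulDl !(tens_recD bf) hx hy rmulDl.
Qed.

Lemma tens_homE (P : bimod A C) (f : M -> N -> P) bf fl fr m n :
  @tens_hom P f bf fl fr (tpure m n) = f m n.
Proof. exact: tens_rec_pure. Qed.

Lemma tens_hom_ext (P : bimod A C) (f g : bhom tens P) :
  (forall m n, f (tpure m n) = g (tpure m n)) -> forall x, f x = g x.
Proof. by move=> E; exact: (@tens_ext P f g (bhD f) (bhD g) E). Qed.

(* Used both for the Z-gradings and for the pieces indexed by W. *)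
Definition tens_gr (I : Type) (op : I -> I -> I)
    (gM : I -> M -> Prop) (gN : I -> N -> Prop) (i : I) : tens -> Prop :=
  addspan (fun t => exists j l m n,
    [/\ op j l = i, gM j m, gN l n & t = tpure m n]).

End Tensor.

Arguments tens : simpl never.
Arguments tpure : simpl never.

Section TensorMaps.
Variables A B C : comNzRingType.

Program Definition tens_map (M M' : bimod A B) (N N' : bimod B C)
    (f : bhom M M') (g : bhom N N') : bhom (tens M N) (tens M' N') :=
  @tens_hom _ _ _ _ _ _ (fun m n => tpure (f m) (g n)) _ _ _.
Next Obligation.
by move=> M M' N N' f g; split=> *; rewrite ?bhD ?tpureDl ?tpureDr // bhr bhl tpureA.
Qed.
Next Obligation. by move=> M M' N N' f g a m n; cbv beta; rewrite bhl tpure_l. Qed.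
Next Obligation. by move=> M M' N N' f g m n c; cbv beta; rewrite bhr tpure_r. Qed.

Lemma tens_mapE (M M' : bimod A B) (N N' : bimod B C)
    (f : bhom M M') (g : bhom N N') m n :
  tens_map f g (tpure m n) = tpure (f m) (g n).
Proof. exact: tens_homE. Qed.

End TensorMaps.

Section Associator.
Variables A B C D : comNzRingType.
Variables (M : bimod A B) (N : bimod B C) (P : bimod C D).

Lemma tassoc1_bal (p : P) :
  balanced (fun (m : M) (n : N) => tpure m (tpure n p)).
Proof.
by split=> *; rewrite ?tpureDl ?tpureDr // tpureA tpure_l.
Qed.
Definition tassoc1 (t : tens M N) (p : P) : tens M (tens N P) :=
  tens_rec (fun m n => tpure m (tpure n p)) t.
Lemma tassoc1E m n p : tassoc1 (tpure m n) p = tpure m (tpure n p).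
Proof. exact: tens_rec_pure (tassoc1_bal p). Qed.
Lemma tassoc1D x y p : tassoc1 (x + y) p = tassoc1 x p + tassoc1 y p.
Proof. exact: tens_recD (tassoc1_bal p) x y. Qed.

Lemma tassoc_bal : balanced tassoc1.
Proof.
split=> [||t c p]; first by move=> *; apply: tassoc1D.
- elim/tind => [m n p q|x y hx hy p q].
    by rewrite !(tassoc1E m n) tpureDr tpureDr.
  by rewrite !tassoc1D hx hy addrACA.
- elim/tind: t => [m n|x y hx hy].
    by rewrite (tpure_r m n c) (tassoc1E m (n >* c)) (tassoc1E m n) tpureA.
  by rewrite rmulDl !tassoc1D hx hy.
Qed.

Program Definition tassoc : bhom (tens (tens M N) P) (tens M (tens N P)) :=
  @tens_hom _ _ _ _ _ _ tassoc1 tassoc_bal _ _.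
Next Obligation.
move=> a t p; elim/tind: t => [m n|x y hx hy].
  by rewrite (tpure_l a m n) (tassoc1E (a *< m)) (tassoc1E m n) tpure_l.
by rewrite lmulDr !tassoc1D hx hy lmulDr.
Qed.
Next Obligation.
move=> t p d; elim/tind: t => [m n|x y hx hy].
  by rewrite !(tassoc1E m n) !tpure_r.
by rewrite !tassoc1D hx hy rmulDl.
Qed.

Lemma tassocE m n p : tassoc (tpure (tpure m n) p) = tpure m (tpure n p).
Proof. by rewrite tens_homE tassoc1E. Qed.

Lemma tassoci1_bal (m : M) :
  balanced (fun (n : N) (p : P) => tpure (tpure m n) p).
Proof.
split=> *; rewrite ?tpureDr ?tpureDl ?tpureDr //.
by rewrite -tpure_r tpureA.
Qed.
Definition tassoci1 (m : M) (t : tens N P) : tens (tens M N) P :=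
  tens_rec (fun n p => tpure (tpure m n) p) t.
Lemma tassoci1E m n p : tassoci1 m (tpure n p) = tpure (tpure m n) p.
Proof. exact: tens_rec_pure (tassoci1_bal m). Qed.
Lemma tassoci1D m x y : tassoci1 m (x + y) = tassoci1 m x + tassoci1 m y.
Proof. exact: tens_recD (tassoci1_bal m) x y. Qed.

Lemma tassoci_bal : balanced tassoci1.
Proof.
split=> [m m' t||m b t]; last 1 first.
- elim/tind: t => [n p|x y hx hy].
    by rewrite (tpure_l b n p) (tassoci1E m (b *< n)) (tassoci1E _ n) tpureA.
  by rewrite lmulDr !tassoci1D hx hy.
- elim/tind: t => [n p|x y hx hy].
    by rewrite !(tassoci1E _ n p) !tpureDl.
  by rewrite !tassoci1D hx hy addrACA.
- by move=> *; apply: tassoci1D.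
Qed.

Program Definition tassoci : bhom (tens M (tens N P)) (tens (tens M N) P) :=
  @tens_hom _ _ _ _ _ _ tassoci1 tassoci_bal _ _.
Next Obligation.
move=> a m t; elim/tind: t => [n p|x y hx hy].
  by rewrite !(tassoci1E _ n p) !tpure_l.
by rewrite !tassoci1D hx hy lmulDr.
Qed.
Next Obligation.
move=> m t d; elim/tind: t => [n p|x y hx hy].
  by rewrite (tpure_r n p d) (tassoci1E _ n (p >* d)) (tassoci1E _ n p) tpure_r.
by rewrite rmulDl !tassoci1D hx hy rmulDl.
Qed.

Lemma tassociE m n p : tassoci (tpure m (tpure n p)) = tpure (tpure m n) p.
Proof. by rewrite tens_homE tassoci1E. Qed.

End Associator.

Section TripleExt.
Variables A B C D : comNzRingType.
Variables (M : bimod A B) (N : bimod B C) (P : bimod C D).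

Lemma tens_ext3l (G : zmodType) (f g : tens (tens M N) P -> G) :
  (forall x y, f (x + y) = f x + f y) -> (forall x y, g (x + y) = g x + g y) ->
  (forall m n p, f (tpure (tpure m n) p) = g (tpure (tpure m n) p)) ->
  forall x, f x = g x.
Proof.
move=> fD gD E; apply: (tens_ext fD gD) => t p.
elim/tind: t => [m n|x y hx hy]; first exact: E.
by rewrite [pure _ _]tpureDl fD gD hx hy.
Qed.

Lemma tens_ext3r (G : zmodType) (f g : tens M (tens N P) -> G) :
  (forall x y, f (x + y) = f x + f y) -> (forall x y, g (x + y) = g x + g y) ->
  (forall m n p, f (tpure m (tpure n p)) = g (tpure m (tpure n p))) ->
  forall x, f x = g x.
Proof.
move=> fD gD E; apply: (tens_ext fD gD) => m t.
elim/tind: t => [n p|x y hx hy]; first exact: E.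
by rewrite [pure _ _]tpureDr fD gD hx hy.
Qed.

End TripleExt.

Section Unitors.
Variables A B : comNzRingType.

Definition regular_bimod (T : comNzRingType) : bimod T T :=
  ring_bimod (idfun : {rmorphism T -> T}) (idfun : {rmorphism T -> T}).

Variable M : bimod A B.

Program Definition tlun : bhom (tens (regular_bimod A) M) M :=
  @tens_hom _ _ _ _ _ _ (fun (a : regular_bimod A) m => (a : A) *< m) _ _ _.
Next Obligation. by split=> *; rewrite ?lmulDl ?lmulDr //= lmulA. Qed.
Next Obligation. by move=> * /=; rewrite lmulA. Qed.
Next Obligation. by move=> * /=; rewrite lrmulA. Qed.

Lemma tlunE (a : regular_bimod A) m : tlun (tpure a m) = (a : A) *< m.
Proof. exact: tens_homE. Qed.

Program Definition tluni : bhom M (tens (regular_bimod A) M) :=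
  @BHom _ _ _ _ (fun m => tpure (1 : regular_bimod A) m) _ _ _.
Next Obligation. by move=> *; apply: tpureDr. Qed.
Next Obligation.
by move=> a m; cbv beta; rewrite tpure_l -tpureA /= mul1r mulr1.
Qed.
Next Obligation. by move=> *; cbv beta; rewrite tpure_r. Qed.

Lemma tluniE m : tluni m = tpure (1 : regular_bimod A) m.
Proof. by []. Qed.

Program Definition trun : bhom (tens M (regular_bimod B)) M :=
  @tens_hom _ _ _ _ _ _ (fun m (b : regular_bimod B) => m >* (b : B)) _ _ _.
Next Obligation. by split=> *; rewrite ?rmulDl ?rmulDr //= rmulA. Qed.
Next Obligation. by move=> * /=; rewrite lrmulA. Qed.
Next Obligation. by move=> * /=; rewrite rmulA. Qed.

Lemma trunE m (b : regular_bimod B) : trun (tpure m b) = m >* (b : B).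
Proof. exact: tens_homE. Qed.

Program Definition truni : bhom M (tens M (regular_bimod B)) :=
  @BHom _ _ _ _ (fun m => tpure m (1 : regular_bimod B)) _ _ _.
Next Obligation. by move=> *; apply: tpureDl. Qed.
Next Obligation. by move=> *; cbv beta; rewrite tpure_l. Qed.
Next Obligation.
by move=> m b; cbv beta; rewrite tpure_r tpureA /= mul1r mulr1.
Qed.

Lemma truniE m : truni m = tpure m (1 : regular_bimod B).
Proof. by []. Qed.

End Unitors.

Record category := Category {
  ob :> Type;
  hom : ob -> ob -> Type;
  idc : forall X, hom X X;
  cmp : forall X Y Z, hom Y Z -> hom X Y -> hom X Z;
  cmpA : forall X Y Z T (h : hom Z T) (g : hom Y Z) (f : hom X Y),
    cmp h (cmp g f) = cmp (cmp h g) f;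
  cmp1l : forall X Y (f : hom X Y), cmp (idc Y) f = f;
  cmp1r : forall X Y (f : hom X Y), cmp f (idc X) = f
}.

Arguments hom {c} X Y.
Arguments idc {c} X.
Arguments cmp {c X Y Z} g f.
Local Notation "g \oc f" := (cmp g f) (at level 50, left associativity).

Definition inverse (C : category) (X Y : C) (f : hom X Y) (g : hom Y X) : Prop :=
  g \oc f = idc X /\ f \oc g = idc Y.

Definition isomorphic (C : category) (X Y : C) : Prop :=
  exists (f : hom X Y) (g : hom Y X), inverse f g.

Record functor (C D : category) := Functor {
  fob :> C -> D;
  fmap : forall X Y, hom X Y -> hom (fob X) (fob Y);
  fmap1 : forall X, fmap (idc X) = idc (fob X);
  fmapM : forall X Y Z (g : hom Y Z) (f : hom X Y),
    fmap (g \oc f) = fmap g \oc fmap f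
}.

Definition idF (C : category) : functor C C :=
  @Functor C C id (fun _ _ f => f) (fun _ => erefl) (fun _ _ _ _ _ => erefl).

Program Definition compF (C D E : category) (G : functor D E) (F : functor C D) :
  functor C E := @Functor C E (fun X => G (F X)) (fun _ _ f => fmap G (fmap F f)) _ _.
Next Obligation. by move=> * /=; rewrite !fmap1. Qed.
Next Obligation. by move=> * /=; rewrite !fmapM. Qed.

Definition naturally_isomorphic (C D : category) (F G : functor C D) : Prop :=
  exists (a : forall X, hom (F X) (G X)) (b : forall X, hom (G X) (F X)),
    (forall X, inverse (a X) (b X)) /\
    (forall X Y (f : hom X Y), a Y \oc fmap F f = fmap G f \oc a X).

Definition is_equivalence (C D : category) (F : functor C D) : Prop :=
  exists G : functor D C,
    naturally_isomorphic (compF G F) (idF C) /\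
    naturally_isomorphic (compF F G) (idF D).

Record monoidal := Monoidal {
  mcat :> category;
  ten : mcat -> mcat -> mcat;
  tmap : forall X X' Y Y', hom X X' -> hom Y Y' -> hom (ten X Y) (ten X' Y');
  tmap1 : forall X Y, tmap (idc X) (idc Y) = idc (ten X Y);
  tmapM : forall X X' X'' Y Y' Y'' (f' : hom X' X'') (f : hom X X')
      (g' : hom Y' Y'') (g : hom Y Y'),
    tmap (f' \oc f) (g' \oc g) = tmap f' g' \oc tmap f g;
  munit : mcat;
  massoc : forall X Y Z, hom (ten (ten X Y) Z) (ten X (ten Y Z));
  massoci : forall X Y Z, hom (ten X (ten Y Z)) (ten (ten X Y) Z);
  massocK : forall X Y Z, inverse (massoc X Y Z) (massoci X Y Z);
  massoc_nat : forall X X' Y Y' Z Z' (f : hom X X') (g : hom Y Y') (h : hom Z Z'),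
    massoc X' Y' Z' \oc tmap (tmap f g) h = tmap f (tmap g h) \oc massoc X Y Z;
  mlun : forall X, hom (ten munit X) X;
  mluni : forall X, hom X (ten munit X);
  mlunK : forall X, inverse (mlun X) (mluni X);
  mlun_nat : forall X Y (f : hom X Y),
    mlun Y \oc tmap (idc munit) f = f \oc mlun X;
  mrun : forall X, hom (ten X munit) X;
  mruni : forall X, hom X (ten X munit);
  mrunK : forall X, inverse (mrun X) (mruni X);
  mrun_nat : forall X Y (f : hom X Y),
    mrun Y \oc tmap f (idc munit) = f \oc mrun X;
  mpentagon : forall X Y Z T,
    massoc X Y (ten Z T) \oc massoc (ten X Y) Z T
    = tmap (idc X) (massoc Y Z T) \oc massoc X (ten Y Z) T
      \oc tmap (massoc X Y Z) (idc T);
  mtriangle : forall X Y,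
    tmap (idc X) (mlun Y) \oc massoc X munit Y = tmap (mrun X) (idc Y)
}.

Arguments ten {m} X Y.
Arguments tmap {m X X' Y Y'} f g.
Arguments munit {m}.

Record monoidal_functor (C D : monoidal) := MonoidalFunctor {
  mfun :> functor C D;
  mu : forall X Y, hom (ten (mfun X) (mfun Y)) (mfun (ten X Y));
  mu_iso : forall X Y, exists mui, inverse (mu X Y) mui;
  mu_nat : forall X X' Y Y' (f : hom X X') (g : hom Y Y'),
    mu X' Y' \oc tmap (fmap mfun f) (fmap mfun g)
    = fmap mfun (tmap f g) \oc mu X Y;
  eps : hom munit (mfun munit);
  eps_iso : exists epsi, inverse eps epsi;
  mu_assoc : forall X Y Z,
    fmap mfun (massoc X Y Z) \oc mu (ten X Y) Z \oc tmap (mu X Y) (idc (mfun Z))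
    = mu X (ten Y Z) \oc tmap (idc (mfun X)) (mu Y Z)
      \oc massoc (mfun X) (mfun Y) (mfun Z);
  mu_lun : forall X,
    fmap mfun (mlun X) \oc mu munit X \oc tmap eps (idc (mfun X)) = mlun (mfun X);
  mu_run : forall X,
    fmap mfun (mrun X) \oc mu X munit \oc tmap (idc (mfun X)) eps = mrun (mfun X)
}.

Definition tensor_closed (C : monoidal) (P : C -> Prop) : Prop :=
  P munit /\ forall X Y, P X -> P Y -> P (ten X Y).

Definition full_category (C : category) (P : C -> Prop) : category :=
  @Category {X : C | P X} (fun X Y => hom (sval X) (sval Y))
    (fun X => idc (sval X)) (fun _ _ _ g f => g \oc f)
    (fun _ _ _ _ h g f => cmpA h g f)
    (fun _ _ f => cmp1l f) (fun _ _ f => cmp1r f).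

Definition full_monoidal (C : monoidal) (P : C -> Prop) (h : tensor_closed P) :
  monoidal :=
  @Monoidal (full_category P)
    (fun X Y => exist P (ten (sval X) (sval Y)) (h.2 _ _ (svalP X) (svalP Y)))
    (fun _ _ _ _ f g => @tmap C _ _ _ _ f g)
    (fun X Y => tmap1 (sval X) (sval Y))
    (fun _ _ _ _ _ _ f' f g' g => @tmapM C _ _ _ _ _ _ f' f g' g)
    (exist P munit h.1)
    (fun X Y Z => massoc (sval X) (sval Y) (sval Z))
    (fun X Y Z => massoci (sval X) (sval Y) (sval Z))
    (fun X Y Z => massocK (sval X) (sval Y) (sval Z))
    (fun _ _ _ _ _ _ f g k => @massoc_nat C _ _ _ _ _ _ f g k)
    (fun X => mlun (sval X)) (fun X => mluni (sval X))
    (fun X => mlunK (sval X)) (fun _ _ f => @mlun_nat C _ _ f)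
    (fun X => mrun (sval X)) (fun X => mruni (sval X))
    (fun X => mrunK (sval X)) (fun _ _ f => @mrun_nat C _ _ f)
    (fun X Y Z T => mpentagon (sval X) (sval Y) (sval Z) (sval T))
    (fun X Y => mtriangle (sval X) (sval Y)).

Section LocalizedBimodules.
Variables (R Q : comNzRingType) (iota : {rmorphism R -> Q}) (W : groupType).
Variables (grR : int -> R -> Prop) (grQ : int -> Q -> Prop).

(* The bare data of an object: M with its grading, E, its grading and its
   W-pieces standing for the sum of the M_Q^w and its summands, and the map
   m |-> xi_M (m (x) 1), which determines xi_M.  The left action of R on the
   M_Q^w extends uniquely to Q by m . q = w(q) . m; this left Q-action, needed
   to form M_Q^x (x)_Q N_Q^y, is part of the data.  The conditions on these
   data are [in_C] below. *)
Record lbimod := LBimod {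
  lb_M : bimod R R;
  lb_gr : int -> lb_M -> Prop;
  lb_E : bimod Q Q;
  lb_grE : int -> lb_E -> Prop;
  lb_piece : W -> lb_E -> Prop;
  lb_pieceP : forall w, subbimod (lb_piece w);
  lb_loc : bhom lb_M (restr iota iota lb_E)
}.

Definition lhom_cond (X Y : lbimod) (f : bhom (lb_M X) (lb_M Y)) : Prop :=
  exists g : bhom (lb_E X) (lb_E Y),
    (forall m, g (lb_loc X m) = lb_loc Y (f m)) /\
    (forall w e, lb_piece w e -> lb_piece w (g e)).

(* When xi_X is an isomorphism, the map g of [lhom_cond] can only be
   xi_Y (f (x) Q) xi_X^-1. *)
Definition lhom (X Y : lbimod) := {f : bhom (lb_M X) (lb_M Y) | lhom_cond f}.

Lemma lhomP (X Y : lbimod) (f g : lhom X Y) :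
  (forall m, sval f m = sval g m) -> f = g.
Proof.
case: f g => [f hf] [g hg] /= /bhP E; rewrite -{}E in hg *.
by congr exist; apply: Prop_irrelevance.
Qed.

Lemma lhom_cond1 X : @lhom_cond X X (bhid _).
Proof. by exists (bhid _). Qed.
Lemma lhom_condM X Y Z (g : lhom Y Z) (f : lhom X Y) :
  @lhom_cond X Z (bhcomp (sval g) (sval f)).
Proof.
case: f g => [f [f' [f1 f2]]] [g [g' [g1 g2]]] /=.
exists (bhcomp g' f'); split=> [m|w e h] /=; first by rewrite f1 g1.
by apply: g2; apply: f2.
Qed.

Definition lcat : category.
Proof.
refine (@Category lbimod lhom (fun X => exist _ _ (lhom_cond1 X))
   (fun X Y Z g f => exist _ _ (lhom_condM g f)) _ _ _) => *; exact: lhomP.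
Defined.

Program Definition loc_tens (X Y : lbimod) :
    bhom (tens (lb_M X) (lb_M Y)) (restr iota iota (tens (lb_E X) (lb_E Y))) :=
  @tens_hom _ _ _ _ _ (restr iota iota (tens (lb_E X) (lb_E Y)))
    (fun m n => tpure (lb_loc X m : lb_E X) (lb_loc Y n : lb_E Y)) _ _ _.
Next Obligation.
move=> X Y; split=> *; rewrite ?bhD ?tpureDl ?tpureDr //.
by rewrite bhr bhl [LHS]tpureA.
Qed.
Next Obligation. by move=> X Y a m n; cbv beta; rewrite bhl -tpure_l. Qed.
Next Obligation. by move=> X Y m n c; cbv beta; rewrite bhr -tpure_r. Qed.

Lemma loc_tensE X Y m n :
  loc_tens X Y (tpure m n) = tpure (lb_loc X m : lb_E X) (lb_loc Y n : lb_E Y).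
Proof. exact: tens_homE. Qed.

Lemma addspan_subbimod (A B : comNzRingType) (M : bimod A B) (P : M -> Prop) :
  (forall a m, P m -> P (a *< m)) -> (forall m b, P m -> P (m >* b)) ->
  subbimod (addspan P).
Proof.
move=> hl hr; split=> [|m n|a m h|m b h].
- exact: Span0.
- exact: SpanB.
- apply: (addspan_map (lmulDr a) _ _ _ h); [exact: Span0|exact: SpanB|].
  by move=> u /(hl a) /SpanG.
- apply: (addspan_map (fun x y => rmulDl x y b) _ _ _ h);
    [exact: Span0|exact: SpanB|].
  by move=> u /(hr _ b) /SpanG.
Qed.

Lemma ten_pieceP X Y w :
  subbimod (tens_gr (fun x y : W => (x * y)%g) (@lb_piece X) (@lb_piece Y) w).
Proof.
apply: addspan_subbimod => [a _|_ b] [x [y [m [n [xy hm hn ->]]]]].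
  exists x, y, (a *< m), n; rewrite tpure_l; split=> //.
  by case: (lb_pieceP X x) => _ _ h _; apply: h.
exists x, y, m, (n >* b); rewrite tpure_r; split=> //.
by case: (lb_pieceP Y y) => _ _ _ h; apply: h.
Qed.

Definition lten (X Y : lbimod) : lbimod :=
  @LBimod _ (tens_gr (fun i j : int => i + j) (@lb_gr X) (@lb_gr Y))
    (tens (lb_E X) (lb_E Y))
    (tens_gr (fun i j : int => i + j) (@lb_grE X) (@lb_grE Y))
    (tens_gr (fun x y : W => (x * y)%g) (@lb_piece X) (@lb_piece Y))
    (ten_pieceP X Y) (loc_tens X Y).

(* The localization of the unit object is concentrated at the identity. *)
Definition conc (V : zmodType) (w0 w : W) (e : V) : Prop := w = w0 \/ e = 0.

Lemma concP (A B : comNzRingType) (M : bimod A B) (w0 w : W) :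
  subbimod (@conc M w0 w).
Proof.
split=> [|m n|a m|m b]; rewrite /conc; first by right.
- by move=> [h|->] [h'|->]; by [left | right; rewrite subrr].
- by move=> [h|->]; [left | right; rewrite lmul0r].
- by move=> [h|->]; [left | right; rewrite rmul0l].
Qed.

Program Definition loc_one :
    bhom (regular_bimod R) (restr iota iota (regular_bimod Q)) :=
  @BHom _ _ (regular_bimod R) (restr iota iota (regular_bimod Q)) iota _ _ _.
Next Obligation. exact: rmorphD. Qed.
Next Obligation. exact: rmorphM. Qed.
Next Obligation. exact: rmorphM. Qed.

Definition lone : lbimod :=
  @LBimod (regular_bimod R) grR (regular_bimod Q) grQ _ (concP _ 1%g) loc_one.

Lemma lhom_cond_tmap X X' Y Y' (f : lhom X X') (g : lhom Y Y') :
  @lhom_cond (lten X Y) (lten X' Y') (tens_map (sval f) (sval g)).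
Proof.
case: f g => [f [f' [f1 f2]]] [g [g' [g1 g2]]].
exists (tens_map f' g'); split.
  apply: text => [x y|x y|m n]; rewrite ?bhD //.
  by rewrite (loc_tensE m n) (tens_mapE f g m n) loc_tensE
             (tens_mapE f' g') f1 g1.
move=> w e; apply: addspan_map (bhD _) _ _ _ _.
- exact: Span0.
- exact: SpanB.
move=> _ [x [y [a [b [xy ha hb ->]]]]].
apply: SpanG; exists x, y, (f' a), (g' b); rewrite tens_mapE.
by split=> //; [exact: f2|exact: g2].
Qed.

Lemma lhom_cond_assoc X Y Z :
  @lhom_cond (lten (lten X Y) Z) (lten X (lten Y Z)) (tassoc _ _ _).
Proof.
exists (tassoc _ _ _); split.
  apply: tens_ext3l => [x y|x y|m n p]; rewrite ?bhD //.
  by rewrite (tassocE m n p) (loc_tensE (X := lten X Y)) (loc_tensE m n)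
             (loc_tensE (Y := lten Y Z)) (loc_tensE n p) tassocE.
move=> w e; apply: addspan_map (bhD _) _ _ _ _.
- exact: Span0.
- exact: SpanB.
move=> _ [xy [z [t [c [wE ht hc ->]]]]].
have D x y : tassoc _ _ _ (tpure (x + y) c) =
   tassoc _ _ _ (tpure x c) + tassoc (lb_E X) (lb_E Y) (lb_E Z) (tpure y c).
  by rewrite tpureDl bhD.
apply: (addspan_map (f := fun t => tassoc _ _ _ (tpure t c)) D _ _ _ ht).
- exact: Span0.
- exact: SpanB.
move=> _ [x [y [a [b [xyE ha hb ->]]]]]; rewrite tassocE; apply: SpanG.
exists x, (y * z)%g, a, (tpure b c); split=> //; first by rewrite mulgA xyE.
by apply: SpanG; exists y, z, b, c.
Qed.

Lemma lhom_cond_associ X Y Z :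
  @lhom_cond (lten X (lten Y Z)) (lten (lten X Y) Z) (tassoci _ _ _).
Proof.
exists (tassoci _ _ _); split.
  apply: tens_ext3r => [x y|x y|m n p]; rewrite ?bhD //.
  by rewrite (tassociE m n p) (loc_tensE (X := lten X Y)) (loc_tensE m n)
             (loc_tensE (Y := lten Y Z)) (loc_tensE n p) tassociE.
move=> w e; apply: addspan_map (bhD _) _ _ _ _.
- exact: Span0.
- exact: SpanB.
move=> _ [x [yz [a [t [wE ha ht ->]]]]].
have D s s' : tassoci _ _ _ (tpure a (s + s')) =
   tassoci _ _ _ (tpure a s) + tassoci (lb_E X) (lb_E Y) (lb_E Z) (tpure a s').
  by rewrite tpureDr bhD.
apply: (addspan_map (f := fun t => tassoci _ _ _ (tpure a t)) D _ _ _ ht).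
- exact: Span0.
- exact: SpanB.
move=> _ [y [z [b [c [yzE hb hc ->]]]]]; rewrite tassociE; apply: SpanG.
exists (x * y)%g, z, (tpure a b), c; split=> //; first by rewrite -mulgA yzE.
by apply: SpanG; exists x, y, a, b.
Qed.

Lemma piece_add X w : forall x y, @lb_piece X w x -> lb_piece w y -> lb_piece w (x - y).
Proof. by case: (lb_pieceP X w). Qed.
Lemma piece0 X w : @lb_piece X w 0.
Proof. by case: (lb_pieceP X w). Qed.

Lemma lhom_cond_lun X : @lhom_cond (lten lone X) X (tlun _).
Proof.
exists (tlun _); split.
  apply: text => [x y|x y|m n]; rewrite ?bhD //.
  rewrite (loc_tensE (X := lone) m n) (tlunE (M := lb_M X) m n).
  by rewrite (tlunE (M := lb_E X)) bhl.
move=> w e; apply: addspan_map (bhD _) (piece0 _ _) (@piece_add X w) _ _.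
move=> _ [x [y [a [b [<- ha hb ->]]]]]; rewrite tlunE.
case: ha => [->|->]; last by rewrite lmul0l; exact: piece0.
by rewrite mul1g; case: (lb_pieceP X y) => _ _ h _; apply: h.
Qed.

Lemma lhom_cond_luni X : @lhom_cond X (lten lone X) (tluni _).
Proof.
exists (tluni _); split=> [m|w e h].
  by rewrite (loc_tensE (X := lone) (1 : regular_bimod R) m) /= rmorph1.
by apply: SpanG; exists 1%g, w, 1, e; split=> //; [rewrite mul1g|left].
Qed.

Lemma lhom_cond_run X : @lhom_cond (lten X lone) X (trun _).
Proof.
exists (trun _); split.
  apply: text => [x y|x y|m n]; rewrite ?bhD //.
  rewrite (loc_tensE (Y := lone) m n) (trunE (M := lb_M X) m n).
  by rewrite (trunE (M := lb_E X)) bhr.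
move=> w e; apply: addspan_map (bhD _) (piece0 _ _) (@piece_add X w) _ _.
move=> _ [x [y [a [b [<- ha hb ->]]]]]; rewrite trunE.
case: hb => [->|->]; last by rewrite rmul0r; exact: piece0.
by rewrite mulg1; case: (lb_pieceP X x) => _ _ _ h; apply: h.
Qed.

Lemma lhom_cond_runi X : @lhom_cond X (lten X lone) (truni _).
Proof.
exists (truni _); split=> [m|w e h].
  by rewrite (loc_tensE (Y := lone) m (1 : regular_bimod R)) /= rmorph1.
by apply: SpanG; exists w, 1%g, e, 1; split=> //; [rewrite mulg1|left].
Qed.

Definition ltmap X X' Y Y' (f : lhom X X') (g : lhom Y Y') :
  lhom (lten X Y) (lten X' Y') := exist _ _ (lhom_cond_tmap f g).
Definition lassoc X Y Z : lhom (lten (lten X Y) Z) (lten X (lten Y Z)) :=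
  exist _ _ (lhom_cond_assoc X Y Z).
Definition lassoci X Y Z : lhom (lten X (lten Y Z)) (lten (lten X Y) Z) :=
  exist _ _ (lhom_cond_associ X Y Z).
Definition llun X : lhom (lten lone X) X := exist _ _ (lhom_cond_lun X).
Definition lluni X : lhom X (lten lone X) := exist _ _ (lhom_cond_luni X).
Definition lrun X : lhom (lten X lone) X := exist _ _ (lhom_cond_run X).
Definition lruni X : lhom X (lten X lone) := exist _ _ (lhom_cond_runi X).

Local Ltac lsimp := cbn [proj1_sig ltmap lassoc lassoci llun lluni lrun lruni
  bhcomp bhid bh_fun cmp idc lcat lten lb_M lone].

Definition lmonoidal : monoidal.
Proof.
refine (@Monoidal lcat lten ltmap _ _ lone lassoc lassoci _ _
          llun lluni _ _ lrun lruni _ _ _ _).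
- move=> X Y; apply: lhomP; apply: text => [x y|x y|m n]; rewrite ?bhD //.
  exact: tens_mapE.
- move=> X X' X'' Y Y' Y'' f' f g' g; apply: lhomP.
  apply: text => [x y|x y|m n]; rewrite ?bhD //; lsimp.
  by rewrite !tens_mapE.
- move=> X Y Z; split; apply: lhomP.
    apply: tens_ext3l => [x y|x y|m n p]; rewrite ?bhD //; lsimp.
    by rewrite tassocE tassociE.
  apply: tens_ext3r => [x y|x y|m n p]; rewrite ?bhD //; lsimp.
  by rewrite tassociE tassocE.
- move=> X X' Y Y' Z Z' f g h; apply: lhomP.
  apply: tens_ext3l => [x y|x y|m n p]; rewrite ?bhD //; lsimp.
  by rewrite !(tens_mapE, tassocE).
- move=> X; split; apply: lhomP.
    apply: text => [x y|x y|r m]; rewrite ?bhD //; lsimp.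
    by rewrite tlunE tluniE -tpureA /= mul1r.
  by move=> m; lsimp; rewrite tluniE tlunE lmul1.
- move=> X Y f; apply: lhomP; apply: text => [x y|x y|r m]; rewrite ?bhD //; lsimp.
  by rewrite tens_mapE !tlunE bhl.
- move=> X; split; apply: lhomP.
    apply: text => [x y|x y|m r]; rewrite ?bhD //; lsimp.
    by rewrite trunE truniE tpureA /= mulr1.
  by move=> m; lsimp; rewrite truniE trunE rmul1.
- move=> X Y f; apply: lhomP; apply: text => [x y|x y|m r]; rewrite ?bhD //; lsimp.
  by rewrite tens_mapE !trunE bhr.
- move=> X Y Z T; apply: lhomP.
  apply: tens_ext3l => [x y|x y|t z u]; rewrite ?bhD //; lsimp.
  elim/tind: t => [m n|x y hx hy]; last by rewrite !(tpureDl, bhD) hx hy.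
  by rewrite !(tassocE, tens_mapE).
- move=> X Y; apply: lhomP.
  apply: tens_ext3l => [x y|x y|m r n]; rewrite ?bhD //; lsimp.
  by rewrite tassocE !tens_mapE tlunE trunE tpureA.
Defined.

End LocalizedBimodules.

Section Conditions.

(* V is the internal direct sum of the additive subgroups P i. *)
Definition direct_sum (I : eqType) (V : zmodType) (P : I -> V -> Prop) : Prop :=
  [/\ forall i, P i 0,
      forall i v w, P i v -> P i w -> P i (v - w),
      forall v, exists (s : seq I) (f : I -> V),
        (forall i, P i (f i)) /\ v = \sum_(i <- s) f i
    & forall (s : seq I) (f : I -> V), uniq s -> (forall i, P i (f i)) ->
        \sum_(i <- s) f i = 0 -> forall i, i \in s -> f i = 0].

Definition graded_bimod (A B : comNzRingType)
    (gA : int -> A -> Prop) (gB : int -> B -> Prop)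
    (M : bimod A B) (gM : int -> M -> Prop) : Prop :=
  [/\ direct_sum gM,
      forall i j a m, gA i a -> gM j m -> gM (i + j) (a *< m)
    & forall i j m b, gM i m -> gB j b -> gM (i + j) (m >* b)].

Definition graded_sub (V : zmodType) (gr : int -> V -> Prop) (P : V -> Prop) :=
  forall v, P v -> exists (s : seq int) (f : int -> V),
    (forall i, gr i (f i) /\ P (f i)) /\ v = \sum_(i <- s) f i.

Definition fg_bimod (A B : comNzRingType) (M : bimod A B) : Prop :=
  exists gs : seq M, forall m,
    addspan (fun t => exists g a b, g \in gs /\ t = a *< g >* b) m.

(* Left B-modules are (B, Z)-bimodules. *)
Definition flat_right (A B : comNzRingType) (M : bimod A B) : Prop :=
  forall (X Y : bimod B int) (f : bhom X Y),
    injective f -> injective (tens_map (bhid M) f).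

End Conditions.

Section NeutralBlock.
Variables (k : idomainType) (W : groupType) (S : {pred W}).
Variables (D : realdata k S) (o : wset W).

Local Notation R := (Sym D).
Local Notation Q := (locQ D).
Local Notation idR := (idfun : {rmorphism R -> R}).
Local Notation idQ := (idfun : {rmorphism Q -> Q}).
Local Notation RQ := (ring_bimod (toQ D) idQ).
Local Notation QR := (ring_bimod idQ (toQ D)).
Local Notation addZ := (fun i j : int => i + j).
Local Notation SymGr := (@SymGr k W S D).
Local Notation QGr := (@QGr k W S D).

(* [Cmon] has the bare data as objects; the categories C and the neutral blocks
   are full subcategories of it, given by [in_C] and [in_neutral_block]. *)
Definition Cobj := lbimod (toQ D) W.
Definition Cmon : monoidal := @lmonoidal R Q (toQ D) W SymGr QGr.

Section XiMap.
Variable X : Cobj.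

(* xi_X : X (x)_R Q -> E. *)
Program Definition xi :
    bhom (tens (lb_M X) RQ) (restr (toQ D) idQ (lb_E X)) :=
  @tens_hom _ _ _ _ _ (restr (toQ D) idQ (lb_E X))
    (fun m (q : RQ) => (lb_loc X m : lb_E X) >* (q : Q)) _ _ _.
Next Obligation.
by split=> *; rewrite ?bhD ?rmulDl ?rmulDr // bhr [LHS]rmulA.
Qed.
Next Obligation. by move=> *; cbv beta; rewrite bhl [LHS]lrmulA. Qed.
Next Obligation. by move=> *; cbv beta; rewrite [RHS]rmulA. Qed.

End XiMap.

(* The objects of the category from L to L'.  The sum of the M_Q^w is internal
   to E, and the isomorphism is [xi], which is graded as E is graded over Q. *)
Definition in_C (L L' : o) (X : Cobj) : Prop :=
  [/\ [/\ graded_bimod SymGr SymGr (@lb_gr _ _ _ _ X),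
          fg_bimod (lb_M X) & flat_right (lb_M X)],
      [/\ graded_bimod QGr QGr (@lb_grE _ _ _ _ X),
          direct_sum (@lb_piece _ _ _ _ X)
        & forall w, graded_sub (@lb_grE _ _ _ _ X) (@lb_piece _ _ _ _ X w)],
      forall w e (f : R), @lb_piece _ _ _ _ X w e ->
        e >* toQ D f = toQ D (Sact D w f) *< e,
      (exists s : seq W, forall w e,
         @lb_piece _ _ _ _ X w e -> e <> 0 -> w \in s) /\
      (forall w e, @lb_piece _ _ _ _ X w e -> e <> 0 -> ws_act L w = L')
    & bijective (xi X) /\
      (forall i t, @tens_gr _ _ _ (lb_M X) RQ _ addZ (@lb_gr _ _ _ _ X) QGr i t ->
         @lb_grE _ _ _ _ X i (xi X t))].

Section TwoSided.
Variables (M : bimod R R) (gM : int -> M -> Prop).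

(* For the objects R_w and C_s the roots already act invertibly on M (x)_R Q from
   the left, so that M (x)_R Q = Q (x)_R M (x)_R Q; the latter carries the left
   Q-action for arbitrary M. *)
Definition twoE : bimod Q Q := tens QR (tens M RQ).

Definition twoE_in (m : M) : twoE := tpure (1 : QR) (tpure m (1 : RQ)).

Program Definition two_loc : bhom M (restr (toQ D) (toQ D) twoE) :=
  @BHom _ _ M (restr (toQ D) (toQ D) twoE) twoE_in _ _ _.
Next Obligation. by move=> *; rewrite /twoE_in tpureDl tpureDr. Qed.
Next Obligation.
move=> a m; rewrite /twoE_in -tpure_l -tpureA [RHS]tpure_l /=.
by congr tpure; rewrite mul1r mulr1.
Qed.
Next Obligation.
move=> m b; rewrite /twoE_in tpureA [RHS]tpure_r tpure_r.
by congr (tpure _ (tpure _ _)); rewrite /= mul1r mulr1.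
Qed.

Definition two_gr : int -> twoE -> Prop :=
  @tens_gr _ _ _ QR (tens M RQ) _ addZ QGr (@tens_gr _ _ _ M RQ _ addZ gM QGr).

(* The objects with underlying bimodule M, where the w-piece of the
   localization is generated over Q by the elements of M satisfying G w. *)
Definition gen_piece (G : W -> M -> Prop) (w : W) : twoE -> Prop :=
  addspan (fun t => exists (q q' : Q) (m : M),
                      G w m /\ t = q *< twoE_in m >* q').

Lemma gen_pieceP G w : subbimod (gen_piece G w).
Proof.
apply: addspan_subbimod => [a _|_ b] [q [q' [m [h ->]]]].
  by exists (a * q), q', m; rewrite -lrmulA lmulA.
by exists q, (q' * b), m; rewrite rmulA.
Qed.

Definition two_obj (G : W -> M -> Prop) : Cobj :=
  @LBimod R Q (toQ D) W M gM twoE two_gr _ (gen_pieceP G) two_loc.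

End TwoSided.

Definition R_obj (w : W) : Cobj :=
  @two_obj (ring_bimod idR (Sact D w)) SymGr (fun v _ => v = w).

Definition RRs (w : W) : bimod R R :=
  tens (ring_bimod idR (invR_val D w)) (ring_bimod (invR_val D w) idR).

Definition RRs_pure w (f g : R) : RRs w :=
  tpure (f : ring_bimod idR (invR_val D w)) (g : ring_bimod (invR_val D w) idR).

Definition Cs_gr w (i : int) : RRs w -> Prop :=
  @tens_gr _ _ _ (ring_bimod idR (invR_val D w))
    (ring_bimod (invR_val D w) idR) _ addZ SymGr SymGr (i + 1).

Definition Cs_gen (s : gens S) (v : W) (m : RRs (val s)) : Prop :=
  exists d : 'Hom(hspace D, k^o), d (coroot D s) = 1 /\
    ((v = 1%g /\ m = RRs_pure _ (lin d) 1
                     - RRs_pure _ 1 (Sact D (val s) (lin d))) \/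
     (v = val s /\ m = RRs_pure _ (lin d) 1 - RRs_pure _ 1 (lin d))).

(* The shift (1) is in [Cs_gr]. *)
Definition C_obj (s : gens S) : Cobj := @two_obj _ (@Cs_gr (val s)) (@Cs_gen s).

Definition Bs (L : o) (s : gens S) : Cobj :=
  if `[< ws_act L (val s) = L >] then C_obj s else R_obj (val s).

Fixpoint Bw (L : o) (u : seq (gens S)) : Cmon :=
  if u is s :: u' then @ten Cmon (Bs L s) (Bw (ws_act L (val s)) u')
  else munit.

(* Finite direct sums, up to isomorphism, as biproducts in a category whose
   morphisms are additive maps of the underlying bimodules. *)
Definition is_biproduct (n : nat) (Y : 'I_n -> Cmon) (X : Cmon) : Prop :=
  exists (i : forall j, hom (Y j) X) (p : forall j, hom X (Y j)),
    [/\ forall j, p j \oc i j = idc (Y j),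
        forall j l, j != l -> forall y, sval (p l \oc i j) y = 0
      & forall x, x = \sum_j sval (i j \oc p j) x].

Definition in_neutral_block (L : o) (X : Cmon) : Prop :=
  in_C L L X /\
  exists (n : nat) (u : 'I_n -> seq (gens S)),
    (forall j, neutral S L (wprod (u j))) /\
    is_biproduct (fun j => Bw L (u j)) X.

End NeutralBlock.

Section EndoscopicRealization.
Variables (k : idomainType) (W : groupType) (S : {pred W}).
Variables (cox : coxeter_system S) (D : realdata k S) (o : wset W) (L : o).

Definition refl_pres (r : W) (p : W * gens S) : Prop :=
  r = (p.1 * val p.2 * p.1^-1)%g /\ (ell S p.1 < ell S (p.1 * val p.2)%g)%N.

(* For a reflection r of W: x alpha_s and x alpha_s^vee, where r = x s x^-1 and
   xs > x; the choice of (x, s) is immaterial in the balanced case. *)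
Definition refl_root (r : W) : 'Hom(hspace D, k^o) :=
  if pselect (exists p, refl_pres r p) is left h then
    wdual (sval (cid h)).1 (root D (sval (cid h)).2) else 0.

Definition refl_coroot (r : W) : hspace D :=
  if pselect (exists p, refl_pres r p) is left h then
    hact D (sval (cid h)).1 (coroot D (sval (cid h)).2) else 0.

Definition endo_realdata : realdata k (neutral_gens cox L) :=
  @RealData k _ (neutral_gens cox L) (hspace D)
    (fun w : neutral_group L cox => hact D (val w))
    (fun s => refl_root (val (val s)))
    (fun s => refl_coroot (val (val s))).

(* The objects of A(h, W_L^o); for the one-point set of parameters every element
   is neutral. *)
Definition in_endo_block : Cmon endo_realdata -> Prop :=
  @in_neutral_block k _ _ endo_realdata (pt_wset _) tt.

Definition Bx (x : seq (gens (neutral_gens cox L))) : Cmon endo_realdata :=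
  @Bw k _ _ endo_realdata (pt_wset _) tt x.

(* The reduced expressions of several occurrences of a letter may differ. *)
Definition expands (u : seq (gens (neutral_gens cox L))) (u' : seq (gens S)) :=
  exists v : seq (seq (gens S)),
    [/\ size v = size u, u' = flatten v
      & forall i (s : gens (neutral_gens cox L)), onth u i = Some s ->
        exists e, [/\ onth v i = Some e, reduced e & wprod e = val (val s)]].

End EndoscopicRealization.

(* Main.v *)
(* The objects of both categories are R-bimodules whose localizations are sums
   of pieces indexed by a group, and W_L^o is a subgroup of W: extending the
   pieces by 0 and inverting the remaining roots, an object over W_L^o becomes one
   over W with the same underlying bimodule.  A bimodule map respects the pieces
   before if and only if it does after, so this is a fully faithful functor; it is
   monoidal with identities as structure maps.

   If no letter of a word v fixes the parameter reached before it, and s fixes the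
   parameter L' = L v, then r = v s v^-1 is in S_L^o and R_v (x) C_s is isomorphic
   to C_r (x) R_v.  Moving the factors R_s of B_u^L to the right one by one thus
   gives B_u^L = B_x (x) R_b with x an expression in S_L^o and b = b_L(u); for u
   neutral, R_b is the unit.  A reduced expression of r in S_L^o has a single letter
   fixing its parameter, so that there x = (r), which identifies the images of the
   B_x.  It also follows that the localization of a neutral object splits
   after inverting roots of W_L^o only, whence essential surjectivity. *)

From HB Require Import structures.
From mathcomp Require Import all_boot all_order all_algebra perm.
From mathcomp Require Import generic_quotient fraction.
From mathcomp.classical Require Import boolp.
From mathcomp Require Import mpoly ring.
Require Import Defs.

Set Implicit Arguments.
Unset Strict Implicit.
Unset Printing Implicit Defensive.

Import GRing.Theory.
Local Open Scope ring_scope.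
Local Open Scope quotient_scope.

Local Notation "g \oc f" := (cmp g f) (at level 50, left associativity).

(** * Words, parameters and the neutral group *)

(** Everything that must be well defined on W comes from its universal property, applied to
    semidirect products: the independence of b_L, the sign, and the parity with which a reflection
    occurs among the inversions of a word. The sign is also needed for the neutral group: the
    inverted elements are the x alpha_s with xs longer than x, and they are stable under the group
    up to sign because x and xs never have equal length.

    Localizations are handled through the underlying bimodule M. Flatness embeds M in its
    localization, the part of M at w is its intersection with the w-piece, and up to denominators M
    is the sum of its parts. So an object can be built from elements of M generating its parts, and
    a bimodule map is a morphism once it sends such generators into the right parts.

    The conjugation step has one obstacle: for r = y s y^-1, the root attached to r and y alpha_s
    may come from different presentations of r. As 1 - r has rank one, the two pairs of root and
    coroot differ by inverse constants, and an invertible constant crosses the tensor sign of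
    C_r. *)

Section Cocycles.
Variables (W H : groupType) (o : wset W).

(** The semidirect product of W with the functions from [o] to [H]. A homomorphism from W into it
    lying over the identity of W is a 1-cocycle, so the universal property of W produces
    cocycles. *)
Definition sdprod := (W * (o -> H))%type.

HB.instance Definition _ := gen_eqMixin sdprod.
HB.instance Definition _ := gen_choiceMixin sdprod.

Definition sd_one : sdprod := (1%g, fun=> 1%g).
Definition sd_mul (x y : sdprod) : sdprod :=
  (x.1 * y.1, fun M => x.2 M * y.2 (ws_act M x.1))%g.
Definition sd_inv (x : sdprod) : sdprod :=
  (x.1^-1, fun M => (x.2 (ws_act M x.1^-1))^-1)%g.

Lemma sd_mulA : associative sd_mul.
Proof.
move=> x y z; congr pair; first exact: mulgA.
by apply/funext => M /=; rewrite ws_actM mulgA.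
Qed.
Lemma sd_mul1 : left_id sd_one sd_mul.
Proof. by case=> w h; congr pair; [|apply/funext => M]; rewrite /= ?ws_act1 mul1g. Qed.
Lemma sd_mulr1 : right_id sd_one sd_mul.
Proof. by case=> w h; congr pair; [|apply/funext => M]; rewrite /= mulg1. Qed.
Lemma sd_mulV : left_inverse sd_one sd_inv sd_mul.
Proof.
by case=> w h; congr pair; [|apply/funext => M]; rewrite /= mulVg.
Qed.
Lemma sd_mulVr : right_inverse sd_one sd_inv sd_mul.
Proof.
case=> w h; congr pair; [|apply/funext => M]; rewrite /= ?mulgV //.
by rewrite -ws_actM mulgV ws_act1 mulgV.
Qed.
HB.instance Definition _ :=
  isGroup.Build sdprod sd_mulA sd_mul1 sd_mulr1 sd_mulV sd_mulVr.

Variables (S : {pred W}) (h : W -> o -> H).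

Fixpoint cocyc (u : seq (gens S)) (M : o) : H :=
  if u is s :: u' then (h (val s) M * cocyc u' (ws_act M (val s)))%g else 1%g.

Lemma cocyc_cat u v M :
  cocyc (u ++ v) M = (cocyc u M * cocyc v (ws_act M (wprod u)))%g.
Proof.
elim: u M => [|s u IH] M /=; first by rewrite mul1g ws_act1.
by rewrite IH mulgA ws_actM.
Qed.

Definition alternating (s t : gens S) n := flatten (nseq n [:: s; t]).

Lemma wprod_alternating s t n :
  wprod (alternating s t n) = ((val s * val t) ^+ n)%g.
Proof. by elim: n => [|n IH] //=; rewrite IH expgS !mulgA. Qed.

(* The universal property of W, applied to the semidirect product [sdprod]. *)
Lemma cocyc_wprod :
  coxeter_system S ->
  (forall s t n M, ((val s * val t) ^+ n = 1)%g -> cocyc (alternating s t n) M = 1%g) ->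
  forall u v, wprod u = wprod v -> cocyc u = cocyc v.
Proof.
move=> [_ _ univ] rel.
pose sd w : sdprod := (w, h w).
have E (s t : gens S) k : ((sd (val s) * sd (val t)) ^+ k)%g
     = ((val s * val t) ^+ k, cocyc (alternating s t k))%g :> sdprod.
  elim: k => [|k IH]; first by [].
  rewrite expgS IH; congr pair; first by rewrite expgS.
  by apply/funext => M' /=; rewrite ws_actM mulgA.
have [s t n hs ht e|g [gM gs]] := univ sdprod sd.
  rewrite (E (exist _ s hs) (exist _ t ht) n) /= e.
  congr pair; apply/funext => M; exact: (rel (exist _ s hs) (exist _ t ht) n).
have gE u : (g (wprod u)) = (wprod u, cocyc u).
  elim: u => [|s u IH]; first by apply: (mulgI (g 1%g)); rewrite -gM !mulg1.
  by rewrite /= gM IH gs ?(svalP s).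
by move=> u v e; have := gE u; rewrite e gE => -[].
Qed.

End Cocycles.

Section Stays.
Variables (W : groupType) (S : {pred W}) (cox : coxeter_system S) (o : wset W).

Definition move (w : W) (M : o) : W :=
  if `[< ws_act M w = M >] then 1%g else w.

Lemma bword_cocyc (L : o) (u : seq (gens S)) : bword L u = cocyc move u L.
Proof.
elim: u L => [|s u IH] L //=; rewrite -IH /bword /= /move.
by case: asboolP => _; rewrite /= ?mul1g.
Qed.

Lemma movesK (s : gens S) (M : o) :
  (move (val s) M * move (val s) (ws_act M (val s)))%g = 1%g.
Proof.
rewrite /move; case: asboolP => [e|ne].
  by rewrite !e asboolT // mulg1.
by rewrite (ws_gensK cox) asboolF ?(gensK cox) // => e; apply: ne.
Qed.

Section Alternating.
Variables (s t : gens S) (M : o).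

(** The walk along s, t, s, t, ... starting at [M]: its letters, the parameters reached, and the
    partial products of the letters that move. *)
Let l i := if odd i then t else s.
Let Ms i := iteri i (fun j N => ws_act N (val (l j))) M.
Let c i := iteri i (fun j w => (w * move (val (l j)) (Ms j))%g) 1%g.

Let MsS i : Ms i.+1 = ws_act (Ms i) (val (l i)). Proof. by []. Qed.
Let cS i : c i.+1 = (c i * move (val (l i)) (Ms i))%g. Proof. by []. Qed.
Let l_double i : l i.*2 = s. Proof. by rewrite /l odd_double. Qed.
Let l_doubleS i : l i.*2.+1 = t. Proof. by rewrite /l oddS odd_double. Qed.

Let Ms_alt n : Ms n.*2 = ws_act M ((val s * val t) ^+ n)%g.
Proof.
elim: n => [|n IH]; first by rewrite expg0 ws_act1.
by rewrite doubleS expgSr ws_actM -IH ws_actM !MsS l_double l_doubleS.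
Qed.

Let c_alt n : c n.*2 = cocyc move (alternating s t n) M.
Proof.
elim: n => [|n IH] //; rewrite /alternating -addn1 nseqD flatten_cat cocyc_cat.
rewrite -[flatten (nseq n _)]/(alternating s t n) -IH wprod_alternating -Ms_alt.
by rewrite addn1 doubleS !(MsS, cS) l_double l_doubleS [cocyc _ _ _]/= mulg1 mulgA.
Qed.

(* The walk M, Ms, Mst, ... turns back at a letter that does not move it. *)
Let mirror i j : Ms i.+1 = Ms i -> (j <= i)%N ->
  Ms (i.+1 + j) = Ms (i - j) /\ c (i.+1 + j) = c (i - j).
Proof.
move=> e; elim: j => [|j IH] ji.
  by rewrite addn0 subn0 cS; split=> //; rewrite /move asboolT ?mulg1.
have {IH}[IHM IHc] := IH (ltnW ji).
have lE : l (i.+1 + j) = l (i - j.+1).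
  by rewrite /l addSn -addnS oddD oddB // -signr_addb.
have E : (i - j = (i - j.+1).+1)%N by rewrite subnSK.
rewrite addnS MsS cS IHM IHc lE E.
by rewrite MsS cS (ws_gensK cox) -mulgA movesK mulg1.
Qed.

(** The walk has period 2n. If no letter stays, the product is (st)^n = 1. Otherwise the walk turns
    back at some i, hence also at i + n. Mirroring in i + n carries time 2n + i + 1 to time i, so
    one full period contributes nothing. *)
Lemma move_alternating n :
  ((val s * val t) ^+ n = 1)%g -> cocyc move (alternating s t n) M = 1%g.
Proof.
move=> st.
have per i : Ms (n.*2 + i) = Ms i.
  elim: i => [|i IH]; first by rewrite addn0 Ms_alt st ws_act1.
  by rewrite addnS !MsS IH /l oddD odd_double.
have cper i : c (n.*2 + i) = (c n.*2 * c i)%g.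
  elim: i => [|i IH]; first by rewrite addn0 /= mulg1.
  by rewrite addnS !cS IH per /l oddD odd_double mulgA.
rewrite -c_alt; have [[i e]|none] := pselect (exists i, Ms i.+1 = Ms i).
  (* A turning point may be translated by the period; once it is at least n, mirroring over n steps
     stays within the walk. *)
  wlog le_ni : i e / (n <= i)%N => [|].
    have le_n : (n <= n.*2 + i)%N by rewrite -addnn -addnA leq_addr.
    by move/(_ (n.*2 + i)); apply=> //; rewrite -addnS !per.
  have e' : Ms (i + n).+1 = Ms (i + n)%N.
    rewrite -addSn; have [-> _] := mirror e le_ni.
    by rewrite -per -addnn -addnA subnKC // addnC.
  have [_] := mirror e' (leq_addl i n).
  rewrite addnK -addSn -addnA addnn addnC cper.
  have [_] := mirror e (leq0n i); rewrite addn0 subn0 => -> h.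
  by apply: (mulIg (c i)); rewrite h mul1g.
have cE i : c i.*2 = ((val s * val t) ^+ i)%g.
  have mv j : move (val (l j)) (Ms j) = val (l j).
    by rewrite /move asboolF // => e; apply: none; exists j.
  elim: i => [|i IH] //.
  by rewrite doubleS expgSr -IH !cS !mv l_double l_doubleS mulgA.
by rewrite cE.
Qed.

End Alternating.

Lemma bword_wprod (L : o) (u v : seq (gens S)) :
  wprod u = wprod v -> bword L u = bword L v.
Proof.
move=> e; rewrite !bword_cocyc (@cocyc_wprod _ _ _ _ move _ _ u v) //.
by move=> s t n M; apply: move_alternating.
Qed.

End Stays.

(** * Inversions of a word and their parity *)

Section Reflections.
Variables (W : groupType) (S : {pred W}) (cox : coxeter_system S).

(** The group of order two, so that parities become values of a cocycle. *)
Let c : {perm bool} := tperm true false.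

Let odd_c n : odd_perm (c ^+ n)%g = odd n.
Proof. by elim: n => [|n IH]; rewrite ?odd_perm1 // expgS odd_permM odd_tperm IH. Qed.

Let c_even n : ~~ odd n -> (c ^+ n = 1)%g.
Proof.
move=> /negbTE o; rewrite -(odd_double_half n) o add0n -muln2 mulnC expgnA.
by rewrite expgS expg1 tperm2 expg1n.
Qed.

(** This is the constant cocycle over the one-point set, trivial on relators since these have even
    length. *)
Lemma odd_size_wprod (u v : seq (gens S)) :
  wprod u = wprod v -> odd (size u) = odd (size v).
Proof.
have E (w : seq (gens S)) : cocyc (fun _ _ => c) w (tt : pt_wset W) = (c ^+ size w)%g.
  by elim: w => [|s w IH] //=; rewrite IH expgS.
move=> e; rewrite -!odd_c -!E (@cocyc_wprod _ _ (pt_wset W) _ _ _ _ u v) //.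
move=> s t n [] _; rewrite E c_even // /alternating.
by elim: n => //= n IH; rewrite negbK.
Qed.

Definition conj_wset : wset W := @WSet W W (fun t w => t ^ w)%g (@conjg1 W) (@conjgM W).

(** The inversions of a word, as reflections: the i-th entry is s_1 ... s_(i-1) s_i s_(i-1) ...
    s_1. *)
Fixpoint refls (u : seq (gens S)) : seq W :=
  if u is s :: u' then val s :: [seq t ^ (val s)^-1 | t <- refls u']%g else [::].

Let chi (s : W) (t : conj_wset) : {perm bool} := if (t : W) == s then c else 1%g.

Let cocyc_refls (u : seq (gens S)) (t : conj_wset) :
  cocyc chi u t = (c ^+ count_mem (t : W) (refls u))%g.
Proof.
elim: u t => [|s u IH] t //=; rewrite IH expgnDr eq_sym {1}/chi.
rewrite count_map; congr (_ * _)%g; first by case: eqP.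
congr (_ ^+ _)%g; apply: eq_count => x /=.
by rewrite -(inj_eq (conjg_inj (val s)^-1%g)) -conjgM mulgV conjg1 eq_sym.
Qed.

Let refls_alternating (s t : gens S) n :
  refls (alternating s t n) =
  [seq ((val s * val t) ^+ i * val s)%g | i <- iota 0 n.*2].
Proof.
have inv (r : gens S) : ((val r)^-1 = val r)%g.
  by apply: (mulgI (val r)); rewrite mulgV (gensK cox).
elim: n => [|n IH] //; rewrite -[alternating _ _ _]/[:: s, t & alternating s t n].
rewrite doubleS -[iota 0 _]/[:: 0, 1 & iota 2 n.*2]%N [refls _]/= IH.
rewrite !map_cons expg0 mul1g; congr (_ :: _ :: _); first by rewrite conjgE invgK inv mulgA.
rewrite (iotaDl 2 0) -!map_comp; apply: eq_map => i /=.
by rewrite !conjgE !invgK !inv -[(2 + i)%N]/(i.+2) expgS expgSr !mulgA.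
Qed.

(** For a relator (st)^n the inversions are the (st)^i s with i < 2n. These repeat after n steps, so
    every reflection occurs an even number of times, and the parity of occurrences is a cocycle for
    W acting on itself by conjugation. *)
Lemma odd_count_refls (u v : seq (gens S)) t :
  wprod u = wprod v -> odd (count_mem t (refls u)) = odd (count_mem t (refls v)).
Proof.
move=> e; rewrite -!odd_c -!cocyc_refls (@cocyc_wprod _ _ _ _ chi _ _ u v) //.
move=> r s n x st; rewrite cocyc_refls c_even // refls_alternating -addnn iotaD.
rewrite map_cat count_cat -[(0 + n)%N]addn0 iotaDl -map_comp.
rewrite (@eq_map _ _ (_ \o addn n) (fun i => ((val r * val s) ^+ i * val r)%g)).
  by rewrite addnn odd_double.
by move=> i /=; rewrite expgnDr st mul1g.
Qed.

Lemma ellP (u : seq (gens S)) : has_length S (wprod u) (ell S (wprod u)).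
Proof.
rewrite /ell; case: pselect => [h|[]]; first by case: ex_minnP => n /asboolP.
by exists (size u); apply/asboolP; exists u.
Qed.

Lemma ell_le (u : seq (gens S)) : (ell S (wprod u) <= size u)%N.
Proof.
rewrite /ell; case: pselect => [h|//]; case: ex_minnP => n _; apply.
by apply/asboolP; exists u.
Qed.

Lemma reduced_exists (u : seq (gens S)) : exists2 v : seq (gens S), reduced v & wprod v = wprod u.
Proof. by have [v [vu sv]] := ellP u; exists v; rewrite // /reduced vu. Qed.

(* Two equal reflections in the list would allow deleting two letters. *)
Lemma uniq_refls (u : seq (gens S)) : reduced u -> uniq (refls u).
Proof.
(* Left multiplication by an inversion removes a letter from the word. *)
have main (v : seq (gens S)) x : x \in refls v ->
    exists2 v' : seq (gens S), wprod v' = (x * wprod v)%g & (size v' < size v)%N.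
  elim: v x => [//|r v IHv] x /=; rewrite inE => /orP[/eqP->|].
    by exists v; rewrite // mulgA (gensK cox) mul1g.
  case/mapP=> t /IHv[v' v'E lt] ->; exists (r :: v') => //=.
  by rewrite v'E conjgE invgK -!mulgA mulKg.
elim: u => // s u IH; rewrite /reduced [size _]/= [wprod _]/= => red.
have red' : reduced u.
  apply/eqP; rewrite eqn_leq ell_le andbT leqNgt; apply/negP => lt.
  have [v [vu sv]] := ellP u.
  by have := ell_le (s :: v); rewrite /= vu -red leqNgt sv /= ltnS lt.
rewrite /= map_inj_uniq ?IH ?andbT //; last exact: conjg_inj.
apply/negP => /mapP[t t_in sE]; have tE : t = val s.
  by rewrite -(conjgK (val s)^-1%g t) invgK -sE conjgE mulKg.
move: t_in; rewrite tE => /main[v' v'E lt].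
by have := ell_le v'; rewrite v'E -red leqNgt ltnS ltnW.
Qed.

(** A letter fixes the parameter reached before it exactly when the corresponding inversion fixes
    [L], since the two are conjugate by the prefix. Thus ell_L counts the inversions in the
    stabilizer of [L]. *)
Lemma stays_refls (o : wset W) (L : o) (u : seq (gens S)) :
  stays L u = [seq `[< ws_act L t = L >] | t <- refls u].
Proof.
elim: u L => [|s u IH] L //=; rewrite IH -map_comp; congr (_ :: _).
apply: eq_map => t /=; apply: asbool_equiv_eq; rewrite conjgE invgK !ws_actM.
split=> [->|e]; first by rewrite -ws_actM mulgV ws_act1.
by rewrite -{2}e -!ws_actM -!mulgA mulVg mulg1 ws_actM.
Qed.

(** The inversions of the reduced word v are distinct, and they are the reflections occurring an odd
    number of times in the list of u. Only one entry of that list fixes [L], so the same reflection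
    is the only such inversion of v. Generators of the neutral group can thus be recognized on words
    that are not reduced. *)
Lemma ellL_word1_reduced (o : wset W) (L : o) (u v : seq (gens S)) :
  wprod u = wprod v -> reduced v -> ellL_word L u = 1%N -> ellL_word L v = 1%N.
Proof.
move=> e red; rewrite /ellL_word !stays_refls !count_map.
pose st := fun t : W => `[< ws_act L t = L >].
have stE : preim (fun t : W => `[< ws_act L t = L >]) (pred1 true) =1 st.
  by move=> t /=; rewrite eqb_id.
rewrite !(eq_count stE).
rewrite -!size_filter; case E: (filter st _) => [|x [|]] // _.
suff /perm_size : perm_eq (filter st (refls v)) [:: x] by [].
apply: uniq_perm; rewrite ?filter_uniq ?uniq_refls //.
move=> t; rewrite mem_filter; have := odd_count_refls t e.
have := count_filter (pred1 t) st (refls u); rewrite E.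
have -> : count (predI (pred1 t) st) (refls u) = (st t * count_mem t (refls u))%N.
  case Et: (st t); rewrite ?mul1n ?mul0n.
    by apply: eq_count => y /=; case: eqP => // ->.
  by rewrite (@eq_count _ _ pred0) ?count_pred0 // => y /=; case: eqP => // ->.
rewrite (count_uniq_mem t (uniq_refls red)) inE eq_sym /= addn0.
by case: (st t); rewrite /= ?mul1n ?mul0n; [move=> <-|]; case: (x == t) => //; case: (t \in _).
Qed.

End Reflections.

(* What is used of a Coxeter system: it makes sense for the pair formed by the
   neutral group and its generators without knowing that it is a Coxeter system. *)
Definition signed_system (W : groupType) (S : {pred W}) : Prop :=
  [/\ forall w, exists u : seq (gens S), wprod u = w,
      forall u v : seq (gens S), wprod u = wprod v -> odd (size u) = odd (size v)
    & forall s : gens S, (val s * val s = 1)%g].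

Lemma coxeter_signed (W : groupType) (S : {pred W}) :
  coxeter_system S -> signed_system S.
Proof.
move=> cox; split; [by case: cox | exact: odd_size_wprod | exact: gensK].
Qed.

Section Signed.
Variables (W : groupType) (S : {pred W}) (sgn : signed_system S).

Lemma gens_inv (s : gens S) : ((val s)^-1 = val s)%g.
Proof. by apply: (mulgI (val s)); rewrite mulgV; case: sgn => _ _ ->. Qed.

Lemma odd_ell (u : seq (gens S)) : odd (ell S (wprod u)) = odd (size u).
Proof. by have [v [vu <-]] := ellP u; case: sgn => _ h _; apply: h. Qed.

(** Equality of the two lengths is excluded by parity. *)
Lemma ell_mul_gen (x : W) (s : gens S) :
  (ell S x < ell S (x * val s)%g)%N \/ (ell S (x * val s)%g < ell S x)%N.
Proof.
have [gen _ _] := sgn; have [u <-] := gen x.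
have := odd_ell (u ++ [:: s]); rewrite wprod_cat /= mulg1 size_cat oddD -odd_ell /=.
by case: ltngtP => [||->]; [left | right | case: odd].
Qed.

Lemma gen_neq1 (s : gens S) : val s <> 1%g.
Proof. by move=> e; have := odd_ell [:: s]; have := odd_ell [::]; rewrite /= mulg1 e => ->. Qed.

End Signed.

(** * Generators and sign of the neutral group *)

Section NeutralGenerators.
Variables (W : groupType) (S : {pred W}) (cox : coxeter_system S).
Variables (o : wset W) (L : o).

Lemma neutral_wprod (u : seq (gens S)) :
  neutral S L (wprod u) <-> ws_act L (wprod u) = L /\ bword L u = 1%g.
Proof.
split=> [[h [v [vu b]]]|[h b]]; split=> //; last by exists u.
by rewrite (bword_wprod cox L (esym vu)).
Qed.

Lemma ellL_word_cat (M : o) (u v : seq (gens S)) :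
  ellL_word M (u ++ v) = (ellL_word M u + ellL_word (ws_act M (wprod u)) v)%N.
Proof. by rewrite /ellL_word stays_cat count_cat. Qed.

Lemma ellL_word_rev (M : o) (u : seq (gens S)) :
  ellL_word (ws_act M (wprod u)) (rev u) = ellL_word M u.
Proof.
elim: u M => [|s u IH] M //=.
rewrite rev_cons -cats1 ellL_word_cat (wprod_rev cox) ws_actM IH -ws_actM mulgV ws_act1.
rewrite addnC /ellL_word /= (ws_gensK cox) addn0; congr (nat_of_bool (_ == _) + _)%N.
by apply/asboolP/asboolP.
Qed.

Lemma bword_clean (M : o) (u : seq (gens S)) :
  ellL_word M u = 0%N -> bword M u = wprod u.
Proof.
elim: u M => [|s u IH] M //; rewrite /ellL_word /= => /eqP.
rewrite addn_eq0 => /andP[h /eqP /IH]; rewrite /bword /= => <-.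
by case: asboolP h.
Qed.

Lemma ellL_word1P (M : o) (u : seq (gens S)) : ellL_word M u = 1%N ->
  exists u1 s u2, [/\ u = u1 ++ s :: u2, ellL_word M u1 = 0%N,
    ws_act (ws_act M (wprod u1)) (val s) = ws_act M (wprod u1)
    & bword M u = (wprod u1 * wprod u2)%g].
Proof.
elim: u M => [|s u IH] M //; rewrite /ellL_word /=; case: asboolP => e /= => [[h]|].
  exists [::], s, u; rewrite /= ws_act1 mul1g; split=> //.
  rewrite /bword /= asboolT //= -[mask _ _]/(mask _ _).
  by apply: bword_clean; rewrite /ellL_word.
rewrite add0n => /IH[u1 [s' [u2 [-> h1 h2 h3]]]].
exists (s :: u1), s', u2; split=> //; rewrite /ellL_word /= ?asboolF //.
- by rewrite ws_actM.
- by rewrite /bword /= asboolF //= -mulgA -h3.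
Qed.

Let nG := neutral_group L cox.
Let nS := neutral_gens cox L.

Lemma val_neutralM (x y : nG) : val (x * y)%g = (val x * val y)%g.
Proof. by []. Qed.
Lemma val_neutral1 : val (1 : nG)%g = 1%g.
Proof. by []. Qed.
Lemma val_neutralV (x : nG) : val (x^-1)%g = (val x)^-1%g.
Proof. by apply: (mulgI (val x)); rewrite -val_neutralM !mulgV. Qed.

(** The word v s v^-1 retraces the moves of v after its single staying letter s, so that b_L is 1
    and exactly one letter stays. The word need not be reduced, whence the recourse to
    [ellL_word1_reduced]. *)
Lemma clean_conj_gen (v : seq (gens S)) (s : gens S) : ellL_word L v = 0%N ->
  ws_act (ws_act L (wprod v)) (val s) = ws_act L (wprod v) ->
  exists r : gens nS, val (val r) = (wprod v * val s * (wprod v)^-1)%g.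
Proof.
move=> h e; pose u := v ++ s :: rev v.
have uE : wprod u = (wprod v * val s * (wprod v)^-1)%g.
  by rewrite wprod_cat /= (wprod_rev cox) mulgA.
have neu : neutral S L (wprod u).
  apply/neutral_wprod; split; first by rewrite uE !ws_actM e -ws_actM mulgV ws_act1.
  rewrite /u -cat1s !bword_cat {2}/bword /= asboolT // mul1g mulg1 e.
  by rewrite (bword_rev cox) mulgV.
have l1 : ellL_word L u = 1%N.
  rewrite ellL_word_cat h -cat1s ellL_word_cat {1}/ellL_word /= asboolT //= mulg1 e.
  by rewrite ellL_word_rev h.
have nP : `[< neutral S L (wprod u) >] by apply/asboolP.
pose w : nG := exist _ (wprod u) nP.
have wS : w \in nS.
  apply/asboolP; have [u' red u'u] := reduced_exists u.
  by exists u'; split; rewrite // (ellL_word1_reduced cox (esym u'u) red l1).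
by exists (exist _ w wS); rewrite -uE.
Qed.

(** A reduced word of r splits at its only staying letter as v s v'. Then b_L is the product of v
    and v', and it must be 1, so v' is inverse to v. *)
Lemma neutral_genP (r : gens nS) : exists (v : seq (gens S)) (s : gens S),
  [/\ ellL_word L v = 0%N, ws_act (ws_act L (wprod v)) (val s) = ws_act L (wprod v)
    & val (val r) = (wprod v * val s * (wprod v)^-1)%g].
Proof.
case: r => [w wS] /=; have /asboolP[u [red uw l1]] := wS.
have [v [s [v' [uE h e]]]] := ellL_word1P l1.
have neu : neutral S L (val w) by apply/asboolP; exact: (svalP w).
move: neu; rewrite -uw => /neutral_wprod[_ ->] b.
exists v, s; split=> //; rewrite -uw uE wprod_cat /= mulgA; congr (_ * _)%g.
by apply: (mulgI (wprod v)); rewrite -b mulgV.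
Qed.

(** If xs is shorter than x, the pair (xs, s) presents the same reflection with the lengths in the
    right order. So [refl_root] and [refl_coroot] never take their default value on generators. *)
Lemma neutral_gen_refl_pres (r : gens nS) : exists p : W * gens S, refl_pres (val (val r)) p.
Proof.
have [v [s [_ _ rE]]] := neutral_genP r; have sg := coxeter_signed cox.
have [lt|lt] := ell_mul_gen sg (wprod v) s; first by exists (wprod v, s).
exists ((wprod v * val s)%g, s); split; rewrite /=.
  by rewrite rE invgM -!mulgA mulVKg.
by rewrite -mulgA (gensK cox) mulg1.
Qed.

(** Induction on u, with a prefix v none of whose letters stays: a moving letter is appended to v, a
    staying one is conjugated by v into a generator of the neutral group. For v empty and u neutral
    this proves that these generators generate. *)
Lemma neutral_decomposition (v u : seq (gens S)) : ellL_word L v = 0%N ->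
  exists x : seq (gens nS), (wprod v * wprod u)%g
    = (val (wprod x) * (wprod v * bword (ws_act L (wprod v)) u))%g.
Proof.
elim: u v => [|s u IH] v h; first by exists [::]; rewrite val_neutral1 mul1g.
have [e|ne] := pselect (ws_act (ws_act L (wprod v)) (val s) = ws_act L (wprod v)).
  have [r rE] := clean_conj_gen h e; have [x xE] := IH v h.
  exists (r :: x); rewrite /bword /= asboolT //= e rE.
  by rewrite -!mulgA -xE mulKg.
have h' : ellL_word L (v ++ [:: s]) = 0%N.
  by rewrite ellL_word_cat h /ellL_word /= asboolF.
have [x] := IH _ h'; rewrite wprod_cat /= mulg1 ws_actM => xE.
by exists x; rewrite /bword /= asboolF //= mulgA xE !mulgA.
Qed.

(** Each generator is conjugate to a letter, hence odd, so the sign of W restricts to a sign on the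
    neutral group. *)
Lemma neutral_odd_word (x : seq (gens nS)) : exists2 u : seq (gens S),
  wprod u = val (wprod x) & odd (size u) = odd (size x).
Proof.
elim: x => [|r x [u uE su]]; first by exists [::].
have [v [s [_ _ rE]]] := neutral_genP r; exists (v ++ s :: rev v ++ u).
  by rewrite wprod_cat /= wprod_cat (wprod_rev cox) uE rE !mulgA.
by rewrite size_cat /= size_cat size_rev addnS /= addnA addnn oddD odd_double su.
Qed.

Lemma neutral_signed : signed_system nS.
Proof.
split=> [w|x y e|r].
- have [_ gen _] := cox; have [u uE] := gen (val w).
  have neu : neutral S L (val w) by apply/asboolP; exact: (svalP w).
  move: neu; rewrite -uE => /neutral_wprod[_ b].
  have [x] := @neutral_decomposition [::] u erefl.
  rewrite /= ws_act1 b !mul1g mulg1 => xE.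
  by exists x; apply: val_inj; exact: etrans (esym xE) uE.
- have [u uE <-] := neutral_odd_word x; have [v vE <-] := neutral_odd_word y.
  by apply: (odd_size_wprod cox); rewrite uE vE e.
- have [v [s [_ _ rE]]] := neutral_genP r; apply: val_inj; rewrite [LHS]/= rE.
  by rewrite -!mulgA mulKg (mulgA (val s)) (gensK cox) mul1g mulgV.
Qed.

End NeutralGenerators.

(** * Graded bimodules *)

Section DirectSums.
Variables (I : eqType) (V : zmodType) (P : I -> V -> Prop) (dP : direct_sum P).

Lemma direct_sum0 i : P i 0. Proof. by case: dP. Qed.
Lemma direct_sumB i v w : P i v -> P i w -> P i (v - w).
Proof. by case: dP => _ h _ _; apply: h. Qed.
Lemma direct_sumN i v : P i v -> P i (- v).
Proof. by move=> h; rewrite -sub0r; apply: direct_sumB; [exact: direct_sum0|]. Qed.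
Lemma direct_sumD i v w : P i v -> P i w -> P i (v + w).
Proof. by move=> hv hw; rewrite -[w]opprK; apply/direct_sumB/direct_sumN. Qed.

Lemma dcomp_ex v : exists sf : seq I * (I -> V),
  [/\ uniq sf.1, forall i, P i (sf.2 i), forall i, i \notin sf.1 -> sf.2 i = 0
    & v = \sum_(i <- sf.1) sf.2 i].
Proof.
have [_ _ h _] := dP; have [s [f [fP ->]]] := h v.
(* The given list may repeat an index; its term is then taken with multiplicity. *)
exists (undup s, fun i => if i \in s then f i *+ count_mem i s else 0).
split=> [|i|i|] /=; first exact: undup_uniq.
- case: ifP => _; last exact: direct_sum0.
  elim: (count_mem i s) => [|n IH]; first by rewrite mulr0n; exact: direct_sum0.
  by rewrite mulrS; apply: direct_sumD.
- by rewrite mem_undup => /negbTE ->.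
- rewrite -big_undup_iterop_count /=; apply: eq_big_seq => i; rewrite mem_undup => ->.
  by [].
Qed.

Definition dcomp v i : V := (sval (cid (dcomp_ex v))).2 i.
Definition dsupp v : seq I := (sval (cid (dcomp_ex v))).1.

Lemma dcompP v i : P i (dcomp v i).
Proof. by rewrite /dcomp; case: cid => -[s f] []. Qed.
Lemma dsupp_uniq v : uniq (dsupp v).
Proof. by rewrite /dsupp; case: cid => -[s f] []. Qed.
Lemma dcomp_out v i : i \notin dsupp v -> dcomp v i = 0.
Proof. by rewrite /dcomp /dsupp; case: cid => -[s f] /= [_ _ h _]; apply: h. Qed.
Lemma dcomp_sum v : v = \sum_(i <- dsupp v) dcomp v i.
Proof. by rewrite /dcomp /dsupp; case: cid => -[s f] []. Qed.

Lemma sum_widen (G : zmodType) (s t : seq I) (F : I -> G) :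
  uniq s -> uniq t -> {subset s <= t} -> (forall i, i \notin s -> F i = 0) ->
  \sum_(i <- s) F i = \sum_(i <- t) F i.
Proof.
move=> us ut st h; rewrite [RHS](bigID (mem s)) /= [X in _ = _ + X]big1 => [|i /h //].
rewrite addr0 -[in RHS]big_filter; apply: perm_big; apply: uniq_perm => //.
  by rewrite filter_uniq.
by move=> i; rewrite mem_filter; case e: (i \in s) => //=; rewrite (st _ e).
Qed.

Lemma dcomp_uniq v (s : seq I) (f : I -> V) : uniq s -> (forall i, P i (f i)) ->
  (forall i, i \notin s -> f i = 0) -> v = \sum_(i <- s) f i -> dcomp v =1 f.
Proof.
move=> us fP f0 vE; pose t := undup (s ++ dsupp v).
have [_ _ _ ind] := dP.
have E : \sum_(i <- t) (dcomp v i - f i) = 0.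
  rewrite big_split /= sumrN; apply/eqP; rewrite subr_eq0; apply/eqP.
  transitivity v; last first.
    rewrite vE; apply: sum_widen; rewrite ?undup_uniq // => i hi.
    by rewrite mem_undup mem_cat hi.
  rewrite {2}[v]dcomp_sum; symmetry; apply: sum_widen;
    rewrite ?undup_uniq ?dsupp_uniq // => i hi; last exact: dcomp_out.
  by rewrite mem_undup mem_cat hi orbT.
move=> i; apply/eqP; rewrite -subr_eq0; apply/eqP.
have [it|] := boolP (i \in t).
  by apply: (ind t _ (undup_uniq _) _ E) => // j; apply: direct_sumB; [exact: dcompP|].
rewrite mem_undup mem_cat negb_or => /andP[/f0 -> /dcomp_out ->].
by rewrite subr0.
Qed.

Lemma dcompD v w i : dcomp (v + w) i = dcomp v i + dcomp w i.
Proof.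
pose t := undup (dsupp v ++ dsupp w).
apply: (@dcomp_uniq _ t (fun i => dcomp v i + dcomp w i)); rewrite ?undup_uniq //.
- by move=> j; apply: direct_sumD; apply: dcompP.
- move=> j; rewrite mem_undup mem_cat negb_or => /andP[/dcomp_out -> /dcomp_out ->].
  by rewrite addr0.
- rewrite big_split /= {1}[v]dcomp_sum {1}[w]dcomp_sum; congr (_ + _);
    apply: sum_widen; rewrite ?undup_uniq ?dsupp_uniq // => j h; rewrite ?dcomp_out //.
  + by rewrite mem_undup mem_cat h.
  + by rewrite mem_undup mem_cat h orbT.
Qed.

Lemma dcomp_hom i v j : P i v -> dcomp v j = if j == i then v else 0.
Proof.
move=> h; apply: (@dcomp_uniq _ [:: i] (fun j => if j == i then v else 0)) => //.
- by move=> l; case: eqP => [->//|_]; exact: direct_sum0.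
- by move=> l; rewrite inE => /negbTE ->.
- by rewrite big_seq1 eqxx.
Qed.

Lemma dcomp_stable (X : V -> Prop) v : X 0 -> (forall x y, X x -> X y -> X (x + y)) ->
  (forall i, X (dcomp v i)) -> X v.
Proof. by move=> X0 XD h; rewrite [v]dcomp_sum; elim/big_ind: _. Qed.

Section Dsum.
Variables (G : zmodType) (F : I -> V -> G).
Hypothesis FD : forall i v w, F i (v + w) = F i v + F i w.

Definition dsum v : G := \sum_(i <- dsupp v) F i (dcomp v i).

Lemma dsumE v t : uniq t -> {subset dsupp v <= t} ->
  dsum v = \sum_(i <- t) F i (dcomp v i).
Proof.
move=> ut h; apply: sum_widen => //; rewrite ?dsupp_uniq // => i /dcomp_out ->.
exact: additive_0.
Qed.

Lemma dsumD v w : dsum (v + w) = dsum v + dsum w.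
Proof.
pose t := undup (dsupp v ++ dsupp w ++ dsupp (v + w)).
have E x : {subset dsupp x <= t} -> dsum x = \sum_(i <- t) F i (dcomp x i).
  by move=> h; apply: dsumE; rewrite ?undup_uniq.
rewrite !E => [|i h|i h|i h]; rewrite ?mem_undup ?mem_cat ?h ?orbT //.
by rewrite -big_split /=; apply: eq_bigr => i _; rewrite dcompD FD.
Qed.

Lemma dsum_hom i v : P i v -> dsum v = F i v.
Proof.
move=> h; pose t := undup (i :: dsupp v).
rewrite (@dsumE _ t) ?undup_uniq // => [|j hj]; last by rewrite mem_undup inE hj orbT.
rewrite (bigD1_seq i) ?undup_uniq ?mem_undup ?mem_head //= big1 => [|j /negbTE ne].
  by rewrite (dcomp_hom _ h) eqxx addr0.
by rewrite (dcomp_hom _ h) ne; exact: additive_0.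
Qed.

End Dsum.

Lemma direct_sum_span v : addspan (fun t => exists i, P i t) v.
Proof.
rewrite [v]dcomp_sum; elim/big_ind: _ => [|x y|i _]; [exact: Span0|exact: addspanD|].
by apply: SpanG; exists i; exact: dcompP.
Qed.

Lemma direct_sum_ext (G : zmodType) (f g : V -> G) :
  (forall x y, f (x + y) = f x + f y) -> (forall x y, g (x + y) = g x + g y) ->
  (forall i v, P i v -> f v = g v) -> f =1 g.
Proof.
move=> fD gD h v; apply: (dcomp_stable (X := fun v => f v = g v)).
- by rewrite !additive_0.
- by move=> x y ex ey; rewrite fD gD ex ey.
- by move=> i; apply: (h i); exact: dcompP.
Qed.

End DirectSums.

Lemma addspan_mono (V : zmodType) (P P' : V -> Prop) v :
  (forall t, P t -> P' t) -> addspan P v -> addspan P' v.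
Proof.
move=> h; elim=> [|t /h|x y _ hx _ hy]; [exact: Span0|exact: SpanG|exact: SpanB].
Qed.

Lemma direct_sum_indep (I : eqType) (V : zmodType) (P : I -> V -> Prop) :
  (forall i, P i 0) -> (forall i v w, P i v -> P i w -> P i (v - w)) ->
  (forall v, addspan (fun t => exists i, P i t) v) ->
  (forall (s : seq I) (f : I -> V), uniq s -> (forall i, P i (f i)) ->
    \sum_(i <- s) f i = 0 -> forall i, i \in s -> f i = 0) -> direct_sum P.
Proof.
move=> P0 PB sp ind; split=> // v.
have [s [f [us fP f0 vE]]] : exists s f, [/\ uniq s, forall i, P i (f i),
    forall i, i \notin s -> f i = 0 & v = \sum_(i <- s) f i]; last by exists s, f.
elim: (sp v) => [|w [i wi]|_ _ _ [s [f [us fP f0 ->]]] _ [t [g [ut gP g0 ->]]]].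
- by exists [::], (fun=> 0); rewrite big_nil; split.
- exists [:: i], (fun j => if j == i then w else 0); split=> //.
  + by move=> j; case: eqP => [->|].
  + by move=> j; rewrite inE => /negbTE ->.
  + by rewrite big_seq1 eqxx.
- exists (undup (s ++ t)), (fun i => f i - g i); split; first exact: undup_uniq.
  + by move=> i; exact: PB.
  + move=> i; rewrite mem_undup mem_cat negb_or => /andP[/f0 -> /g0 ->].
    by rewrite subr0.
  + rewrite big_split /= sumrN; congr (_ - _); apply: sum_widen;
      rewrite ?undup_uniq // => i h; by rewrite mem_undup mem_cat h ?orbT.
Qed.

Lemma direct_sum_proj (I : eqType) (V : zmodType) (P : I -> V -> Prop)
    (p : I -> V -> V) :
  (forall i, P i 0) -> (forall i v w, P i v -> P i w -> P i (v - w)) ->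
  (forall v, addspan (fun t => exists i, P i t) v) ->
  (forall i v w, p i (v + w) = p i v + p i w) ->
  (forall i j v, P i v -> p j v = if j == i then v else 0) -> direct_sum P.
Proof.
move=> P0 PB sp pD pE; apply: direct_sum_indep => // s f us fP e i i_s.
have := congr1 (p i) e; rewrite (additive_0 (pD i)) => <-.
rewrite (big_morph (p i) (pD i) (additive_0 (pD i))) (bigD1_seq i) //= big1.
  by rewrite addr0 (pE i) // eqxx.
by move=> j /negbTE ne; rewrite (pE j) // eq_sym ne.
Qed.

Lemma direct_sum_bij (I : eqType) (V U : zmodType) (P : I -> V -> Prop)
    (P' : I -> U -> Prop) (j : V -> U) :
  (forall x y, j (x + y) = j x + j y) -> bijective j ->
  (forall i u, P' i u <-> exists2 v, P i v & u = j v) ->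
  direct_sum P -> direct_sum P'.
Proof.
move=> jD [k jK kK] PE dP.
have kD x y : k (x + y) = k x + k y by apply: (can_inj jK); rewrite jD !kK.
have kP i u : P' i u -> P i (k u) by move=> /PE[v vP ->]; rewrite jK.
have jP i v : P i v -> P' i (j v) by move=> h; apply/PE; exists v.
apply: direct_sum_indep.
- by move=> i; rewrite -(additive_0 jD); apply/jP/(direct_sum0 dP).
- move=> i v w /kP hv /kP hw; rewrite -[v]kK -[w]kK -(additive_N jD) -jD.
  exact/jP/(direct_sumB dP).
- move=> u; rewrite -[u]kK; apply: (addspan_map jD _ _ _ (direct_sum_span dP (k u))).
  + exact: Span0.
  + exact: SpanB.
  + by move=> v [i vi]; apply: SpanG; exists i; exact: jP.
- move=> s f us fP e i i_s; have [_ _ _ ind] := dP.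
  apply: (can_inj kK); rewrite (additive_0 kD).
  apply: (ind s (k \o f)) => //; first by move=> l; exact/kP.
  by rewrite /= -(big_morph k kD (additive_0 kD)) e (additive_0 kD).
Qed.

Lemma dcomp_map (I : eqType) (V U : zmodType) (P : I -> V -> Prop) (P' : I -> U -> Prop)
    (dP : direct_sum P) (dP' : direct_sum P') (f : V -> U) :
  (forall x y, f (x + y) = f x + f y) -> (forall i v, P i v -> P' i (f v)) ->
  forall v i, dcomp dP' (f v) i = f (dcomp dP v i).
Proof.
move=> fD fP v i; move: v; apply: (direct_sum_ext dP) => [x y|x y|j v hv].
- by rewrite fD dcompD.
- by rewrite dcompD fD.
rewrite (dcomp_hom dP _ hv) (dcomp_hom dP' _ (fP _ _ hv)).
by case: eqP => // _; rewrite additive_0.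
Qed.

Lemma addspan_neq0 (V : zmodType) (P : V -> Prop) v :
  addspan P v -> v <> 0 -> exists2 t, P t & t <> 0.
Proof.
move=> h; have [//|no] := pselect (exists2 t, P t & t <> 0).
case; apply: (addspan_map (f := id) (Q := fun v => v = 0) _ _ _ _ h) => //.
  by move=> x y -> ->; rewrite subrr.
by move=> u Pu; apply/eqP/negPn/negP => /eqP ne; apply: no; exists u.
Qed.

Section GradedTensor.
Variables (A B C : comNzRingType) (M : bimod A B) (N : bimod B C).
Variables (I : eqType) (op : I -> I -> I) (opA : associative op).
Variables (gM : I -> M -> Prop) (gB : I -> B -> Prop) (gN : I -> N -> Prop).
Hypotheses (dM : direct_sum gM) (dB : direct_sum gB) (dN : direct_sum gN).
Hypothesis gMr : forall i j m b, gM i m -> gB j b -> gM (op i j) (m >* b).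
Hypothesis gNl : forall i j b n, gB i b -> gN j n -> gN (op i j) (b *< n).

Let F i j l (m : M) (n : N) : tens M N := if op j l == i then tpure m n else 0.
Let f i (m : M) (n : N) := dsum dM (fun j m' => dsum dN (fun l => F i j l m') n) m.

Let F1 i j l n m m' : F i j l (m + m') n = F i j l m n + F i j l m' n.
Proof. by rewrite /F; case: eqP; rewrite ?tpureDl ?addr0. Qed.
Let F2 i j l m n n' : F i j l m (n + n') = F i j l m n + F i j l m n'.
Proof. by rewrite /F; case: eqP; rewrite ?tpureDr ?addr0. Qed.
Let f1 i j n m m' : dsum dN (fun l => F i j l (m + m')) n
  = dsum dN (fun l => F i j l m) n + dsum dN (fun l => F i j l m') n.
Proof. by rewrite /dsum -big_split; apply: eq_bigr => l _; exact: F1. Qed.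

Let fDl i m m' n : f i (m + m') n = f i m n + f i m' n.
Proof. by apply: (dsumD dM) => j v w; exact: f1. Qed.
Let fDr i m n n' : f i m (n + n') = f i m n + f i m n'.
Proof.
rewrite /f {1 3 5}/dsum -big_split /=; apply: eq_bigr => j _.
by apply: (dsumD dN) => l v w; exact: F2.
Qed.
Let f_hom i j l m n : gM j m -> gN l n -> f i m n = F i j l m n.
Proof.
move=> hm hn; rewrite /f (dsum_hom dM _ hm); last by move=> *; exact: f1.
by rewrite (dsum_hom dN _ hn) // => *; exact: F2.
Qed.

Let f_bal i : balanced (f i).
Proof.
split=> [m m' n|m n n'|m b n]; [exact: fDl|exact: fDr|].
move: m; apply: (direct_sum_ext dM) => [x y|x y|j m hm]; rewrite ?rmulDl ?fDl //.
move: b; apply: (direct_sum_ext dB) => [x y|x y|k b hb];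
  rewrite ?rmulDr ?lmulDl ?fDl ?fDr //.
move: n; apply: (direct_sum_ext dN) => [x y|x y|l n hn]; rewrite ?lmulDr ?fDr //.
by rewrite (f_hom i (gMr hm hb) hn) (f_hom i hm (gNl hb hn)) /F -opA tpureA.
Qed.

(** [f i] keeps the products of homogeneous components whose indices combine to i. It is balanced
    because the middle ring is a direct sum as well, acts compatibly with [op], and [op] is
    associative. It therefore descends to the projection of the tensor product onto its i-th
    summand. *)
Lemma tens_direct_sum : direct_sum (tens_gr op gM gN).
Proof.
apply: (@direct_sum_proj _ _ _ (fun i => tens_rec (f i))).
- by move=> i; exact: Span0.
- by move=> i; exact: SpanB.
- apply: tind => [m n|x y]; last exact: addspanD.
  rewrite [m](dcomp_sum dM).
  rewrite (big_morph (fun m => tpure m n) (id1 := 0) (op1 := +%R)); first last.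
  + exact: (additive_0 (fun m m' => tpureDl m m' n)).
  + by move=> x y; exact: tpureDl.
  elim/big_ind: _ => [|x y|j _]; [exact: Span0|exact: addspanD|].
  rewrite [n](dcomp_sum dN).
  rewrite (big_morph (tpure (dcomp dM m j)) (id1 := 0) (op1 := +%R)); first last.
  + exact: (additive_0 (tpureDr _)).
  + by move=> x y; exact: tpureDr.
  elim/big_ind: _ => [|x y|l _]; [exact: Span0|exact: addspanD|].
  apply: SpanG; exists (op j l); apply: SpanG.
  by exists j, l, (dcomp dM m j), (dcomp dN n l); split=> //; exact: dcompP.
- by move=> i v w; exact: (tens_recD (f_bal i)).
- move=> i j v; elim=> [|_ [k [l [m [n [<- hm hn ->]]]]]|x y _ hx _ hy].
  + by rewrite (additive_0 (tens_recD (f_bal j))); case: eqP.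
  + by rewrite (tens_rec_pure _ _ (f_bal j)) (f_hom j hm hn) /F eq_sym.
  + rewrite (tens_recD (f_bal j)) (additive_N (tens_recD (f_bal j))) hx hy.
    by case: eqP; rewrite ?subr0.
Qed.

End GradedTensor.

Lemma graded_bimod_tens (A B C : comNzRingType) (M : bimod A B) (N : bimod B C)
    (gA : int -> A -> Prop) (gB : int -> B -> Prop) (gC : int -> C -> Prop)
    (gM : int -> M -> Prop) (gN : int -> N -> Prop) :
  direct_sum gB -> graded_bimod gA gB gM -> graded_bimod gB gC gN ->
  graded_bimod gA gC (tens_gr (fun i j : int => i + j) gM gN).
Proof.
move=> dB [dM Ml Mr] [dN Nl Nr]; split.
- by apply: (tens_direct_sum _ dM dB dN) => //; exact: addrA.
- move=> i j a m ha; apply: (addspan_map (f := fun m => a *< m) (lmulDr a)).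
  + exact: Span0.
  + exact: SpanB.
  move=> _ [k [l [x [y [<- hx hy ->]]]]]; apply: SpanG.
  by exists (i + k), l, (a *< x), y; rewrite addrA tpure_l; split=> //; exact: Ml.
- move=> i j m b hm hb; move: m hm.
  apply: (addspan_map (f := fun m => m >* b) (fun x y => rmulDl x y b)).
  + exact: Span0.
  + exact: SpanB.
  move=> _ [k [l [x [y [<- hx hy ->]]]]]; apply: SpanG.
  by exists k, (l + j), x, (y >* b); rewrite -addrA tpure_r; split=> //; exact: Nr.
Qed.

Lemma graded_sub_dcomp (V : zmodType) (gr : int -> V -> Prop) (dg : direct_sum gr)
    (P : V -> Prop) :
  (forall v i, P v -> P (dcomp dg v i)) -> graded_sub gr P.
Proof.
move=> h v Pv; exists (dsupp dg v), (dcomp dg v); split; last exact: dcomp_sum.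
by move=> i; split; [exact: dcompP|exact: h].
Qed.

Lemma dcomp_graded_sub (V : zmodType) (gr : int -> V -> Prop) (dg : direct_sum gr)
    (P : V -> Prop) v i :
  P 0 -> (forall x y, P x -> P y -> P (x - y)) -> graded_sub gr P -> P v ->
  P (dcomp dg v i).
Proof.
move=> P0 PB gP /gP[s [f [fP ->]]].
have PD x y : P x -> P y -> P (x + y).
  by move=> hx hy; rewrite -[y]opprK -[- y]sub0r; apply: (PB _ _ hx); exact: PB.
have pD : {morph (fun v => dcomp dg v i) : u v / u + v} by move=> x y; exact: dcompD.
rewrite (big_morph _ pD (additive_0 pD)); elim/big_ind: _ => // j _.
by have [hj Pj] := fP j; rewrite (dcomp_hom dg _ hj); case: eqP.
Qed.

Lemma graded_sub_addspan (V : zmodType) (gr : int -> V -> Prop) (P : V -> Prop) :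
  direct_sum gr ->
  (forall t, P t -> addspan (fun u => P u /\ exists i, gr i u) t) ->
  graded_sub gr (addspan P).
Proof.
move=> dg hP; apply: (graded_sub_dcomp (dg := dg)) => v i hv.
have {}hv : addspan (fun u => P u /\ exists i, gr i u) v.
  by apply: (addspan_map (f := id) _ _ _ _ hv) => //; [exact: Span0|exact: SpanB].
apply: (addspan_map (f := fun v => dcomp dg v i) _ _ _ _ hv).
- by move=> x y; exact: dcompD.
- exact: Span0.
- exact: SpanB.
move=> u [Pu [j uj]]; rewrite (dcomp_hom dg _ uj); case: eqP => _; last exact: Span0.
exact: SpanG.
Qed.

Section FlatFinite.
Variables A B : comNzRingType.

(* A finite right dual basis: M is projective of finite type over B. *)
Definition right_basis (M : bimod A B) : Prop :=
  exists (n : nat) (b : 'I_n -> M) (c : 'I_n -> M -> B),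
    [/\ forall i m m', c i (m + m') = c i m + c i m',
        forall i m r, c i (m >* r) = c i m * r
      & forall m, m = \sum_i b i >* c i m].

(** The [c i] give coordinates on M (x) X with values in X. They determine an element and commute
    with f, so injectivity is checked coordinatewise. *)
Lemma flat_right_basis (M : bimod A B) : right_basis M -> flat_right M.
Proof.
move=> [n [b [c [cD cr mE]]]] X Y f f_inj.
have bal (Z : bimod B int) i : balanced (fun (m : M) (x : Z) => c i m *< x).
  by split=> *; rewrite ?cD ?lmulDl ?lmulDr // cr lmulA.
pose C (Z : bimod B int) i : tens M Z -> Z := tens_rec (fun m x => c i m *< x).
have CD Z i x y : C Z i (x + y) = C Z i x + C Z i y by exact: (tens_recD (bal Z i)).
have tE Z (t : tens M Z) : t = \sum_i tpure (b i) (C Z i t).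
  move: t; apply: text => [x y|x y|m x] //.
    by rewrite -big_split; apply: eq_bigr => i _; rewrite CD tpureDr.
  rewrite {1}[m]mE; have pD : {morph (fun m => tpure m x : tens M Z) : u v / u + v}.
    by move=> u v; exact: tpureDl.
  rewrite (big_morph _ pD (additive_0 pD)); apply: eq_bigr => i _.
  by rewrite tpureA /C (tens_rec_pure _ _ (bal Z i)).
have Cf t i : C Y i (tens_map (bhid M) f t) = f (C X i t).
  move: t; apply: text => [x y|x y|m x]; rewrite ?bhD ?CD ?bhD //.
  by rewrite tens_mapE /C !(tens_rec_pure _ _ (bal _ _)) bhl.
move=> t t' e; rewrite [t]tE [t']tE; apply: eq_bigr => i _; congr tpure.
by apply: f_inj; rewrite -!Cf e.
Qed.

(** Finite generation on the left passes to tensor products, which finite generation as a bimodule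
    does not in general. *)
Definition left_fg (M : bimod A B) : Prop :=
  exists (n : nat) (g : 'I_n -> M), forall m, exists a : 'I_n -> A,
    m = \sum_i a i *< g i.

Lemma left_fg_bimod (M : bimod A B) : left_fg M -> fg_bimod M.
Proof.
move=> [n [g h]]; exists [seq g i | i <- enum 'I_n] => m; have [a ->] := h m.
elim/big_ind: _ => [|x y|i _]; [exact: Span0|exact: addspanD|apply: SpanG].
by exists (g i), (a i), 1; rewrite rmul1 map_f ?mem_enum.
Qed.

End FlatFinite.

Section TensorInstances.
Variables (A B C : comNzRingType).

Lemma flat_right_tens (M : bimod A B) (N : bimod B C) :
  flat_right M -> flat_right N -> flat_right (tens M N).
Proof.
move=> fM fN X Y f f_inj.
have inj := fM _ _ _ (fN _ _ _ f_inj).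
move=> t t' e; apply: (can_inj (g := tassoci M N X) (f := tassoc M N X)).
  apply: tens_ext3l => [x y|x y|m n p]; rewrite ?bhD //.
  by rewrite tassocE tassociE.
apply: inj.
have E (x : tens (tens M N) X) : tens_map (bhid M) (tens_map (bhid N) f) (tassoc M N X x)
    = tassoc M N Y (tens_map (bhid (tens M N)) f x).
  move: x; apply: tens_ext3l => [x y|x y|m n p]; rewrite ?bhD //.
  by rewrite tassocE !tens_mapE tassocE.
by rewrite !E e.
Qed.

Lemma left_fg_tens (M : bimod A B) (N : bimod B C) :
  left_fg M -> left_fg N -> left_fg (tens M N).
Proof.
move=> [k [g hg]] [l [h hh]].
pose G (p : 'I_k * 'I_l) : tens M N := tpure (g p.1) (h p.2).
suff H t : exists a : 'I_k * 'I_l -> A, t = \sum_p a p *< G p.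
  exists #|{: 'I_k * 'I_l}|, (G \o enum_val) => t; have [a ->] := H t.
  exists (a \o enum_val).
  by rewrite (reindex (@enum_val _ {: 'I_k * 'I_l})) //=; exact: onW_bij (enum_val_bij _).
move: t; apply: tind => [m n|x y [a ->] [b ->]]; last first.
  exists (fun p => a p + b p); rewrite -big_split.
  by apply: eq_bigr => p _; rewrite lmulDl.
have [b nE] := hh n; have [c cE] : exists c : 'I_l -> 'I_k -> A,
    forall j, m >* b j = \sum_i c j i *< g i.
  by have [c cP] := choice (fun j => hg (m >* b j)); exists c.
exists (fun p => c p.2 p.1); rewrite nE.
have pD (x : M) : {morph (fun y => tpure x y : tens M N) : u v / u + v}.
  by move=> u v; exact: tpureDr.
have pD' (x : N) : {morph (fun y => tpure y x : tens M N) : u v / u + v}.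
  by move=> u v; exact: tpureDl.
rewrite (big_morph _ (pD m) (additive_0 (pD m))).
rewrite -(pair_bigA _ (fun i j => c j i *< G (i, j))) [RHS]exchange_big /=.
apply: eq_bigr => j _; rewrite -tpureA cE.
rewrite (big_morph _ (pD' (h j)) (additive_0 (pD' (h j)))).
by apply: eq_bigr => i _; exact: (esym (tpure_l _ _ _)).
Qed.

End TensorInstances.

(** * Localized bimodules *)

(* The data of R, Q and W used below, so that they apply to both (W, S) and the
   neutral group. *)
Record setting (R Q : comNzRingType) (iota : {rmorphism R -> Q}) (W : groupType)
    (act : W -> {rmorphism R -> R}) (grR : int -> R -> Prop) (grQ : int -> Q -> Prop) :
    Prop := Setting {
  st_inj : injective iota;
  st_frac : forall q, exists f d, (exists e, iota d * e = 1) /\ q * iota d = iota f;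
  st_act1 : act 1%g =1 id;
  st_actM : forall x y, act (x * y)%g =1 act x \o act y;
  st_act_unit : forall w d, (exists e, iota d * e = 1) -> exists e, iota (act w d) * e = 1;
  st_grR : direct_sum grR;
  st_grQ : direct_sum grQ;
  st_grQ1 : grQ 0 1;
  st_grRM : forall i j f g, grR i f -> grR j g -> grR (i + j) (f * g);
  st_grQM : forall i j f g, grQ i f -> grQ j g -> grQ (i + j) (f * g);
  st_gr_iota : forall i f, grR i f -> grQ i (iota f)
}.

Lemma bij_additive_inj (U V : zmodType) (f : U -> V) :
  (forall x y, f (x + y) = f x + f y) -> (forall x, f x = 0 -> x = 0) -> injective f.
Proof.
move=> fD h x y e; apply/eqP; rewrite -subr_eq0; apply/eqP/h.
by rewrite fD (additive_N fD) e subrr.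
Qed.

Lemma inj_surj_bij (U V : Type) (f : U -> V) :
  injective f -> (forall y, exists x, f x = y) -> bijective f.
Proof.
move=> fi fs; have [g gK] := choice fs.
by exists g => // x; apply: fi; rewrite gK.
Qed.

Section BimodOps.
Variables (A B : comNzRingType) (M : bimod A B).

Lemma lmulC (a b : A) (m : M) : a *< (b *< m) = b *< (a *< m).
Proof. by rewrite !lmulA mulrC. Qed.
Lemma rmulC (a b : B) (m : M) : m >* a >* b = m >* b >* a.
Proof. by rewrite !rmulA mulrC. Qed.

Lemma rmul_cross (m n : M) (a b : B) :
  (m - n) >* (a * b) = m >* a >* b - n >* b >* a.
Proof. by rewrite rmulDl rmulNl !rmulA [b * a]mulrC. Qed.

Lemma rmul_inj (b c : B) : b * c = 1 -> injective (fun m : M => m >* b).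
Proof. by move=> bc m n /(congr1 (fun x => x >* c)); rewrite !rmulA bc !rmul1. Qed.
Lemma lmul_inj (a c : A) : a * c = 1 -> injective (fun m : M => a *< m).
Proof. by move=> ac m n /(congr1 (fun x => c *< x)); rewrite !lmulA mulrC ac !lmul1. Qed.

End BimodOps.

Section TensorOps.
Variables (A B C : comNzRingType) (M : bimod A B) (N : bimod B C).
Lemma tpure0l (n : N) : tpure (0 : M) n = 0.
Proof. exact: (additive_0 (fun x y => tpureDl x y n)). Qed.
Lemma tpure0r (m : M) : tpure m (0 : N) = 0.
Proof. exact: (additive_0 (tpureDr m)). Qed.
Lemma tpureBl (m m' : M) (n : N) : tpure (m - m') n = tpure m n - tpure m' n.
Proof. by rewrite tpureDl (additive_N (fun x y => tpureDl x y n)). Qed.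
Lemma tpureBr (m : M) (n n' : N) : tpure m (n - n') = tpure m n - tpure m n'.
Proof. by rewrite tpureDr (additive_N (tpureDr m)). Qed.
Lemma tpure_suml (I : Type) (r : seq I) (P : pred I) (F : I -> M) (n : N) :
  tpure (\sum_(i <- r | P i) F i) n = \sum_(i <- r | P i) tpure (F i) n.
Proof. exact: (big_morph (fun m => tpure m n) (fun x y => tpureDl x y n) (tpure0l n)). Qed.
Lemma tpure_sumr (I : Type) (r : seq I) (P : pred I) (F : I -> N) (m : M) :
  tpure m (\sum_(i <- r | P i) F i) = \sum_(i <- r | P i) tpure m (F i).
Proof. exact: (big_morph (tpure m) (tpureDr m) (tpure0r m)). Qed.

Lemma addspan_tpure (P : M -> Prop) (P' : N -> Prop) m n :
  addspan P m -> addspan P' n ->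
  addspan (fun t => exists x y, [/\ P x, P' y & t = tpure x y]) (tpure m n).
Proof.
move=> hm hn; apply: (addspan_map (f := fun m => tpure m n) _ _ _ _ hm).
- by move=> x y; exact: tpureDl.
- exact: Span0.
- exact: SpanB.
move=> x Px; apply: (addspan_map (f := tpure x) _ _ _ _ hn).
- exact: tpureDr.
- exact: Span0.
- exact: SpanB.
by move=> y Py; apply: SpanG; exists x, y.
Qed.
End TensorOps.

Section Setting.
Variables (R Q : comNzRingType) (iota : {rmorphism R -> Q}) (W : groupType).
Variables (act : W -> {rmorphism R -> R}).
Variables (grR : int -> R -> Prop) (grQ : int -> Q -> Prop).
Hypothesis st : setting iota act grR grQ.

Local Notation idR := (idfun : {rmorphism R -> R}).
Local Notation idQ := (idfun : {rmorphism Q -> Q}).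
Local Notation RQ := (ring_bimod iota idQ).
Local Notation addZ := (fun i j : int => i + j).
Local Notation lbm := (lbimod iota W).

Definition lunit (d : R) : Prop := exists e, iota d * e = 1.

Lemma lunit1 : lunit 1.
Proof. by exists 1; rewrite rmorph1 mul1r. Qed.
Lemma lunitM c d : lunit c -> lunit d -> lunit (c * d).
Proof.
move=> [e ce] [e' de']; exists (e * e').
by rewrite rmorphM /= mulrACA ce de' mulr1.
Qed.

Section Extend.
Variables (A : comNzRingType) (M : bimod A R).
Local Notation T := (tens M RQ).

Lemma tensRQ_pure (t : T) : exists (m : M) (d : R) (e : Q),
  iota d * e = 1 /\ t = tpure m (e : RQ).
Proof.
move: t; apply: tind => [m q|x y [m [d [e [de ->]]]] [m' [d' [e' [de' ->]]]]].
  have [f [d [[e de] qd]]] := st_frac st q.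
  exists (m >* f), d, e; split=> //; rewrite tpureA /= -qd.
  by congr tpure; rewrite -mulrA de mulr1.
exists (m >* d' + m' >* d), (d * d'), (e * e'); split.
  by rewrite rmorphM /= mulrACA de de' mulr1.
rewrite tpureDl !tpureA /=; congr (tpure _ _ + tpure _ _).
  by rewrite mulrCA de' mulr1.
by rewrite mulrA de mul1r.
Qed.

Let ZR : bimod R int := ring_bimod idR (intr : {rmorphism int -> R}).
Let ZQ : bimod R int := ring_bimod iota (intr : {rmorphism int -> Q}).

(** Flatness is applied to the inclusion of R in Q. As [flat_right] speaks of (R, Z)-bimodules, the
    inclusion is viewed as the map from [ZR] to [ZQ]. *)
Lemma tensRQ_inj (m : M) : flat_right M -> tpure m (1 : RQ) = 0 -> m = 0.
Proof.
move=> fM e.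
have fr (t : ZR) (n : int) : iota (t * n%:~R) = iota t * n%:~R.
  by rewrite rmorphM rmorph_int.
pose f : bhom ZR ZQ := @BHom _ _ ZR ZQ iota (rmorphD iota) (rmorphM iota) fr.
have inj := fM _ _ f (st_inj st).
have b1 : balanced (fun (m : M) (q : RQ) => tpure m (q : ZQ)).
  by split=> *; rewrite ?tpureDl ?tpureDr // tpureA.
have e1 : tpure m (1 : ZQ) = 0.
  by rewrite -(tens_rec_pure _ _ b1) -[pure _ _]/(tpure _ _) e (additive_0 (tens_recD b1)).
have e2 : tpure m (1 : ZR) = 0.
  by apply: inj; rewrite bh0 tens_mapE /= rmorph1.
have b2 : balanced (fun (m : M) (r : ZR) => m >* (r : R)).
  by split=> *; rewrite ?rmulDl ?rmulDr // rmulA.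
rewrite -[m]rmul1 -[LHS](tens_rec_pure m (1 : ZR) b2) -[pure _ _]/(tpure _ _) e2.
exact: (additive_0 (tens_recD b2)).
Qed.

End Extend.

(** The map [xi] for an arbitrary setting. *)
Definition xim (X : lbm) : bhom (tens (lb_M X) RQ) (restr iota idQ (lb_E X)).
Proof.
refine (@tens_hom _ _ _ _ _ (restr iota idQ (lb_E X))
  (fun m (q : RQ) => (lb_loc X m : lb_E X) >* (q : Q)) _ _ _).
- by split=> *; rewrite ?bhD ?rmulDl ?rmulDr // bhr [LHS]rmulA.
- by move=> *; cbv beta; rewrite bhl [LHS]lrmulA.
- by move=> *; cbv beta; rewrite [RHS]rmulA.
Defined.

Arguments xim : simpl never.

Lemma ximE (X : lbm) m q : xim X (tpure m q) = (lb_loc X m : lb_E X) >* (q : Q).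
Proof. exact: tens_homE. Qed.

(** [in_C] for an arbitrary setting, the condition on parameters being kept apart. *)
Definition goodC (X : lbm) : Prop :=
  [/\ [/\ graded_bimod grR grR (@lb_gr _ _ _ _ X), fg_bimod (lb_M X)
        & flat_right (lb_M X)],
      [/\ graded_bimod grQ grQ (@lb_grE _ _ _ _ X), direct_sum (@lb_piece _ _ _ _ X)
        & forall w, graded_sub (@lb_grE _ _ _ _ X) (@lb_piece _ _ _ _ X w)],
      forall w e (f : R), @lb_piece _ _ _ _ X w e -> e >* iota f = iota (act w f) *< e,
      exists s : seq W, forall w e, @lb_piece _ _ _ _ X w e -> e <> 0 -> w \in s
    & bijective (xim X) /\
      (forall i t, @tens_gr _ _ _ (lb_M X) RQ _ addZ (@lb_gr _ _ _ _ X) grQ i t ->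
         @lb_grE _ _ _ _ X i (xim X t))].

(** For a good object M embeds in its localization, and this is the intersection of M with the
    w-piece. *)
Definition lpart (X : lbm) (w : W) (m : lb_M X) : Prop :=
  @lb_piece _ _ _ _ X w (lb_loc X m).

(** Such a family is all that must be inspected in order to recognize a morphism, by
    [lhom_cond_lgens]. *)
Definition lgens (X : lbm) (G : W -> lb_M X -> Prop) : Prop :=
  forall w e, @lb_piece _ _ _ _ X w e ->
    exists d t, [/\ lunit d, addspan (G w) t & e >* iota d = lb_loc X t].

Section Pieces.
Variable X : lbm.
Lemma pieceB w x y : @lb_piece _ _ _ _ X w x -> lb_piece w y -> lb_piece w (x - y).
Proof. by case: (lb_pieceP X w) => _ h _ _; exact: h. Qed.
Lemma piece_0 w : @lb_piece _ _ _ _ X w 0.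
Proof. by case: (lb_pieceP X w). Qed.
Lemma piece_l w a x : @lb_piece _ _ _ _ X w x -> lb_piece w (a *< x).
Proof. by case: (lb_pieceP X w) => _ _ h _; exact: h. Qed.
Lemma piece_r w a x : @lb_piece _ _ _ _ X w x -> lb_piece w (x >* a).
Proof. by case: (lb_pieceP X w) => _ _ _ h; exact: h. Qed.

Lemma lpart0 w : lpart w (0 : lb_M X).
Proof. by rewrite /lpart bh0; exact: piece_0. Qed.
Lemma lpartB w (x y : lb_M X) : lpart w x -> lpart w y -> lpart w (x - y).
Proof. by rewrite /lpart bhD bhN; exact: pieceB. Qed.
Lemma lpart_l w a (x : lb_M X) : lpart w x -> lpart w (a *< x).
Proof. by rewrite /lpart bhl; exact: piece_l. Qed.
Lemma lpart_r w a (x : lb_M X) : lpart w x -> lpart w (x >* a).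
Proof. by rewrite /lpart bhr; exact: piece_r. Qed.
Lemma lpart_span w (P : lb_M X -> Prop) m :
  (forall t, P t -> lpart w t) -> addspan P m -> lpart w m.
Proof.
by move=> h hm; apply: (addspan_map (f := id) _ _ _ h hm) => //; [exact: lpart0|exact: lpartB].
Qed.
Lemma lpart_unit w d (x : lb_M X) : lunit d -> lpart w (x >* d) -> lpart w x.
Proof.
move=> [e de]; rewrite /lpart bhr => /(piece_r e).
by rewrite [X in lb_piece _ X -> _]rmulA de rmul1.
Qed.
End Pieces.

Section Good.
Variables (X : lbm) (gX : goodC X).

Lemma good_flat : flat_right (lb_M X). Proof. by case: gX => -[_ _ h] _ _ _ _; exact: h. Qed.
Lemma good_dpiece : direct_sum (@lb_piece _ _ _ _ X). Proof. by case: gX => _ [_ h _] _ _ _. Qed.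
Lemma good_twist w e (f : R) :
  @lb_piece _ _ _ _ X w e -> e >* iota f = iota (act w f) *< e.
Proof. by case: gX => _ _ h _ _; exact: h. Qed.

Lemma loc_eq0 m : lb_loc X m = 0 -> m = 0.
Proof.
move=> e; apply: (tensRQ_inj good_flat); have [_ _ _ _ [bij _]] := gX.
by apply: (bij_inj bij); rewrite bh0 ximE e [LHS]rmul0l.
Qed.
Lemma loc_inj : injective (lb_loc X).
Proof. by apply: bij_additive_inj; [exact: bhD|exact: loc_eq0]. Qed.

Lemma loc_frac (x : lb_E X) : exists m d, lunit d /\ x >* iota d = lb_loc X m.
Proof.
have [_ _ _ _ [[k _ kK] _]] := gX.
have [m [d [e [de kE]]]] := tensRQ_pure (k x).
exists m, d; split; first by exists e.
by rewrite -[x]kK kE ximE rmulA mulrC de rmul1.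
Qed.

Lemma lgens_lpart : lgens (@lpart X).
Proof.
move=> w e he; have [m [d [hd ed]]] := loc_frac e; exists d, m; split=> //.
by apply: SpanG; rewrite /lpart -ed; exact: piece_r.
Qed.

Lemma loc_gr i m : @lb_gr _ _ _ _ X i m -> @lb_grE _ _ _ _ X i (lb_loc X m).
Proof.
have [_ _ _ _ [_ h]] := gX => hm.
rewrite -[lb_loc X m](@rmul1 _ _ (lb_E X)) -(ximE m 1); apply: h; apply: SpanG.
by exists i, 0, m, 1; rewrite addr0; split=> //; exact: (st_grQ1 st).
Qed.

Lemma lpart_decomp m : exists d, lunit d /\
  addspan (fun t => exists w, @lpart X w t) (m >* d).
Proof.
suff H (e : lb_E X) : exists d t, [/\ lunit d, e >* iota d = lb_loc X t
    & addspan (fun t => exists w, @lpart X w t) t].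
  have [d [t [hd e h]]] := H (lb_loc X m); exists d; split=> //.
  by rewrite (_ : m >* d = t) //; apply: loc_inj; rewrite bhr.
elim: (direct_sum_span good_dpiece e) => [|v [w hw]|x y _ [d [t [hd xE ht]]] _ [d' [t' [hd' yE ht']]]].
- by exists 1, 0; rewrite bh0 rmul0l; split; [exact: lunit1| |exact: Span0].
- have [d [t [hd ht vE]]] := lgens_lpart hw; exists d, t; split=> //.
  by apply: addspan_mono ht => u hu; exists w.
have stab c u : addspan (fun t => exists w, @lpart X w t) u ->
    addspan (fun t => exists w, @lpart X w t) (u >* c).
  apply: (addspan_map (f := fun u => u >* c) (fun x y => rmulDl x y c)).
  + exact: Span0.
  + exact: SpanB.
  by move=> v [w hv]; apply: SpanG; exists w; exact: lpart_r.
exists (d * d'), (t >* d' - t' >* d); split; first exact: lunitM.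
  rewrite bhD bhN !bhr -xE -yE rmorphM; exact: rmul_cross.
by apply: SpanB; exact: stab.
Qed.

End Good.

Section Homs.
Variables (X Y : lbm) (gX : goodC X) (f : bhom (lb_M X) (lb_M Y)).
Variable G : W -> lb_M X -> Prop.
Hypotheses (hG : lgens G) (fG : forall w m, G w m -> lpart w (f m)).

(** The map on localizations can only be xi_Y (f (x) Q) xi_X^-1. It is R-linear on the left by
    construction, and Q-linear because denominators can be cleared. It respects the pieces since, up
    to denominators, these are spanned by the elements of [G]. *)
Lemma lhom_cond_lgens : lhom_cond f.
Proof.
have [_ _ _ _ [[k xK kK] _]] := gX.
have kD x y : k (x + y) = k x + k y by apply: (can_inj xK); rewrite bhD !kK.
pose h t := xim Y (tens_map f (bhid RQ) t).
pose g (e : lb_E X) : lb_E Y := h (k e).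
have gE m q : g ((lb_loc X m : lb_E X) >* q) = (lb_loc Y (f m) : lb_E Y) >* q.
  by rewrite /g -(ximE m q) xK /h tens_mapE ximE.
have gD x y : g (x + y) = g x + g y by rewrite /g kD /h !bhD.
have gr x b : g (x >* b) = g x >* b.
  rewrite /g; have -> : k (x >* b) = k x >* b by apply: (can_inj xK); rewrite bhr !kK.
  by rewrite /h !bhr.
have glR (a : R) x : g (iota a *< x) = iota a *< g x.
  rewrite /g; have -> : k (iota a *< x) = a *< k x by apply: (can_inj xK); rewrite bhl !kK.
  by rewrite /h !bhl.
have gl a x : g (a *< x) = a *< g x.
  have [r [d [[e de] ad]]] := st_frac st a.
  by apply: (lmul_inj de); rewrite -glR !lmulA mulrC ad glR.
exists (@BHom _ _ (lb_E X) (lb_E Y) g gD gl gr); split=> [m|w x hx] /=.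
  by rewrite -[lb_loc X m](@rmul1 _ _ (lb_E X)) gE rmul1.
have [d [t [[e de] ht xd]]] := hG hx.
have -> : x = (lb_loc X t : lb_E X) >* e by rewrite -xd rmulA de rmul1.
rewrite gE; apply: piece_r; rewrite -/(lpart w (f t)).
apply: (addspan_map (bhD f) _ _ _ ht); [exact: lpart0|exact: lpartB|exact: fG].
Qed.

End Homs.

Lemma lhom_lpart (X Y : lbm) (f : lhom X Y) w m : lpart w m -> lpart w (sval f m).
Proof. by case: f => f [g [g1 g2]] /= h; rewrite /lpart -g1; exact: g2. Qed.

(** The map g induced on localizations is injective and preserves pieces, so it commutes with the
    projections to them. An element whose image lies in the w-piece thus equals its own
    w-component. *)
Lemma lhom_cond_inv (X Y : lbm) (f : lhom X Y) (f' : bhom (lb_M Y) (lb_M X)) :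
  goodC X -> goodC Y -> cancel (sval f) f' -> cancel f' (sval f) -> lhom_cond f'.
Proof.
move=> gX gY fK f'K; apply: (lhom_cond_lgens gY (lgens_lpart gY)) => w m hm.
case: f fK f'K => f [g [g1 g2]] /= fK f'K.
have ginj : injective g.
  apply: bij_additive_inj; first exact: bhD.
  move=> x gx; have [n [d [[e de] xd]]] := loc_frac gX x.
  apply: (rmul_inj de); rewrite rmul0l xd.
  suff -> : n = 0 by rewrite bh0.
  apply: (can_inj fK); apply: (loc_inj gY); rewrite -g1 -xd bhr gx rmul0l.
  by rewrite (bh0 f) bh0.
have dX := good_dpiece gX; have dY := good_dpiece gY.
suff E : lb_loc X (f' m) = dcomp dX (lb_loc X (f' m)) w.
  by rewrite /lpart E; exact: dcompP.
apply: ginj; rewrite -(dcomp_map dX dY (bhD g) g2) g1 f'K.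
by rewrite (dcomp_hom dY _ hm) eqxx.
Qed.

Lemma lgens_isomorphic (X Y : lbm) (f : bhom (lb_M X) (lb_M Y))
    (f' : bhom (lb_M Y) (lb_M X)) (G : W -> lb_M X -> Prop) :
  goodC X -> goodC Y -> cancel f f' -> cancel f' f -> lgens G ->
  (forall w m, G w m -> lpart w (f m)) -> @isomorphic (lcat iota W) X Y.
Proof.
move=> gX gY fK f'K hG fG.
pose F : lhom X Y := exist _ f (lhom_cond_lgens gX hG fG).
pose F' : lhom Y X := exist _ f' (@lhom_cond_inv X Y F f' gX gY fK f'K).
exists F, F'; split; apply: lhomP => m; [exact: fK|exact: f'K].
Qed.

End Setting.

Lemma direct_sum_conc (W : groupType) (V : zmodType) (w0 : W) :
  direct_sum (fun w => @conc W V w0 w).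
Proof.
apply: (@direct_sum_proj _ _ _ (fun w v => if w == w0 then v else 0)).
- by move=> w; right.
- by move=> w x y [->|->] [e|->]; [left|left|left|right]; rewrite ?subrr.
- by move=> v; apply: SpanG; exists w0; left.
- by move=> w x y; case: eqP; rewrite ?addr0.
- move=> w w' v [->//|->]; by case: eqP; case: eqP.
Qed.

Lemma graded_ring_bimod (A B T : comNzRingType) (f : {rmorphism A -> T})
    (g : {rmorphism B -> T}) (gA : int -> A -> Prop) (gB : int -> B -> Prop)
    (gT : int -> T -> Prop) : direct_sum gT ->
  (forall i j x y, gT i x -> gT j y -> gT (i + j) (x * y)) ->
  (forall i x, gA i x -> gT i (f x)) -> (forall i x, gB i x -> gT i (g x)) ->
  @graded_bimod A B gA gB (ring_bimod f g) gT.
Proof.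
by move=> dT gM hf hg; split=> // i j x y hx hy; apply: gM => //; [exact: hf|exact: hg].
Qed.

(** * Tensor products of localized bimodules *)

Section GoodTensor.
Variables (R Q : comNzRingType) (iota : {rmorphism R -> Q}) (W : groupType).
Variables (act : W -> {rmorphism R -> R}).
Variables (grR : int -> R -> Prop) (grQ : int -> Q -> Prop).
Hypothesis st : setting iota act grR grQ.

Local Notation idR := (idfun : {rmorphism R -> R}).
Local Notation idQ := (idfun : {rmorphism Q -> Q}).
Local Notation RQ := (ring_bimod iota idQ).
Local Notation lbm := (lbimod iota W).
Local Notation good := (goodC act grR grQ).
Local Notation lone := (lone iota W grR grQ).

Lemma right_basis_regular : right_basis (regular_bimod R).
Proof.
exists 1%N, (fun=> 1), (fun _ m => m); split=> // m.
by rewrite big_ord1 /= mul1r.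
Qed.

Lemma left_fg_regular (f : {rmorphism R -> R}) : left_fg (ring_bimod idR f).
Proof.
by exists 1%N, (fun=> 1) => m; exists (fun=> m); rewrite big_ord1 /= mulr1.
Qed.

Lemma goodC_lone : good lone.
Proof.
split.
- split; first by apply: graded_ring_bimod; [exact: st_grR st|exact: st_grRM st| |].
    exact: left_fg_bimod (left_fg_regular _).
  exact: flat_right_basis right_basis_regular.
- split; first by apply: graded_ring_bimod; [exact: st_grQ st|exact: st_grQM st| |].
    exact: direct_sum_conc.
  move=> w; apply: (graded_sub_dcomp (dg := st_grQ st)) => v i [->|->]; first by left.
  by right; rewrite (additive_0 (fun x y => dcompD _ x y i)).
- move=> w e f [->|->]; last by rewrite rmul0l lmul0r.
  by rewrite (st_act1 st) /= mulrC.
- by exists [:: 1%g] => w e [-> _|//]; rewrite mem_head.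
- split; last first.
    move=> i t; apply: (addspan_map (bhD _)).
    + exact: (direct_sum0 (st_grQ st)).
    + by move=> x y; exact: (direct_sumB (st_grQ st)).
    move=> _ [j [l [m [q [<- hm hq ->]]]]]; rewrite ximE.
    by apply: (st_grQM st) => //; exact: (st_gr_iota st).
  exists (fun q : Q => tpure (1 : regular_bimod R) (q : RQ)).
    apply: text => [x y|x y|m q] //; first by rewrite bhD tpureDr.
    rewrite ximE /=; have -> : iota m * q = m *< (q : RQ) :> RQ by [].
    by rewrite -tpureA /= mul1r.
  by move=> q; rewrite ximE /= rmorph1 mul1r.
Qed.

Lemma lgens_lone : lgens (X := lone) (fun w _ => w = 1%g).
Proof.
move=> w e [->|->]; last first.
  by exists 1, 0; rewrite bh0 rmul0l; split; [exact: lunit1| |]; [exact: Span0|].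
have [f [d [hd ed]]] := st_frac st e.
by exists d, f; split=> //; apply: SpanG.
Qed.

Section Tensor.
Variables X Y : lbm.

(** A pure tensor of elements of two pieces is treated by clearing the denominators of both factors.
    The closure of [GY] under right multiplication serves to put differences over a common
    denominator. *)
Lemma lgens_lten (GX : W -> lb_M X -> Prop) (GY : W -> lb_M Y -> Prop) :
  good Y -> lgens GX -> lgens GY -> (forall w m a, GY w m -> GY w (m >* a)) ->
  lgens (X := lten X Y) (fun w t => exists x y m n,
    [/\ (x * y)%g = w, GX x m, GY y n & t = tpure m n]).
Proof.
move=> gY hX hY GYr w e; pose GT w t := exists x y m n,
    [/\ (x * y)%g = w, GX x m, GY y n & t = tpure m n].
have stab c t : addspan (GT w) t -> addspan (GT w) (t >* c).
  apply: (addspan_map (f := fun t => t >* c) (fun x y => rmulDl x y c)).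
  - exact: Span0.
  - exact: SpanB.
  move=> _ [x [y [m [n [e1 hm hn ->]]]]]; apply: SpanG.
  by exists x, y, m, (n >* c); rewrite tpure_r; split=> //; exact: GYr.
elim=> [|_ [x [y [a [b [xy ha hb ->]]]]]|u v _ [d [t [hd ht ut]]] _ [d' [t' [hd' ht' vt']]]].
- by exists 1, 0; rewrite bh0 rmul0l; split; [exact: lunit1|exact: Span0|].
- have [d [t [hd ht at_]]] := hX _ _ ha; have [d' [t' [hd' ht' bt']]] := hY _ _ hb.
  (* The denominator d of the first factor sits in the middle and crosses the y-piece of the second
     factor twisted by y; hence the y^-1. *)
  exists (act y^-1%g d * d'), (tpure t t'); split.
  + by apply: lunitM => //; exact: (st_act_unit st).
  + apply: addspan_mono (addspan_tpure ht ht') => _ [m [n [hm hn ->]]].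
    by exists x, y, m, n.
  + rewrite tpure_r rmorphM /= -rmulA (good_twist gY _ hb).
    have -> : act y (act y^-1%g d) = d.
      by have := st_actM st y y^-1%g d; rewrite mulgV (st_act1 st) /= => <-.
    by rewrite lrmulA bt' -tpureA at_; exact: (esym (loc_tensE _ _)).
- exists (d * d'), (t >* d' - t' >* d); split; first exact: lunitM.
    by apply: SpanB; exact: stab.
  have E c z : lb_loc (lten X Y) (z >* c)
    = (lb_loc (lten X Y) z : tens (lb_E X) (lb_E Y)) >* iota c by exact: bhr.
  rewrite bhD bhN !E -ut -vt' rmorphM; exact: rmul_cross.
Qed.

(** After reassociation ([al]), the map factors as M (x) N (x) Q -> M (x) E_Y -> E_X (x)_Q E_Y. The
    first arrow [be] is M (x) xi_Y. The second, [ga], is invertible because E_X is M (x) Q and E_Y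
    has a left Q-action absorbing the factor Q. *)
Lemma xim_lten_bij : bijective (xim X) -> bijective (xim Y) ->
  bijective (xim (lten X Y)).
Proof.
move=> [k kX Xk] bY.
pose M := lb_M X; pose EY := restr iota idQ (lb_E Y).
have kD x y : k (x + y) = k x + k y by apply: (can_inj kX); rewrite bhD !Xk.
have kr x b : k (x >* b) = k x >* b by apply: (can_inj kX); rewrite bhr !Xk.
pose mu_f (e : lb_E Y) (m : M) (q : RQ) : tens M EY := tpure m ((q : Q) *< e : EY).
have mu_bal e : balanced (mu_f e).
  by split=> *; rewrite /mu_f ?tpureDl ?lmulDl ?tpureDr // tpureA /= lmulA.
pose mu (t : tens M RQ) (e : lb_E Y) : tens M EY := tens_rec (mu_f e) t.
have muE m q e : mu (tpure m q) e = tpure m ((q : Q) *< e : EY).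
  exact: tens_rec_pure (mu_bal e).
have muD x y e : mu (x + y) e = mu x e + mu y e by exact: (tens_recD (mu_bal e)).
have muDr x e e' : mu x (e + e') = mu x e + mu x e'.
  move: x; apply: tind => [m q|x y hx hy]; last by rewrite !muD hx hy addrACA.
  by rewrite !muE lmulDr tpureDr.
have muA x (q : Q) e : mu (x >* q) e = mu x (q *< e).
  move: x; apply: tind => [m r|x y hx hy]; last by rewrite rmulDl !muD hx hy.
  by rewrite tpure_r !muE lmulA.
pose ga_f (m : M) (e : EY) : tens (lb_E X) (lb_E Y) := tpure (lb_loc X m : lb_E X) (e : lb_E Y).
have ga_bal : balanced ga_f.
  by split=> *; rewrite /ga_f ?bhD ?tpureDl ?tpureDr // bhr [LHS]tpureA.
pose ga := tens_rec ga_f.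
have gaD x y : ga (x + y) = ga x + ga y by exact: (tens_recD ga_bal).
have gaE m e : ga (tpure m e) = ga_f m e by exact: (tens_rec_pure _ _ ga_bal).
pose ka_f (e : lb_E X) (e' : lb_E Y) : tens M EY := mu (k e) e'.
have ka_bal : balanced ka_f.
  by split=> *; rewrite /ka_f ?kD ?muD ?muDr // kr muA.
pose ka : tens (lb_E X) (lb_E Y) -> tens M EY := tens_rec ka_f.
have kaD x y : ka (x + y) = ka x + ka y by exact: (tens_recD ka_bal).
have kaE e e' : ka (tpure e e') = mu (k e) e' by exact: (tens_rec_pure _ _ ka_bal).
have ga_bij : bijective ga.
  exists ka.
    apply: text => [x y|x y|m e] //; first by rewrite gaD kaD.
    rewrite gaE kaE -[lb_loc X m](@rmul1 _ _ (lb_E X)) -(ximE m 1) kX muE.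
    by rewrite lmul1.
  apply: text => [x y|x y|e e'] //; first by rewrite kaD gaD.
  rewrite kaE -{2}[e]Xk; move: (k e); apply: tind => [m q|x y hx hy].
    by rewrite muE gaE /ga_f ximE tpureA.
  by rewrite muD gaD hx hy bhD tpureDl.
pose al := tassoc (lb_M X) (lb_M Y) RQ.
have al_bij : bijective al.
  exists (tassoci (lb_M X) (lb_M Y) RQ).
    apply: tens_ext3l => [x y|x y|m n p]; rewrite ?bhD //.
    by rewrite [al _]tassocE tassociE.
  apply: tens_ext3r => [x y|x y|m n p]; rewrite ?bhD //.
  by rewrite tassociE [al _]tassocE.
pose be := tens_map (bhid M) (xim Y).
have be_bij : bijective be.
  case: bY => l lY Yl.
  have lD x y : l (x + y) = l x + l y by apply: (can_inj lY); rewrite bhD !Yl.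
  have ll (a : R) (x : EY) : l (a *< x) = a *< l x.
    by apply: (can_inj lY); rewrite bhl !Yl.
  have lr x b : l (x >* b) = l x >* b by apply: (can_inj lY); rewrite bhr !Yl.
  pose lb := @BHom _ _ EY _ l lD ll lr.
  exists (tens_map (bhid M) lb).
    apply: text => [x y|x y|m t]; rewrite ?bhD //.
    by rewrite /be !tens_mapE /= lY.
  apply: text => [x y|x y|m t]; rewrite ?bhD //.
  by rewrite /be !tens_mapE; congr tpure; exact: Yl.
have E t : ga (be (al t)) = xim (lten X Y) t.
  move: t; apply: tens_ext3l => [x y|x y|m n q]; rewrite ?bhD ?gaD //.
  rewrite [al _]tassocE /be tens_mapE gaE /ga_f !ximE.
  by rewrite [lb_loc (lten X Y) _]loc_tensE; exact: (esym (tpure_r _ _ _)).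
have [h hK Kh] := bij_comp ga_bij (bij_comp be_bij al_bij).
by exists h => t; rewrite -E; [exact: hK|exact: Kh].
Qed.

Lemma goodC_lten : good X -> good Y -> left_fg (lb_M X) -> left_fg (lb_M Y) ->
  good (lten X Y).
Proof.
move=> gX gY fX fY.
have [[grX _ flX] [grEX dX subX] twX [sX sXP] [bX _]] := gX.
have [[grY _ flY] [grEY dY subY] twY [sY sYP] [bY _]] := gY.
(* The pieces are treated as a grading by W, with Q concentrated at 1. *)
have dT : direct_sum (@lb_piece _ _ _ _ (lten X Y)).
  apply: (tens_direct_sum (@mulgA W) dX (direct_sum_conc Q 1%g) dY).
  + move=> i j m b hm [->|->]; first by rewrite mulg1; exact: piece_r.
    by rewrite rmul0r; exact: (direct_sum0 dX).
  + move=> i j b n [->|->] hn; first by rewrite mul1g; exact: piece_l.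
    by rewrite lmul0l; exact: (direct_sum0 dY).
have grE : graded_bimod grQ grQ (@lb_grE _ _ _ _ (lten X Y)).
  by apply: graded_bimod_tens grEX grEY; exact: (st_grQ st).
split.
- split; first by apply: graded_bimod_tens grX grY; exact: (st_grR st).
    exact: left_fg_bimod (left_fg_tens fX fY).
  exact: flat_right_tens.
- split=> // w; have [dE _ _] := grE; apply: (graded_sub_addspan dE).
  move=> _ [x [y [a [b [<- ha hb ->]]]]].
  have [dEX _ _] := grEX; have [dEY _ _] := grEY.
  have HX : addspan (fun t => lb_piece x t /\ exists i, @lb_grE _ _ _ _ X i t) a.
    rewrite [a](dcomp_sum dEX); elim/big_ind: _ => [|u v|i _]; [exact: Span0|exact: addspanD|].
    apply: SpanG; split; last by exists i; exact: dcompP.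
    apply: (dcomp_graded_sub _ _ _ _ (subX x) ha); [exact: piece_0|exact: pieceB].
  have HY : addspan (fun t => lb_piece y t /\ exists i, @lb_grE _ _ _ _ Y i t) b.
    rewrite [b](dcomp_sum dEY); elim/big_ind: _ => [|u v|i _]; [exact: Span0|exact: addspanD|].
    apply: SpanG; split; last by exists i; exact: dcompP.
    apply: (dcomp_graded_sub _ _ _ _ (subY y) hb); [exact: piece_0|exact: pieceB].
  apply: addspan_mono (addspan_tpure HX HY) => _ [m [n [[hm [i mi]] [hn [j nj]] ->]]].
  split; first by exists x, y, m, n.
  by exists (i + j); apply: SpanG; exists i, j, m, n.
- move=> w e f; elim=> [|_ [x [y [a [b [<- ha hb ->]]]]]|u v _ hu _ hv].
  + by rewrite rmul0l lmul0r.
  + rewrite tpure_r (twY _ _ _ hb) -tpureA (twX _ _ _ ha) -tpure_l.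
    by rewrite (st_actM st).
  + by rewrite rmulDl rmulNl hu hv lmulDr lmulNr.
- exists [seq (x * y)%g | x <- sX, y <- sY] => w e he ne.
  have [_ [x [y [a [b [<- ha hb ->]]]]] ne'] := addspan_neq0 he ne.
  apply: allpairs_f.
    by apply: sXP ha _ => a0; apply: ne'; rewrite a0 tpure0l.
  by apply: sYP hb _ => b0; apply: ne'; rewrite b0 tpure0r.
- split; first exact: xim_lten_bij.
  have [dE _ Er] := grE.
  move=> i t; apply: (addspan_map (bhD _)).
  + exact: (direct_sum0 dE).
  + by move=> x y; exact: (direct_sumB dE).
  move=> _ [j [l [m [q [<- hm hq ->]]]]]; rewrite ximE; apply: Er => //.
  move: m hm; apply: (addspan_map (bhD _)).
  + exact: (direct_sum0 dE).
  + by move=> x y; exact: (direct_sumB dE).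
  move=> _ [a [b [x [y [<- hx hy ->]]]]]; rewrite [X in lb_grE _ X]loc_tensE; apply: SpanG.
  by exists a, b, (lb_loc X x), (lb_loc Y y); split=> //; exact: (loc_gr st).
Qed.

End Tensor.
End GoodTensor.

(** * Objects given by generators of their pieces *)

Section Presented.
Variables (R Q : comNzRingType) (iota : {rmorphism R -> Q}) (W : groupType).
Variables (act : W -> {rmorphism R -> R}).
Variables (grR : int -> R -> Prop) (grQ : int -> Q -> Prop).
Hypothesis st : setting iota act grR grQ.

Local Notation idQ := (idfun : {rmorphism Q -> Q}).
Local Notation RQ := (ring_bimod iota idQ).
Local Notation QR := (ring_bimod idQ iota).
Local Notation addZ := (fun i j : int => i + j).

Variables (M : bimod R R) (gM : int -> M -> Prop) (G : W -> M -> Prop).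

Definition lspan (w : W) : M -> Prop :=
  addspan (fun t => exists a m, G w m /\ t = a *< m).

(* G w generates, up to denominators, the part of M at w. *)
Record presented : Prop := Presented {
  pr_graded : graded_bimod grR grR gM;
  pr_fg : fg_bimod M;
  pr_flat : flat_right M;
  pr_twist : forall w m f, G w m -> m >* f = act w f *< m;
  pr_supp : exists s : seq W, forall w m, G w m -> m <> 0 -> w \in s;
  pr_dense : forall m, exists d, lunit iota d /\
    addspan (fun t => exists w, lspan w t) (m >* d);
  pr_indep : forall (s : seq W) (n : W -> M), uniq s -> (forall w, lspan w (n w)) ->
    \sum_(w <- s) n w = 0 -> forall w, w \in s -> n w = 0;
  pr_homog : forall w m, G w m -> addspan (fun t => G w t /\ exists i, gM i t) m
}.

Hypothesis pr : presented.

Local Notation T := (tens M RQ).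
Local Notation E := (tens QR T).

(** With [two_piece], this mirrors [twoE_in] and [gen_piece] in an arbitrary setting. *)
Definition two_in (m : M) : E := tpure (1 : QR) (tpure m (1 : RQ)).
Definition two_piece (w : W) : E -> Prop :=
  addspan (fun t => exists (q q' : Q) (m : M), G w m /\ t = q *< two_in m >* q').

Lemma lspan_twist w m f : lspan w m -> m >* f = act w f *< m.
Proof.
elim=> [|_ [a [n [hn ->]]]|x y _ hx _ hy]; first by rewrite rmul0l lmul0r.
  by rewrite lrmulA (pr_twist pr _ hn) lmulC.
by rewrite rmulDl rmulNl hx hy lmulDr lmulNr.
Qed.

Lemma lspan_l w a m : lspan w m -> lspan w (a *< m).
Proof.
apply: (addspan_map (f := lmul a) (lmulDr a)); [exact: Span0|exact: SpanB|].
by move=> _ [b [n [hn ->]]]; apply: SpanG; exists (a * b), n; rewrite lmulA.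
Qed.

Lemma lspan_r w a m : lspan w m -> lspan w (m >* a).
Proof. by move=> h; rewrite (lspan_twist a h); exact: lspan_l. Qed.

Definition tpart (w : W) : T -> Prop :=
  addspan (fun t => exists m (q : RQ), lspan w m /\ t = tpure m q).

Lemma tpart_r w (q : Q) t : tpart w t -> tpart w (t >* q).
Proof.
apply: (addspan_map (f := fun t => t >* q) (fun x y => rmulDl x y q)).
- exact: Span0.
- exact: SpanB.
by move=> _ [m [r [hm ->]]]; apply: SpanG; exists m, (r * q); rewrite tpure_r.
Qed.

Lemma tpart_l w (a : R) t : tpart w t -> tpart w (a *< t).
Proof.
apply: (addspan_map (f := lmul a) (lmulDr a)); [exact: Span0|exact: SpanB|].
move=> _ [m [r [hm ->]]]; apply: SpanG; exists (a *< m), r; rewrite tpure_l.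
by split=> //; exact: lspan_l.
Qed.

Lemma tpart_twist w (d : R) t : tpart w t -> act w d *< t = t >* (iota d : Q).
Proof.
elim=> [|_ [m [q [hm ->]]]|x y _ hx _ hy]; first by rewrite lmul0r rmul0l.
  rewrite tpure_l tpure_r -(lspan_twist _ hm) tpureA; congr tpure.
  by rewrite /= mulrC.
by rewrite lmulDr lmulNr hx hy rmulDl rmulNl.
Qed.

Lemma tpart_pure w t : tpart w t -> exists (m : M) (d : R) (e : Q),
  [/\ lspan w m, iota d * e = 1 & t = tpure m (e : RQ)].
Proof.
elim=> [|_ [m [q [hm ->]]]|x y _ [m [d [e [hm de ->]]]] _ [m' [d' [e' [hm' de' ->]]]]].
- by exists 0, 1, 1; rewrite rmorph1 mul1r tpure0l; split=> //; exact: Span0.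
- have [f [d [[e de] qd]]] := st_frac st q.
  exists (m >* f), d, e; split=> //; first exact: lspan_r.
  by rewrite tpureA /= -qd; congr tpure; rewrite -mulrA de mulr1.
exists (m >* d' - m' >* d), (d * d'), (e * e'); split.
- by apply: SpanB; exact: lspan_r.
- by rewrite rmorphM /= mulrACA de de' mulr1.
rewrite tpureBl !tpureA /=; congr (tpure _ _ - tpure _ _).
  by rewrite mulrCA de' mulr1.
by rewrite mulrA de mul1r.
Qed.

Lemma tpart_common (s : seq W) (t : W -> T) : (forall w, tpart w (t w)) ->
  exists (n : W -> M) (d : R) (e : Q), [/\ iota d * e = 1, forall w, lspan w (n w)
    & forall w, w \in s -> t w = tpure (n w) (e : RQ)].
Proof.
move=> ht; elim: s => [|w s [n [d [e [de hn tE]]]]].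
  by exists (fun=> 0), 1, 1; rewrite rmorph1 mul1r; split=> // w; exact: Span0.
have [m [d' [e' [hm de' wE]]]] := tpart_pure (ht w).
exists (fun v => if v == w then m >* d else n v >* d'), (d * d'), (e * e').
split; first by rewrite rmorphM /= mulrACA de de' mulr1.
- by move=> v; case: eqP => [->|_]; exact: lspan_r.
- move=> v; rewrite inE; case: eqP => [-> _|_ /= /tE ->].
    by rewrite tpureA wE; congr tpure; rewrite /= mulrA de mul1r.
  by rewrite tpureA; congr tpure; rewrite /= mulrCA de' mulr1.
Qed.

(** The parts span by density. For independence, finitely many components are brought over one
    denominator; the relation then holds in M, which embeds by flatness, and [pr_indep] applies. *)
Lemma tpart_direct_sum : direct_sum tpart.
Proof.
apply: direct_sum_indep.
- by move=> w; exact: Span0.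
- by move=> w; exact: SpanB.
- apply: tind => [m q|x y]; last exact: addspanD.
  have [d [[e de] hd]] := pr_dense pr m.
  have -> : q = d *< ((e * q : Q) : RQ) by rewrite /= mulrA de mul1r.
  rewrite -tpureA; move: hd.
  apply: (addspan_map (f := fun m => tpure m ((e * q : Q) : RQ))
    (fun x y => tpureDl x y _)); [exact: Span0|exact: SpanB|].
  move=> n [w hn]; apply: SpanG; exists w; apply: SpanG.
  by exists n, ((e * q : Q) : RQ).
- move=> s t us ht sum0; have [n [d [e [de hn tE]]]] := tpart_common s ht.
  have n0 : \sum_(w <- s) n w = 0.
    apply: (tensRQ_inj st (pr_flat pr)); apply: (rmul_inj (b := e) (c := iota d)).
      by rewrite mulrC.
    rewrite rmul0l tpure_r -sum0 tpure_suml; rewrite [RHS]big_seq [LHS]big_seq.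
    by apply: eq_bigr => w /tE ->; congr tpure; rewrite /= mul1r.
  by move=> w ws; rewrite tE // (pr_indep pr us hn n0 ws) tpure0l.
Qed.

Let dT := tpart_direct_sum.

Lemma lunit_act_ex w d : lunit iota d ->
  exists c, [/\ lunit iota c & act w c = d].
Proof.
move=> hd; exists (act w^-1%g d); split; first exact: (st_act_unit st).
by have := st_actM st w w^-1%g d; rewrite mulgV (st_act1 st).
Qed.

Lemma unit_lmul_surj w d t : lunit iota d -> tpart w t ->
  exists2 t', tpart w t' & t = d *< t'.
Proof.
move=> hd ht; have [c [[e ce] <-]] := lunit_act_ex w hd; exists (t >* e); first exact: tpart_r.
by rewrite (tpart_twist c (tpart_r e ht)) rmulA mulrC ce rmul1.
Qed.

(** On the part at w, left multiplication by [act w c] is right multiplication by c, and every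
    denominator has this form with c again a denominator. So left multiplication by it is injective
    on each part, and it preserves the decomposition. *)
Lemma unit_lmul_inj d : lunit iota d -> injective (fun t : T => d *< t).
Proof.
move=> hd; apply: bij_additive_inj; first exact: lmulDr.
move=> t dt; rewrite [t](dcomp_sum dT) big1_seq // => w _.
have [c [[e ce] cd]] := lunit_act_ex w hd.
apply: (rmul_inj ce); rewrite rmul0l -(tpart_twist c (dcompP dT t w)).
rewrite cd -(dcomp_map dT dT (f := fun t => d *< t) (lmulDr d)); last first.
  by move=> v x; exact: tpart_l.
by rewrite dt (dcomp_hom dT (i := w) w) ?eqxx //; exact: Span0.
Qed.

Definition two_j (t : T) : E := tpure (1 : QR) t.

Lemma two_jD x y : two_j (x + y) = two_j x + two_j y.
Proof. exact: tpureDr. Qed.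

Lemma two_pure_j w (q : Q) t : tpart w t ->
  exists2 t', tpart w t' & tpure (q : QR) t = two_j t'.
Proof.
have [f [d [hd qd]]] := st_frac st q => ht.
have [t' ht' ->] := unit_lmul_surj hd ht; exists (f *< t'); first exact: tpart_l.
by rewrite -tpureA /two_j -[f *< t'](lmul1 (f *< t')) lmul1 /= qd -[RHS]tpureA /= mul1r.
Qed.

Lemma tens_decomp t : addspan (fun t => exists w, tpart w t) t.
Proof. exact: direct_sum_span dT t. Qed.

Lemma two_j_surj x : exists t, two_j t = x.
Proof.
move: x; apply: tind => [q t|x y [t <-] [t' <-]]; last by exists (t + t'); rewrite two_jD.
elim: (tens_decomp t) => [|u [w hu]|u v _ [x xE] _ [y yE]].
- by exists 0; rewrite tpure0r; exact: tpure0r.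
- by have [t' _ ->] := two_pure_j q hu; exists t'.
- by exists (x - y); rewrite tpureBr -xE -yE; exact: tpureBr.
Qed.

(** Left division by denominators being possible on M (x) Q, the field-like rule defines an action
    of Q: for q = f / d, the value t' solves d t' = f t. The equation is required for all fractions
    representing q at once, which frees the action from the choice of one. *)
Lemma qact_ex (q : Q) (t : T) : exists t' : T, forall f d, lunit iota d ->
  q * iota d = iota f -> d *< t' = f *< t.
Proof.
have surj d (u : T) : lunit iota d -> exists u' : T, d *< u' = u.
  move=> hd; elim: (tens_decomp u) => [|v [w hv]|? ? _ [x <-] _ [y <-]].
  - by exists 0; rewrite lmul0r.
  - by have [v' _ ->] := unit_lmul_surj hd hv; exists v'.
  - by exists (x - y); rewrite lmulDr lmulNr.
have [f [d [hd qd]]] := st_frac st q; have [t' dt'] := surj d (f *< t) hd.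
exists t' => f' d' hd' qd'; apply: (unit_lmul_inj hd).
rewrite lmulC dt' !lmulA; congr (_ *< _); apply: (st_inj st).
by rewrite !rmorphM /= -qd -qd' mulrCA [RHS]mulrCA [iota d' * _]mulrC.
Qed.

Definition qact q t : T := sval (cid (qact_ex q t)).
Lemma qactP q t f d : lunit iota d -> q * iota d = iota f -> d *< qact q t = f *< t.
Proof. by move=> hd qd; rewrite /qact; case: cid => t' /= h; exact: h. Qed.

Lemma qact_bal : balanced (fun (q : QR) t => qact q t).
Proof.
split=> [q q' t|q t t'|q r t].
- have [f [d [hd qd]]] := st_frac st q; have [f' [d' [hd' qd']]] := st_frac st q'.
  have hdd := lunitM hd hd'; apply: (unit_lmul_inj hdd); rewrite lmulDr.
  rewrite (@qactP (q + q') t (f * d' + f' * d)) //; last first.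
    by rewrite rmorphD !rmorphM /= -qd -qd' mulrDl mulrA [iota d * _]mulrC mulrA.
  rewrite -[_ *< qact q' t]lmulA (qactP t hd' qd') [d * d']mulrC.
  by rewrite -[_ *< qact q t]lmulA (qactP t hd qd) !lmulA lmulDl ![d * _]mulrC ![d' * _]mulrC.
- have [f [d [hd qd]]] := st_frac st q; apply: (unit_lmul_inj hd); rewrite lmulDr.
  by rewrite !(qactP _ hd qd) lmulDr.
- have [f [d [hd qd]]] := st_frac st q; apply: (unit_lmul_inj hd).
  rewrite (qactP _ hd qd) (@qactP (q * iota r) _ (f * r)) ?lmulA //.
  by rewrite rmorphM /= -qd mulrAC.
Qed.

(** M (x) Q is already a left Q-module, so tensoring with Q on the left adds nothing. The action
    [qact], being balanced, yields a retraction of [two_j]. *)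
Lemma two_j_bij : bijective two_j.
Proof.
apply: inj_surj_bij two_j_surj => x y e.
have := congr1 (tens_rec (fun (q : QR) t => qact q t)) e.
rewrite !(tens_rec_pure _ _ qact_bal).
have q1 t : qact 1 t = t.
  by rewrite -[LHS]lmul1 (@qactP 1 t 1 1) ?rmorph1 ?mulr1 ?lmul1 //; exact: lunit1.
by rewrite !q1.
Qed.

Lemma two_pieceE w x : two_piece w x <-> exists2 t, tpart w t & x = two_j t.
Proof.
split=> [|[t ht ->]].
  elim=> [|_ [q [q' [m [hm ->]]]]|_ _ _ [t ht ->] _ [t' ht' ->]].
  - by exists 0; [exact: Span0|rewrite /two_j tpure0r].
  - rewrite /two_in tpure_l !tpure_r; apply: two_pure_j; apply: SpanG.
    exists m, (1 * q'); split=> //; apply: SpanG; exists 1, m; split=> //.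
    by rewrite lmul1.
  - by exists (t - t'); [exact: SpanB|rewrite /two_j tpureBr].
move: ht; apply: (addspan_map two_jD); [exact: Span0|exact: SpanB|].
move=> _ [m [q [hm ->]]]; move: hm.
apply: (addspan_map (f := fun m => two_j (tpure m q))).
- by move=> x' y; rewrite tpureDl two_jD.
- exact: Span0.
- exact: SpanB.
move=> _ [a [n [hn ->]]]; apply: SpanG; exists (iota a), q, n; split=> //.
rewrite /two_in /two_j tpure_l tpure_r tpure_r -tpure_l -[LHS]tpureA /=.
by rewrite mul1r mulr1; congr (tpure _ (tpure _ _)); rewrite /= mul1r.
Qed.

Lemma two_piece_direct_sum : direct_sum two_piece.
Proof. exact: direct_sum_bij two_jD two_j_bij two_pieceE dT. Qed.

Lemma two_piece_neq0 w x : two_piece w x -> x <> 0 -> exists2 m, G w m & m <> 0.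
Proof.
move=> hx ne; have [_ [q [q' [m [hm ->]]]] ne'] := addspan_neq0 hx ne.
exists m => // m0; apply: ne'; rewrite m0 /two_in tpure0l tpure0r lmul0r.
exact: rmul0l.
Qed.

Definition two_gr : int -> E -> Prop := 
  @tens_gr _ _ _ QR T _ addZ grQ (@tens_gr _ _ _ M RQ _ addZ gM grQ).

Variables (pP : forall w, subbimod (two_piece w)).
Variables (lc : bhom M (restr iota iota E)) (lcE : forall m, lc m = two_in m).

Definition two_lbimod : lbimod iota W := @LBimod R Q iota W M gM E two_gr two_piece pP lc.

Lemma xim_two t : xim two_lbimod t = two_j t.
Proof.
move: t; apply: text => [x y|x y|m q]; rewrite ?bhD ?two_jD //.
rewrite ximE /= lcE /two_in /two_j [LHS]tpure_r tpure_r.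
by congr (tpure _ (tpure _ _)); rewrite /= mul1r.
Qed.

Lemma goodC_two : goodC act grR grQ two_lbimod.
Proof.
have gT : graded_bimod grR grQ (@tens_gr _ _ _ M RQ _ addZ gM grQ).
  apply: graded_bimod_tens (pr_graded pr) _; first exact: (st_grR st).
  by apply: graded_ring_bimod; [exact: st_grQ st|exact: st_grQM st|exact: st_gr_iota st|].
have gE : graded_bimod grQ grQ two_gr.
  apply: graded_bimod_tens _ gT; first exact: (st_grR st).
  by apply: graded_ring_bimod; [exact: st_grQ st|exact: st_grQM st| |exact: st_gr_iota st].
have [dE El Er] := gE.
have spQ (q : Q) : addspan (fun q => exists i, grQ i q) q.
  exact: direct_sum_span (st_grQ st) q.
split.
- by split; [exact: pr_graded pr|exact: pr_fg pr|exact: pr_flat pr].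
- split=> //; first exact: two_piece_direct_sum.
  move=> w; apply: (graded_sub_addspan dE) => _ [q [q' [m [hm ->]]]].
  have H : addspan (fun t => exists m i, [/\ G w m, gM i m & t = two_in m]) (two_in m).
    apply: (addspan_map (f := two_in) _ _ _ _ (pr_homog pr hm)).
    + by move=> x y; rewrite /two_in tpureDl tpureDr.
    + exact: Span0.
    + exact: SpanB.
    by move=> n [hn [i ni]]; apply: SpanG; exists n, i.
  move: H; apply: (addspan_map (f := fun t => q *< t >* q')).
  + by move=> x y; rewrite lmulDr rmulDl.
  + exact: Span0.
  + exact: SpanB.
  move=> _ [n [i [hn ni ->]]]; move: (spQ q).
  apply: (addspan_map (f := fun q => q *< two_in n >* q')).
  + by move=> x y; rewrite lmulDl rmulDl.
  + exact: Span0.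
  + exact: SpanB.
  move=> r [j rj]; move: (spQ q').
  apply: (addspan_map (rmulDr (r *< two_in n))); [exact: Span0|exact: SpanB|].
  move=> r' [l rl]; apply: SpanG; split; first by exists r, r', n.
  exists (j + i + l); apply: Er => //; apply: El => //; apply: SpanG.
  exists 0, i, (1 : QR), (tpure n (1 : RQ)); rewrite add0r; split=> //.
    exact: st_grQ1 st.
  apply: SpanG; exists i, 0, n, (1 : RQ); rewrite addr0; split=> //; exact: st_grQ1 st.
- move=> w x f; elim=> [|_ [q [q' [m [hm ->]]]]|u v _ hu _ hv].
  + by rewrite rmul0l lmul0r.
  + have tw : two_in m >* iota f = iota (act w f) *< two_in m.
      rewrite /two_in tpure_l !tpure_r.
      have -> : (1 : RQ) >* (iota f : Q) = f *< (1 : RQ) by rewrite /= mulr1 mul1r.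
      rewrite -tpureA (pr_twist pr _ hm) -tpure_l -tpureA; congr tpure.
      by rewrite /= mulr1 mul1r.
    by rewrite rmulC [q *< _ >* iota f]lrmulA tw lmulC !lrmulA.
  + by rewrite rmulDl rmulNl hu hv lmulDr lmulNr.
- have [s hs] := pr_supp pr; exists s => w x hx ne.
  by have [m hm m0] := two_piece_neq0 hx ne; exact: hs hm m0.
- split; first by have [k jK kK] := two_j_bij; exists k => t; rewrite xim_two; [exact: jK|exact: kK].
  move=> i t ht; rewrite xim_two; apply: SpanG.
  by exists 0, i, (1 : QR), t; rewrite add0r; split=> //; exact: st_grQ1 st.
Qed.

Lemma lgens_two :
  lgens (X := two_lbimod) (fun w t => exists a m, G w m /\ t = a *< m).
Proof.
move=> w x /two_pieceE[t ht ->]; have [m [d [e [hm de ->]]]] := tpart_pure ht.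
exists d, m; split=> //; first by exists e.
rewrite [RHS]lcE [LHS]tpure_r tpure_r; congr (tpure _ (tpure _ _)).
by rewrite /= mulrC.
Qed.

End Presented.

(** * Fractions with prescribed denominators *)

Section LocFractions.
Variables (R : idomainType) (A : R -> Prop).
Hypothesis A0 : forall a, A a -> a != 0.

Inductive denominator : R -> Prop :=
| Den1 : denominator 1
| DenA a d : A a -> denominator d -> denominator (a * d).

Lemma denominatorM c d : denominator c -> denominator d -> denominator (c * d).
Proof. by move=> hc hd; elim: hc => [|a b ha _ IH]; rewrite ?mul1r // -mulrA; exact: DenA. Qed.

Lemma denominator_neq0 d : denominator d -> d != 0.
Proof. by elim=> [|a b /A0 ha _ hb]; rewrite ?oner_eq0 // mulf_neq0. Qed.

Lemma toloc_inj : injective (@toloc R A).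
Proof. by move=> f g /(congr1 val) /eqP; rewrite /= tofrac_eq => /eqP. Qed.

Lemma denominator_unit d : denominator d -> exists e, @toloc R A d * e = 1.
Proof.
elim=> [|a b ha _ [e be]]; first by exists 1; rewrite rmorph1 mul1r.
have ia : `[< in_loc A ((tofrac a)^-1) >] by apply/asboolP=> P h1 h2 h3 h4; exact: h2.
exists ((exist (fun q => `[< in_loc A q >]) _ ia : loc A) * e); rewrite rmorphM mulrACA be mulr1; apply: val_inj => /=.
by rewrite mulfV // tofrac_eq0 A0.
Qed.

Lemma loc_fraction (q : loc A) : exists f d, denominator d /\
  q * toloc A d = toloc A f.
Proof.
suff [f [d [hd qE]]] : exists f d, denominator d /\ val q * tofrac d = tofrac f.
  by exists f, d; split=> //; apply: val_inj.
case: q => q /= /asboolP/(_ (fun q => exists f d, denominator d /\ q * tofrac d = tofrac f)).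
apply.
- by move=> f; exists f, 1; rewrite tofrac1 mulr1; split=> //; exact: Den1.
- move=> a ha; exists 1, (a * 1); split; first exact: DenA ha Den1.
  by rewrite mulr1 tofrac1 mulVf // tofrac_eq0 A0.
- move=> p q' [f [d [hd pE]]] [g [e [he qE]]]; exists (f * e - g * d), (d * e).
  split; first exact: denominatorM.
  by rewrite tofracB !tofracM -pE -qE mulrBl !mulrA; congr (_ - _); rewrite mulrAC.
- move=> p q' [f [d [hd pE]]] [g [e [he qE]]]; exists (f * g), (d * e).
  split; first exact: denominatorM.
  by rewrite !tofracM -pE -qE mulrACA.
Qed.

End LocFractions.

(** * The symmetric algebra and its localization *)

Section SymFacts.
Import VectorInternalTheory.
Variables (k : idomainType) (W : groupType) (S : {pred W}) (D : realdata k S).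

Local Notation R := (Sym D).
Local Notation n := (vector.dim (hspace D)).
Local Notation hc := (@hcoord k W S D).
Local Notation hb := (@hbasis k W S D).
Local Notation dual := 'Hom(hspace D, k^o).

Lemma linD (l l' : dual) : lin (l + l') = lin l + lin l'.
Proof.
by rewrite /lin -big_split; apply: eq_bigr => i _; rewrite lfunE scalerDl.
Qed.
Lemma linZ (c : k) (l : dual) : lin (c *: l) = c *: lin l.
Proof.
by rewrite /lin scaler_sumr; apply: eq_bigr => i _; rewrite lfunE scalerA.
Qed.
Lemma lin0 : lin (0 : dual) = 0.
Proof. exact: (additive_0 linD). Qed.
Lemma linN (l : dual) : lin (- l) = - lin l.
Proof. exact: (additive_N linD). Qed.

Definition hcoord_fun i (v : hspace D) : k^o := v2r v 0 i.
Lemma hcoord_fun_linear i : linear (hcoord_fun i).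
Proof. by move=> c u v; rewrite /hcoord_fun linearP !mxE. Qed.
HB.instance Definition _ i :=
  GRing.isLinear.Build k (hspace D) k^o *:%R (hcoord_fun i) (hcoord_fun_linear i).

Lemma hcoordE i (v : hspace D) : hc i v = v2r v 0 i.
Proof. exact: (lfunE (hcoord_fun i) v). Qed.

Lemma hcoord_hbasis i j : hc i (hb j) = (i == j)%:R.
Proof. by rewrite hcoordE /hbasis r2vK mxE eqxx eq_sym. Qed.

Lemma hbasis_sum (v : hspace D) : v = \sum_i (hc i v : k) *: hb i.
Proof.
apply: v2r_inj; rewrite linear_sum /= [LHS]row_sum_delta.
by apply: eq_bigr => i _; rewrite linearZ /= hcoordE /hbasis r2vK.
Qed.

Lemma dual_ext (l l' : dual) : (forall i, l (hb i) = l' (hb i)) -> l = l'.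
Proof.
move=> h; apply/lfunP => v; rewrite [v]hbasis_sum !linear_sum.
by apply: eq_bigr => i _; rewrite !linearZ /= h.
Qed.

Lemma dual_sum (l : dual) : l = \sum_i (l (hb i) : k) *: hc i.
Proof.
apply: dual_ext => j; rewrite sum_lfunE (bigD1 j) //= big1 => [|i ne].
  by rewrite lfunE /= hcoord_hbasis eqxx [_ *: _]mulr1 addr0.
by rewrite lfunE /= hcoord_hbasis (negbTE ne) [_ *: _]mulr0.
Qed.

Lemma lin_coeff (l : dual) i : (lin l)@_(U_(i))%MM = l (hb i).
Proof.
rewrite /lin linear_sum (bigD1 i) //= big1 => [|j ne].
  by rewrite mcoeffZ mcoeffXU eqxx mulr1 addr0.
by rewrite mcoeffZ mcoeffXU (negbTE ne) mulr0.
Qed.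

Lemma lin_inj : injective (@lin k W S D).
Proof. by move=> l l' e; apply: dual_ext => i; rewrite -!lin_coeff e. Qed.

Lemma lin_hcoord i : lin (hc i) = 'X_i.
Proof.
rewrite /lin (bigD1 i) //= big1 => [|j ne]; rewrite hcoord_hbasis ?eqxx.
  by rewrite scale1r addr0.
by rewrite eq_sym (negbTE ne) scale0r.
Qed.

Lemma lin_homog (l : dual) : lin l \is 1.-homog.
Proof.
rewrite /lin; apply: rpred_sum => i _; apply: dhomogZ.
by rewrite dhomogX; apply/eqP; exact: mdeg1.
Qed.

Lemma mpoly_ring_ind (P : R -> Prop) : (forall c : k, P c%:MP) -> (forall i, P 'X_i) ->
  (forall f g, P f -> P g -> P (f + g)) -> (forall f g, P f -> P g -> P (f * g)) ->
  forall f, P f.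
Proof.
move=> PC PX PD PM f; rewrite [f]mpolyE; elim/big_ind: _ => //.
  by rewrite -mpolyC0.
move=> m _; rewrite -mul_mpolyC; apply: (PM _ _ (PC _)); rewrite mpolyXE_id.
elim/big_ind: _ => //; first by rewrite -mpolyC1.
by move=> i _; elim: (m i) => [|e IH]; rewrite ?expr0 -?mpolyC1 // exprS; exact: PM.
Qed.

Lemma SymGr_homog (f : R) d : f \is d.-homog -> SymGr (d.*2)%:Z f.
Proof. by move=> h; right; exists d. Qed.

Lemma SymGr_direct_sum : direct_sum (@SymGr k W S D).
Proof.
(* Degrees are doubled: only even i >= 0 contribute, through the polynomial component of degree
   i/2. *)
pose p (i : int) (f : R) : R :=
  if i is Posz m then if odd m then 0 else pihomog mdeg m./2 f else 0.
apply: (@direct_sum_proj _ _ _ p).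
- by move=> i; left.
- move=> i f g [->|[d -> hf]] [->|[e E hg]].
  + by left; rewrite subrr.
  + by rewrite sub0r E; apply: SymGr_homog; rewrite rpredN.
  + by rewrite subr0; exact: SymGr_homog.
  + have de : d = e by apply: double_inj; case: E.
    by apply: SymGr_homog; rewrite rpredB // de.
- move=> f; rewrite [f](@pihomog_partitionE _ _ mdeg (mmeasure mdeg f)) //.
  elim/big_ind: _ => [|x y|d _]; [exact: Span0|exact: addspanD|apply: SpanG].
  by exists (d.*2)%:Z; apply: SymGr_homog; exact: pihomogP.
- by move=> [m|m] f g; rewrite /p ?addr0 //; case: odd; rewrite ?addr0 // pihomogD.
- move=> i j f [->|[d -> hf]].
    by case: j => [m|m] /=; rewrite ?pihomog0; do ?case: ifP.
  case: j => [m|m] //=; rewrite eqz_nat; case: eqP => [->|ne].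
    by rewrite odd_double doubleK pihomog_dE.
  case: (boolP (odd m)) => // em; rewrite (pihomog_ne0 _ hf) //.
  apply/eqP => e; apply: ne; rewrite e -[LHS]odd_double_half (negbTE em).
  by rewrite add0n.
Qed.

Lemma SymGr1 : SymGr 0 (1 : R).
Proof. by apply: (@SymGr_homog 1 0%N); exact: dhomog1. Qed.

Lemma SymGrM i j (f g : R) : SymGr i f -> SymGr j g -> SymGr (i + j) (f * g).
Proof.
move=> [->|[d -> hf]]; first by left; rewrite mul0r.
move=> [->|[e -> hg]]; first by left; rewrite mulr0.
by rewrite -PoszD -doubleD; apply: SymGr_homog; exact: dhomogM.
Qed.

Lemma Sact_X (w : W) i : Sact D w 'X_i = lin (wdual w (hc i)).
Proof. by rewrite /Sact /= comp_mpolyXU -tnth_nth tnth_mktuple. Qed.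

Lemma SactC (w : W) (c : k) : Sact D w c%:MP = c%:MP.
Proof. exact: comp_mpolyC. Qed.

Lemma SactZ (w : W) (c : k) f : Sact D w (c *: f) = c *: Sact D w f.
Proof. exact: comp_mpolyZ. Qed.

Lemma wdualD (w : W) (l l' : dual) : wdual w (l + l') = wdual w l + wdual w l'.
Proof. exact: comp_lfunDl. Qed.
Lemma wdualZ (w : W) (c : k) (l : dual) : wdual w (c *: l) = c *: wdual w l.
Proof. by rewrite /wdual comp_lfunZl. Qed.

Lemma Sact_lin (w : W) (l : dual) : Sact D w (lin l) = lin (wdual w l).
Proof.
rewrite {1}/lin rmorph_sum {2}[l]dual_sum.
have wD : {morph (@wdual k W S D w) : u v / u + v} by exact: wdualD.
rewrite (big_morph _ wD (additive_0 wD)) (big_morph _ linD lin0).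
by apply: eq_bigr => i _; rewrite /= SactZ wdualZ linZ Sact_X.
Qed.

Lemma Sact_homog (w : W) d (f : R) : f \is d.-homog -> Sact D w f \is d.-homog.
Proof.
move/dhomogP => hf; rewrite [f]mpolyE rmorph_sum big_seq; apply: rpred_sum => m /hf hm.
rewrite /= SactZ; apply: dhomogZ; rewrite [Sact _ _ _]comp_mpolyX.
have -> : d = (\sum_i m i)%N by rewrite -mdegE; exact: esym hm.
elim/big_rec2: _ => [|i e g _ hg]; first exact: dhomog1.
apply: dhomogM hg; rewrite tnth_mktuple -[X in X.-homog]mul1n.
exact/dhomogMn/lin_homog.
Qed.

Lemma SymGr_act (w : W) i (f : R) : SymGr i f -> SymGr i (Sact D w f).
Proof.
by move=> [->|[d -> hf]]; [left; rewrite rmorph0|apply/SymGr_homog/Sact_homog].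
Qed.

Lemma lin_SymGr (l : dual) : SymGr 2 (lin l).
Proof. exact: SymGr_homog (lin_homog l). Qed.

End SymFacts.

Section RealizationSetting.
Variables (k : idomainType) (W : groupType) (S : {pred W}) (D : realdata k S).
Hypotheses (sg : signed_system S) (pre : prerealization D).

Local Notation R := (Sym D).
Local Notation Q := (locQ D).
Local Notation dual := 'Hom(hspace D, k^o).
Local Notation alpha := (@is_alpha k W S D).

Lemma hact1 : hact D 1%g = \1%VF. Proof. by case: pre => _ []. Qed.
Lemma hactM x y : hact D (x * y)%g = (hact D x \o hact D y)%VF.
Proof. by case: pre => _ [_ h _ _ _]. Qed.
Lemma hact_gen (s : gens S) v :
  hact D (val s) v = v - (root D s v : k) *: coroot D s.
Proof. by case: pre => _ [_ _ h _ _]. Qed.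
Lemma root_coroot (s : gens S) : root D s (coroot D s) = 2%:R.
Proof. by case: pre => h _; exact: h. Qed.
Lemma root_surj (s : gens S) (c : k) : exists v, root D s v = c.
Proof. by case: pre => _ [_ _ _ h _]. Qed.
Lemma coroot_surj (s : gens S) (c : k) : exists l : dual, l (coroot D s) = c.
Proof. by case: pre => _ [_ _ _ _ h]. Qed.

Lemma hactVK (w : W) v : hact D w^-1%g (hact D w v) = v.
Proof. by have := hactM w^-1%g w; rewrite mulVg hact1 => /lfunP/(_ v); rewrite comp_lfunE id_lfunE. Qed.
Lemma hactKV (w : W) v : hact D w (hact D w^-1%g v) = v.
Proof. by have := hactM w w^-1%g; rewrite mulgV hact1 => /lfunP/(_ v); rewrite comp_lfunE id_lfunE. Qed.

Lemma wdualE (w : W) (l : dual) v : wdual w l v = l (hact D w^-1%g v).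
Proof. exact: comp_lfunE. Qed.
Lemma wdual1 (l : dual) : wdual 1%g l = l.
Proof. by rewrite /wdual invg1 hact1 comp_lfun1r. Qed.
Lemma wdualM x y (l : dual) : wdual (x * y)%g l = wdual x (wdual y l).
Proof. by rewrite /wdual invgM hactM comp_lfunA. Qed.

Lemma wdual_gen (s : gens S) (l : dual) :
  wdual (val s) l = l - (l (coroot D s) : k) *: root D s.
Proof.
apply/lfunP => v; rewrite wdualE (gens_inv sg) hact_gen linearB linearZ /=.
by rewrite add_lfunE opp_lfunE scale_lfunE; congr (_ - _); exact: mulrC.
Qed.

Lemma wdual_gen_root (s : gens S) : wdual (val s) (root D s) = - root D s.
Proof.
rewrite wdual_gen root_coroot -[X in X - _]scale1r -scalerBl.
by rewrite (_ : 1 - 2%:R = -1) ?scaleN1r // mulr2n opprD addrA subrr sub0r.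
Qed.

Lemma Sact1 : Sact D 1%g =1 id.
Proof.
elim/mpoly_ring_ind => [c|i|f g hf hg|f g hf hg].
- exact: SactC.
- by rewrite Sact_X wdual1 lin_hcoord.
- by rewrite rmorphD hf hg.
- by rewrite rmorphM hf hg.
Qed.

Lemma SactM x y : Sact D (x * y)%g =1 Sact D x \o Sact D y.
Proof.
elim/mpoly_ring_ind => [c|i|f g hf hg|f g hf hg].
- by rewrite /= !SactC.
- by rewrite /= !Sact_X wdualM Sact_lin.
- by rewrite rmorphD hf hg /= !rmorphD.
- by rewrite rmorphM hf hg /= !rmorphM.
Qed.

Lemma root_neq0 (w : W) (s : gens S) : lin (wdual w (root D s)) != 0.
Proof.
apply/eqP => e; have [v v1] := root_surj s 1.
have := congr1 (fun l : dual => l (hact D w v)) (lin_inj (etrans e (esym (lin0 D)))).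
by rewrite wdualE hactVK v1 lfunE => /eqP; rewrite oner_eq0.
Qed.

Lemma alpha_neq0 f : alpha f -> f != 0.
Proof. by move=> [x [s [_ ->]]]; exact: root_neq0. Qed.

(** [is_alpha] asks that xs be longer than x. If ws is shorter than w, then ws takes the place of x,
    at the cost of a sign since s alpha_s = - alpha_s. This is where the parity of lengths enters,
    and it is what makes the set of units stable under W. *)
Lemma root_alpha (w : W) (s : gens S) :
  alpha (lin (wdual w (root D s))) \/ alpha (- lin (wdual w (root D s))).
Proof.
have [lt|lt] := ell_mul_gen sg w s; first by left; exists w, s.
right; exists (w * val s)%g, s; rewrite -mulgA.
have -> : (val s * val s = 1)%g by case: sg.
by rewrite mulg1 wdualM wdual_gen_root -linN (additive_N (wdualD w)).
Qed.

Local Notation den := (denominator alpha).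
Local Notation unitR := (lunit (toQ D)).

Lemma toQ_inj : injective (toQ D).
Proof. exact: (@toloc_inj _ alpha). Qed.
Lemma toQ_frac (q : Q) : exists f d, den d /\ q * toQ D d = toQ D f.
Proof. exact: (loc_fraction alpha_neq0 q). Qed.

Lemma den_lunit d : den d -> unitR d.
Proof. exact: (denominator_unit alpha_neq0). Qed.

Lemma lunitN d : unitR (- d) -> unitR d.
Proof. by move=> [e de]; exists (- e); rewrite mulrN -mulNr -rmorphN. Qed.

Lemma lunit_root (w : W) (s : gens S) : unitR (lin (wdual w (root D s))).
Proof.
have [h|h] := root_alpha w s; last apply: lunitN; rewrite -[X in lunit _ X]mulr1;
  apply/den_lunit/DenA => //; exact: Den1.
Qed.

Lemma lunit_factor d f : unitR (d * f) -> unitR d.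
Proof. by move=> [e h]; exists (toQ D f * e); rewrite mulrA -rmorphM. Qed.

Lemma lunit_den d : unitR d -> exists f, den (d * f).
Proof.
move=> [e de]; have [f [c [hc ec]]] := toQ_frac e.
exists f; suff -> : d * f = c by [].
by apply: toQ_inj; rewrite rmorphM -ec mulrA de mul1r.
Qed.

Lemma den_act (w : W) d : den d -> unitR (Sact D w d).
Proof.
elim=> [|_ b [x [s [lt ->]]] _ hb]; first by rewrite rmorph1; exact: lunit1.
by rewrite rmorphM /= Sact_lin -wdualM; apply: lunitM hb; exact: lunit_root.
Qed.

Lemma lunit_act (w : W) d : unitR d -> unitR (Sact D w d).
Proof.
by move=> /lunit_den[f hf]; apply: (@lunit_factor _ (Sact D w f)); rewrite -rmorphM; exact: den_act.
Qed.

Lemma den_homog d : den d -> exists e, d \is e.-homog.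
Proof.
elim=> [|_ b [x [s [_ ->]]] _ [e he]]; first by exists 0%N; exact: dhomog1.
by exists (1 + e)%N; apply: dhomogM he; exact: lin_homog.
Qed.

Lemma QGr_iota i (f : R) : SymGr i f -> QGr i (toQ D f).
Proof.
move=> [->|[d -> hf]]; first by left; rewrite rmorph0.
right; exists f, 1, d, 0%N; rewrite subr0 tofrac1 divr1; split=> //.
  exact: dhomog1.
exact: oner_neq0.
Qed.

Lemma QGr1 : @QGr k W S D 0 1.
Proof. by rewrite -(rmorph1 (toQ D)); apply/QGr_iota/SymGr1. Qed.

Lemma QGrM i j (p q : Q) : QGr i p -> QGr j q -> QGr (i + j) (p * q).
Proof.
move=> [->|[f [g [d [e [-> hf hg g0 pE]]]]]]; first by left; rewrite mul0r.
move=> [->|[f' [g' [d' [e' [-> hf' hg' g0' qE]]]]]]; first by left; rewrite mulr0.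
right; exists (f * f'), (g * g'), (d + d')%N, (e + e')%N; split.
- by rewrite !doubleD !PoszD opprD addrACA.
- exact: dhomogM.
- exact: dhomogM.
- by rewrite mulf_neq0.
- by rewrite [LHS]/= pE qE !tofracM invfM mulrACA.
Qed.

(** A common homogeneous denominator shifts all degrees by the same amount 2e, which reduces
    independence in Q to independence in R. *)
Lemma QGr_common (s : seq int) (F : int -> Q) : (forall i, QGr i (F i)) ->
  exists (g : R) (e : nat), [/\ g \is e.-homog, g != 0 & forall i, i \in s ->
    exists2 r : R, SymGr (i + (e.*2)%:Z) r & val (F i) * tofrac g = tofrac r].
Proof.
move=> hF; elim: s => [|i s [g [e [hg g0 gE]]]].
  by exists 1, 0%N; rewrite oner_eq0; split=> //; exact: dhomog1.
have [Fi|[f [h [d [c [iE hf hh h0 Fi]]]]]] := hF i.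
  exists g, e; split=> // j; rewrite inE => /orP[/eqP->|]; last exact: gE.
  by exists 0; [left|rewrite Fi /= mul0r tofrac0].
exists (g * h), (e + c)%N; split; first exact: dhomogM.
  by rewrite mulf_neq0.
move=> j; rewrite inE => /orP[/eqP->|/gE[r hr rE]].
  exists (f * g); last by rewrite Fi !tofracM mulrACA mulVf ?mulr1 ?tofrac_eq0.
  have -> : i + ((e + c).*2)%:Z = ((d + e).*2)%:Z.
    by rewrite iE !doubleD !PoszD [X in _ + X]addrC addrA subrK.
  by apply: SymGr_homog; exact: dhomogM.
exists (r * h); last by rewrite !tofracM mulrA rE.
by rewrite doubleD PoszD addrA; apply: SymGrM hr _; exact: SymGr_homog.
Qed.

Lemma QGr_direct_sum : direct_sum (@QGr k W S D).
Proof.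
apply: direct_sum_indep.
- by move=> i; left.
- move=> i p q hp hq; pose F (j : int) := if j == i then p else 0.
  have Q0 j : @QGr k W S D j 0 by left.
  move: hp hq => [->|[f [g [d [e [iE hf hg g0 pE]]]]]].
    move=> [->|[f' [g' [d' [e' [-> hf' hg' g0' qE]]]]]]; first by left; rewrite subrr.
    right; exists (- f'), g', d', e'; split=> //; first by rewrite rpredN.
    by rewrite sub0r /= qE tofracN mulNr.
  move=> [->|[f' [g' [d' [e' [iE' hf' hg' g0' qE]]]]]].
    by right; exists f, g, d, e; rewrite subr0.
  right; exists (f * g' - f' * g), (g * g'), (d + e')%N, (e + e')%N; split.
  + by rewrite iE !doubleD !PoszD opprD addrACA subrr addr0.
  + have de : (d + e' = d' + e)%N.
      apply: double_inj; apply/eqP; rewrite -eqz_nat !doubleD !PoszD; apply/eqP.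
      by rewrite -[(d.*2)%:Z](subrK (e.*2)%:Z) -iE iE' addrAC subrK addrC.
    by rewrite rpredB //; [exact: dhomogM|rewrite de; exact: dhomogM].
  + exact: dhomogM.
  + by rewrite mulf_neq0.
  + rewrite /= pE qE tofracB !tofracM invfM mulrBl.
    rewrite mulrACA divff ?tofrac_eq0 // mulr1; congr (_ - _).
    by rewrite [X in _ = X * _]mulrC mulrACA divff ?tofrac_eq0 // mul1r.
(* The denominator d is a product of roots, hence homogeneous, so q splits along the components of
   f. *)
- move=> q; have [f [d [hd qd]]] := toQ_frac q.
  have [e he] := den_homog hd; have [c dc] := den_lunit hd.
  have -> : q = toQ D f * c by rewrite -qd -mulrA dc mulr1.
  have d0 := denominator_neq0 alpha_neq0 hd.
  have cE : val c = (tofrac d)^-1.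
    have := congr1 val dc; rewrite /= => dc'; apply: (mulfI (x := tofrac d)).
      by rewrite tofrac_eq0.
    by rewrite dc' divff ?tofrac_eq0.
  apply: (addspan_map (f := fun f => toQ D f * c) _ _ _ _
    (direct_sum_span (SymGr_direct_sum D) f)).
  + by move=> x y; rewrite rmorphD mulrDl.
  + exact: Span0.
  + exact: SpanB.
  move=> u [i [->|[d' _ hu]]].
    by rewrite rmorph0 mul0r; exact: Span0.
  apply: SpanG; exists ((d'.*2)%:Z - (e.*2)%:Z); right.
  by exists u, d, d', e; split=> //; rewrite /= cE.
- move=> s F us hF sum0; have [g [e [hg g0 gE]]] := QGr_common s hF.
  (* The numerators are indexed by their own degree, which is shifted by 2e; the value is 0 at the
     degrees that do not come from s. *)
  pose r (j : int) : R := if pselect (j - (e.*2)%:Z \in s) is left h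
    then s2val (cid2 (gE _ h)) else 0.
  have hr j : SymGr j (r j).
    rewrite /r; case: pselect => h; last by left.
    by case: cid2 => x /= hx _; rewrite subrK in hx.
  have rE i : i \in s -> val (F i) * tofrac g = tofrac (r (i + (e.*2)%:Z)).
    move=> hi; rewrite /r; case: pselect => h; last by rewrite addrK in h.
    by case: cid2 => x /= _; rewrite addrK.
  have [_ _ _ ind] := SymGr_direct_sum D.
  have r0 : \sum_(j <- [seq i + (e.*2)%:Z | i <- s]) r j = 0.
    apply: toQ_inj; rewrite rmorph0 rmorph_sum big_map.
    have -> : \sum_(i <- s) toQ D (r (i + (e.*2)%:Z)) = \sum_(i <- s) F i * toQ D g.
      rewrite big_seq [RHS]big_seq; apply: eq_bigr => i /rE h.
      by apply: val_inj; rewrite /= -h.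
    by rewrite -mulr_suml sum0 mul0r.
  move=> i hi; apply: val_inj; have := rE i hi.
  have us' : uniq [seq i + (e.*2)%:Z | i <- s] by rewrite map_inj_uniq //; exact: addIr.
  rewrite (ind _ r us' hr r0 _ (map_f _ hi)).
  by rewrite tofrac0 => /eqP; rewrite mulf_eq0 tofrac_eq0 (negbTE g0) orbF => /eqP ->.
Qed.

Lemma realization_setting :
  setting (toQ D) (Sact D) (@SymGr k W S D) (@QGr k W S D).
Proof.
split.
- exact: toQ_inj.
- move=> q; have [f [d [hd qd]]] := toQ_frac q.
  by exists f, d; split=> //; exact: den_lunit.
- exact: Sact1.
- exact: SactM.
- by move=> w d; exact: lunit_act.
- exact: SymGr_direct_sum.
- exact: QGr_direct_sum.
- exact: QGr1.
- by move=> *; exact: SymGrM.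
- by move=> *; exact: QGrM.
- exact: QGr_iota.
Qed.

End RealizationSetting.

Lemma direct_sum_shift (V : zmodType) (P : int -> V -> Prop) (c : int) :
  direct_sum P -> direct_sum (fun i => P (i + c)).
Proof.
move=> dP; apply: direct_sum_indep.
- by move=> i; exact: direct_sum0.
- by move=> i; exact: direct_sumB.
- move=> v; apply: addspan_mono (direct_sum_span dP v) => t [i ti].
  by exists (i - c); rewrite subrK.
- move=> s f us fP e i i_s; have [_ _ _ ind] := dP.
  rewrite -[i](addrK c); apply: (ind [seq i + c | i <- s] (fun j => f (j - c))).
  + by rewrite map_inj_uniq //; exact: addIr.
  + by move=> j; have := fP (j - c); rewrite subrK.
  + by rewrite big_map -[RHS]e; apply: eq_bigr => j _; rewrite addrK.
  + exact: map_f.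
Qed.

Lemma graded_bimod_shift (A B : comNzRingType) (gA : int -> A -> Prop)
    (gB : int -> B -> Prop) (M : bimod A B) (gM : int -> M -> Prop) (c : int) :
  graded_bimod gA gB gM -> graded_bimod gA gB (fun i => gM (i + c)).
Proof.
move=> [dM Ml Mr]; split; first exact: direct_sum_shift.
  by move=> i j a m; rewrite -addrA; exact: Ml.
by move=> i j m b hm hb; rewrite addrAC; exact: Mr.
Qed.

(** * The objects R_w and C_s *)

Section ElementaryObjects.
Variables (k : idomainType) (W : groupType) (S : {pred W}) (D : realdata k S).
Hypotheses (sg : signed_system S) (pre : prerealization D).

Local Notation R := (Sym D).
Local Notation Q := (locQ D).
Local Notation idR := (idfun : {rmorphism R -> R}).
Local Notation dual := 'Hom(hspace D, k^o).
Local Notation SymGr := (@SymGr k W S D).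
Local Notation QGr := (@QGr k W S D).

Let st := realization_setting sg pre.

Definition goodD (X : Cobj D) : Prop := goodC (Sact D) SymGr QGr X.
Definition presentedD (M : bimod R R) (gM : int -> M -> Prop) (G : W -> M -> Prop) :=
  presented (toQ D) (Sact D) SymGr gM G.

Section TwoObj.
Variables (M : bimod R R) (gM : int -> M -> Prop) (G : W -> M -> Prop).
Hypothesis pr : presentedD gM G.

(** [two_obj] unfolds to [two_lbimod] for the setting [st]; the conversion is left to the kernel. *)
Lemma goodD_two : goodD (two_obj gM G).
Proof.
exact_no_check (@goodC_two R Q (toQ D) W (Sact D) SymGr QGr st M gM G pr
  (@gen_pieceP k W S D M G) (@two_loc k W S D M) (fun m => erefl)).
Qed.

Lemma lgens_two_obj :
  lgens (X := two_obj gM G) (fun w t => exists a m, G w m /\ t = a *< m).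
Proof.
exact_no_check (@lgens_two R Q (toQ D) W (Sact D) SymGr QGr st M gM G pr
  (@gen_pieceP k W S D M G) (@two_loc k W S D M) (fun m => erefl)).
Qed.

End TwoObj.

Lemma lpart_two_obj (M : bimod R R) (gM : int -> M -> Prop) (G : W -> M -> Prop) w m :
  G w m -> lpart (X := two_obj gM G) w m.
Proof. by move=> hm; apply: SpanG; exists 1, 1, m; rewrite lmul1 rmul1. Qed.

Lemma Sact_VK (w : W) f : Sact D w^-1%g (Sact D w f) = f.
Proof. by rewrite -[LHS]/((Sact D w^-1%g \o Sact D w) f) -(SactM pre) mulVg Sact1. Qed.
Lemma Sact_KV (w : W) f : Sact D w (Sact D w^-1%g f) = f.
Proof. by rewrite -[LHS]/((Sact D w \o Sact D w^-1%g) f) -(SactM pre) mulgV Sact1. Qed.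

Lemma presented_R (w : W) : @presentedD (ring_bimod idR (Sact D w)) SymGr (fun v _ => v = w).
Proof.
have lsp v m : lspan (M := ring_bimod idR (Sact D w)) (fun v _ => v = w) v m ->
    v <> w -> m = 0.
  move=> h ne; apply: (addspan_map (f := id) (Q := fun m => m = 0) _ _ _ _ h) => //.
    by move=> x y -> ->; rewrite subrr.
  by move=> u [a [m' [e _]]]; case: ne.
split.
- apply: graded_ring_bimod; first exact: SymGr_direct_sum.
  + by move=> *; exact: SymGrM.
  + by [].
  + by move=> i x; exact: SymGr_act.
- exact/left_fg_bimod/left_fg_regular.
- apply: flat_right_basis; exists 1%N, (fun=> 1), (fun _ m => Sact D w^-1%g m).
  split=> [_ m m'|_ m r|m]; first by rewrite rmorphD.
    by rewrite /= rmorphM /= Sact_VK.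
  by rewrite big_ord1 /= mul1r Sact_KV.
- by move=> v m f -> /=; rewrite mulrC.
- by exists [:: w] => v m -> _; rewrite mem_head.
- move=> m; exists 1; split; first exact: lunit1.
  by apply: SpanG; exists w; apply: SpanG; exists 1, m; rewrite lmul1 rmul1.
- move=> s n us hn sum0 v vs; have [e|ne] := eqVneq v w; last by apply: lsp (hn v) _; exact/eqP.
  rewrite -sum0 (bigD1_seq v) //= big1 ?addr0 // => u /eqP uv.
  by apply: lsp (hn u) _ => uw; apply: uv; rewrite uw e.
- move=> v m ->; apply: addspan_mono (direct_sum_span (SymGr_direct_sum D) m).
  by move=> t ht; split.
Qed.

Section Reflection.
Variable s : gens S.

Local Notation sR := (Sact D (val s)).
Local Notation RRs := (RRs D (val s)).
Local Notation "f \ot g" := (@RRs_pure k W S D (val s) f g) (at level 40).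
Local Notation alpha := (lin (root D s)).

Lemma lam_ex : exists l : dual, l (coroot D s) = 1. Proof. exact: coroot_surj. Qed.
Definition lam : dual := sval (cid lam_ex).
Lemma lamE : lam (coroot D s) = 1. Proof. by rewrite /lam; case: cid. Qed.
Let dl := lin lam.

Lemma Sact_gen_lin (l : dual) : sR (lin l) = lin l - (l (coroot D s) : k) *: alpha.
Proof. by rewrite Sact_lin (wdual_gen sg pre) linD linN linZ. Qed.

Lemma Sact_gen_lam : sR dl = dl - alpha.
Proof. by rewrite Sact_gen_lin lamE scale1r. Qed.

Lemma Sact_genK f : sR (sR f) = f.
Proof. by rewrite -{1}(gens_inv sg) Sact_VK. Qed.

Lemma alpha_s_neq0 : alpha != 0.
Proof. by rewrite -[root D s](wdual1 pre); exact: root_neq0. Qed.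

(** With delta written [dl]: a linear form becomes invariant after subtracting the multiple of delta
    that makes it vanish on the coroot. Products are reduced by delta^2 = (delta + s delta) delta -
    delta s(delta), whose coefficients are invariant. *)
Lemma invariant_decomp f : exists a b, [/\ sR a = a, sR b = b & f = a + b * dl].
Proof.
elim/mpoly_ring_ind: f => [c|i|f g [a [b [ha hb ->]]] [c [d [hc hd ->]]]|f g [a [b [ha hb ->]]] [c [d [hc hd ->]]]].
- by exists c%:MP, 0; rewrite rmorph0 mul0r addr0 SactC.
- pose l := @hcoord k W S D i; pose x := l (coroot D s) : k.
  exists (lin (l - x *: lam)), x%:MP; rewrite SactC; split=> //.
    rewrite Sact_gen_lin add_lfunE opp_lfunE scale_lfunE lamE.
    by rewrite [_ *: 1]mulr1 subrr scale0r subr0.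
  by rewrite linD linN linZ mul_mpolyC subrK lin_hcoord.
- exists (a + c), (b + d); rewrite !rmorphD ha hb hc hd; split=> //.
  by rewrite mulrDl addrACA.
- exists (a * c - b * d * (dl * sR dl)), (a * d + b * c + b * d * (dl + sR dl)).
  split; rewrite ?(rmorphB, rmorphD, rmorphM) /= ?Sact_genK ?ha ?hb ?hc ?hd //.
  + by rewrite [sR dl * dl]mulrC.
  + by rewrite [sR dl + dl]addrC.
  + by ring.
Qed.

(** Applying s and subtracting leaves b (delta - s delta) = b alpha_s = 0, in a domain. *)
Lemma invariant_uniq a b : sR a = a -> sR b = b -> a + b * dl = 0 -> a = 0 /\ b = 0.
Proof.
move=> ha hb e; have e' : a + b * sR dl = 0.
  by have := congr1 sR e; rewrite rmorphD rmorphM rmorph0 /= ha hb.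
have : b * alpha = 0.
  have -> : alpha = dl - sR dl by rewrite Sact_gen_lam opprB addrCA subrr addr0.
  by rewrite mulrBr -[b * dl](addKr a) e -[b * sR dl](addKr a) e' subrr.
move/eqP; rewrite mulf_eq0 (negbTE alpha_s_neq0) orbF => /eqP b0.
by move: e; rewrite b0 mul0r addr0.
Qed.

Lemma invariant_coord : exists c0 c1 : R -> R,
  [/\ forall f, sR (c0 f) = c0 f, forall f, sR (c1 f) = c1 f,
      forall f, f = c0 f + c1 f * dl
    & (forall a b, sR a = a -> sR b = b -> c0 (a + b * dl) = a /\ c1 (a + b * dl) = b)].
Proof.
have [c hc] := choice (fun f => invariant_decomp f).
have [d hd] := choice hc.
exists c, d; have h0 f : sR (c f) = c f by have [] := hd f.
have h1 f : sR (d f) = d f by have [] := hd f.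
have hE f : f = c f + d f * dl by have [] := hd f.
split=> // a b ha hb; have := hE (a + b * dl); set f := a + b * dl => e.
have : (c f - a) + (d f - b) * dl = 0.
  by rewrite mulrBl addrACA -opprD -e subrr.
case/invariant_uniq; rewrite ?rmorphB ?h0 ?h1 /= ?ha ?hb //.
by move=> /eqP; rewrite subr_eq0 => /eqP -> /eqP; rewrite subr_eq0 => /eqP ->.
Qed.

Lemma pureRDl f f' g : (f + f') \ot g = f \ot g + f' \ot g.
Proof. exact: tpureDl. Qed.
Lemma pureRDr f g g' : f \ot (g + g') = f \ot g + f \ot g'.
Proof. exact: tpureDr. Qed.
Lemma pureR_l a f g : a *< (f \ot g) = (a * f) \ot g.
Proof. exact: tpure_l. Qed.
Lemma pureR_r f g b : (f \ot g) >* b = f \ot (g * b).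
Proof. exact: tpure_r. Qed.
Lemma pureR_mid f b g : sR b = b -> (f * b) \ot g = f \ot (b * g).
Proof.
move=> /eqP hb; pose b' : invR D (val s) := exist _ b hb.
exact: (tpureA (f : ring_bimod idR (invR_val D (val s))) b'
  (g : ring_bimod (invR_val D (val s)) idR)).
Qed.
Lemma pureR_ind (P : RRs -> Prop) : (forall f g, P (f \ot g)) ->
  (forall x y, P x -> P y -> P (x + y)) -> forall m, P m.
Proof.
exact: (@tind _ _ _ (ring_bimod idR (invR_val D (val s))) (ring_bimod (invR_val D (val s)) idR)).
Qed.

Definition Cs_one : RRs := dl \ot 1 - 1 \ot sR dl.
Definition Cs_s : RRs := dl \ot 1 - 1 \ot dl.

(** Two admissible choices of delta differ by an s-invariant element, which crosses the tensor sign
    and cancels. *)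
Lemma Cs_genE v m : @Cs_gen k W S D s v m <->
  (v = 1%g /\ m = Cs_one) \/ (v = val s /\ m = Cs_s).
Proof.
have E (d : dual) : d (coroot D s) = 1 ->
    (lin d) \ot 1 - 1 \ot sR (lin d) = Cs_one /\ (lin d) \ot 1 - 1 \ot lin d = Cs_s.
  move=> d1; pose e := lin (d - lam).
  have he : sR e = e.
    by rewrite Sact_gen_lin add_lfunE opp_lfunE d1 lamE subrr scale0r subr0.
  have -> : lin d = dl + 1 * e by rewrite mul1r /e linD linN addrCA subrr addr0.
  rewrite rmorphD rmorphM rmorph1 /= he !(pureRDl, pureRDr) pureR_mid // mulr1 mul1r.
  have cancel (x y z : RRs) : x + z - (y + z) = x - y.
    by rewrite opprD addrACA subrr addr0.
  by rewrite !cancel.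
split=> [[d [d1 [[-> ->]|[-> ->]]]]|].
- by left; split; [|exact: (E d d1).1].
- by right; split; [|exact: (E d d1).2].
- by move=> [[-> ->]|[-> ->]]; exists lam; split; [exact: lamE|left|exact: lamE|right].
Qed.

(** Normal form in the right basis 1 (x) 1, delta (x) 1; the two twisting identities are checked by
    comparing coefficients in it. *)
Lemma pureR_norm a b g : sR a = a -> sR b = b ->
  (a + b * dl) \ot g = 1 \ot (a * g) + dl \ot (b * g).
Proof.
move=> ha hb; rewrite pureRDl [b * dl]mulrC pureR_mid //.
by rewrite -[a in LHS]mul1r pureR_mid.
Qed.

Let tr := dl + sR dl.
Let nm := dl * sR dl.
Let tr_inv : sR tr = tr. Proof. by rewrite /tr rmorphD /= Sact_genK addrC. Qed.
Let nm_inv : sR nm = nm. Proof. by rewrite /nm rmorphM /= Sact_genK mulrC. Qed.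
Let sdl : sR dl = tr - dl. Proof. by rewrite /tr addrC addKr. Qed.
Let dl2 : dl * dl = tr * dl - nm. Proof. by rewrite /nm sdl; ring. Qed.

Lemma Cs_one_twist f : Cs_one >* f = f *< Cs_one.
Proof.
have [a [b [ha hb ->]]] := invariant_decomp f.
have -> : Cs_one >* (a + b * dl) = 1 \ot (- (sR dl * (a + b * dl))) + dl \ot (a + b * dl).
  rewrite rmulDl rmulNl !pureR_r mul1r addrC; congr (_ + _).
  by rewrite (additive_N (pureRDr 1)).
rewrite lmulDr lmulNr !pureR_l mulr1.
have -> : (a + b * dl) * dl = - (b * nm) + (a + b * tr) * dl.
  by rewrite mulrDl -mulrA dl2; ring.
have h1 : sR (- (b * nm)) = - (b * nm) by rewrite rmorphN rmorphM /= hb nm_inv.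
have h2 : sR (a + b * tr) = a + b * tr by rewrite rmorphD rmorphM /= ha hb tr_inv.
rewrite (pureR_norm _ h1 h2) (pureR_norm _ ha hb).
rewrite opprD addrACA -!(additive_N (pureRDr _)) -!pureRDr; congr (_ \ot _ + _ \ot _).
  by rewrite sdl /nm sdl; ring.
by rewrite sdl; ring.
Qed.

Lemma Cs_s_twist f : Cs_s >* f = sR f *< Cs_s.
Proof.
have [a [b [ha hb ->]]] := invariant_decomp f.
have -> : Cs_s >* (a + b * dl) = 1 \ot (- (dl * (a + b * dl))) + dl \ot (a + b * dl).
  rewrite rmulDl rmulNl !pureR_r mul1r addrC; congr (_ + _).
  by rewrite (additive_N (pureRDr 1)).
rewrite lmulDr lmulNr !pureR_l mulr1 rmorphD rmorphM /= ha hb.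
have -> : (a + b * sR dl) * dl = b * nm + a * dl by rewrite /nm; ring.
have -> : a + b * sR dl = (a + b * tr) + (- b) * dl by rewrite sdl; ring.
have h1 : sR (b * nm) = b * nm by rewrite rmorphM /= hb nm_inv.
have h2 : sR (a + b * tr) = a + b * tr by rewrite rmorphD rmorphM /= ha hb tr_inv.
have h3 : sR (- b) = - b by rewrite rmorphN hb.
rewrite (pureR_norm _ h1 ha) (pureR_norm _ h2 h3).
rewrite opprD addrACA -!(additive_N (pureRDr _)) -!pureRDr; congr (_ \ot _ + _ \ot _).
  by rewrite /nm sdl; ring.
by ring.
Qed.

Let s_neq1 : val s <> 1%g. Proof. exact: gen_neq1. Qed.

Lemma lspan_Cs v m : lspan (@Cs_gen k W S D s) v m ->
  [\/ v = 1%g /\ exists a, m = a *< Cs_one, v = val s /\ exists a, m = a *< Cs_s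
   | m = 0].
Proof.
elim=> [|_ [a [n [/Cs_genE[[-> ->]|[-> ->]] ->]]]|x y _ hx _ hy]; first by constructor 3.
- by constructor 1; split=> //; exists a.
- by constructor 2; split=> //; exists a.
case: hx => [[e' [a ->]]|[e' [a ->]]|->]; case: hy => [[e [b ->]]|[e [b ->]]|->].
- by constructor 1; split=> //; exists (a - b); rewrite lmulDl (additive_N (fun x y => lmulDl x y _)).
- by case: s_neq1; rewrite -e -e'.
- by constructor 1; split=> //; exists a; rewrite subr0.
- by case: s_neq1; rewrite -e -e'.
- by constructor 2; split=> //; exists (a - b); rewrite lmulDl (additive_N (fun x y => lmulDl x y _)).
- by constructor 2; split=> //; exists a; rewrite subr0.
- by constructor 1; split=> //; exists (- b); rewrite sub0r (additive_N (fun x y => lmulDl x y _)).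
- by constructor 2; split=> //; exists (- b); rewrite sub0r (additive_N (fun x y => lmulDl x y _)).
- by constructor 3; rewrite subrr.
Qed.

Let invS i (b : invR D (val s)) := SymGr i (val b).

Lemma invR_direct_sum : direct_sum invS.
Proof.
have dS := SymGr_direct_sum D.
have cs f i : sR f = f -> sR (dcomp dS f i) = dcomp dS f i.
  move=> hf; rewrite -(dcomp_map dS dS (f := sR)) ?hf //.
    by move=> x y; rewrite rmorphD.
  by move=> j v; exact: SymGr_act.
pose p i (b : invR D (val s)) : invR D (val s) := exist _ (dcomp dS (val b) i)
  (introT eqP (cs (val b) i (eqP (svalP b)))).
apply: (@direct_sum_proj _ _ _ p).
- by move=> i; left.
- move=> i x y hx hy; rewrite /invS rmorphB; exact: (direct_sumB dS).
- move=> b; have -> : b = \sum_(i <- dsupp dS (val b)) p i b.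
    by apply: val_inj; rewrite raddf_sum /= -dcomp_sum.
  elim/big_ind: _ => [|x y|i _]; [exact: Span0|exact: addspanD|apply: SpanG].
  by exists i; exact: dcompP.
- by move=> i v w; apply: val_inj; rewrite /= dcompD.
- move=> i j v hv; apply: val_inj; rewrite /= (dcomp_hom dS _ hv).
  by case: eqP.
Qed.

Lemma graded_RRs : graded_bimod SymGr SymGr (@Cs_gr k W S D (val s)).
Proof.
apply: (@graded_bimod_shift _ _ _ _ _ _ 1); apply: graded_bimod_tens invR_direct_sum _ _.
- apply: graded_ring_bimod => //; first exact: SymGr_direct_sum.
  by move=> *; exact: SymGrM.
- apply: graded_ring_bimod => //; first exact: SymGr_direct_sum.
  by move=> *; exact: SymGrM.
Qed.

Lemma left_fg_RRs : left_fg RRs.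
Proof.
exists 2%N, (fun i => if i == ord0 then 1 \ot 1 else 1 \ot dl).
apply: pureR_ind => [f g|x y [a ->] [b ->]]; last first.
  exists (fun i => a i + b i); rewrite -big_split.
  by apply: eq_bigr => i _; rewrite lmulDl.
have [a [b [ha hb ->]]] := invariant_decomp g.
exists (fun i => if i == ord0 then f * a else f * b).
transitivity ((f * a) *< (1 \ot 1) + (f * b) *< (1 \ot dl)).
  by rewrite !pureR_l !mulr1 !pureR_mid // mulr1 pureRDr.
by rewrite big_ord_recl big_ord1.
Qed.

Lemma right_basis_RRs : right_basis RRs.
Proof.
have [c0 [c1 [h0 h1 hE hu]]] := invariant_coord.
have cD f f' : c0 (f + f') = c0 f + c0 f' /\ c1 (f + f') = c1 f + c1 f'.
  have -> : f + f' = (c0 f + c0 f') + (c1 f + c1 f') * dl.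
    by rewrite mulrDl addrACA -!hE.
  by apply: hu; rewrite rmorphD ?h0 ?h1.
have cM f b : sR b = b -> c0 (f * b) = c0 f * b /\ c1 (f * b) = c1 f * b.
  move=> hb; have -> : f * b = c0 f * b + (c1 f * b) * dl.
    by rewrite mulrAC -mulrDl -hE.
  by apply: hu; rewrite rmorphM /= ?h0 ?h1 hb.
pose F (c : R -> R) (f : ring_bimod idR (invR_val D (val s)))
  (g : ring_bimod (invR_val D (val s)) idR) : R := c f * (g : R).
have bal (c : R -> R) : (forall f f', c (f + f') = c f + c f') ->
    (forall f b, sR b = b -> c (f * b) = c f * b) -> balanced (F c).
  move=> hD hM; split=> [f f' g|f g g'|f b g]; rewrite /F ?hD ?mulrDl ?mulrDr //.
  by rewrite hM /= ?mulrA //; exact/eqP/(svalP b).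
have b0 := bal c0 (fun f f' => (cD f f').1) (fun f b hb => (cM f b hb).1).
have b1 := bal c1 (fun f f' => (cD f f').2) (fun f b hb => (cM f b hb).2).
pose C0 : RRs -> R := tens_rec (F c0).
pose C1 : RRs -> R := tens_rec (F c1).
have C0D x y : C0 (x + y) = C0 x + C0 y by exact: (tens_recD b0).
have C1D x y : C1 (x + y) = C1 x + C1 y by exact: (tens_recD b1).
have C0E f g : C0 (f \ot g) = c0 f * g by exact: (tens_rec_pure _ _ b0).
have C1E f g : C1 (f \ot g) = c1 f * g by exact: (tens_rec_pure _ _ b1).
exists 2%N, (fun i => if i == ord0 then 1 \ot 1 else dl \ot 1).
exists (fun i => if i == ord0 then C0 else C1); split.
- by move=> i m m'; case: eqP.
- move=> i m r; case: eqP => _; elim/pureR_ind: m => [f g|x y hx hy].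
  + by rewrite pureR_r !C0E mulrA.
  + by rewrite rmulDl !C0D hx hy mulrDl.
  + by rewrite pureR_r !C1E mulrA.
  + by rewrite rmulDl !C1D hx hy mulrDl.
- move=> m; transitivity ((1 \ot 1) >* C0 m + (dl \ot 1) >* C1 m); last first.
    by rewrite big_ord_recl big_ord1.
  elim/pureR_ind: m => [f g|x y hx hy].
    by rewrite C0E C1E !pureR_r !mul1r {1}(hE f) pureR_norm ?h0 ?h1.
  by rewrite C0D C1D !rmulDr addrACA -hx -hy.
Qed.

(** The maps f (x) g -> f g and f (x) g -> f s(g) each kill one of the two generators and send the
    other to alpha_s, whence independence. Since [Cs_one] and [Cs_s] differ by 1 (x) alpha_s,
    multiplication by alpha_s carries all of C_s into the sum of its parts. *)
Lemma presented_C : presentedD (@Cs_gr k W S D (val s)) (@Cs_gen k W S D s).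
Proof.
pose F (h : R -> R) (f : ring_bimod idR (invR_val D (val s)))
  (g : ring_bimod (invR_val D (val s)) idR) : R := (f : R) * h g.
have bal (h : R -> R) : (forall g g', h (g + g') = h g + h g') ->
    (forall b g, sR b = b -> h (b * g) = b * h g) -> balanced (F h).
  move=> hD hM; split=> [f f' g|f g g'|f b g]; rewrite /F ?hD ?mulrDl ?mulrDr //.
  by rewrite [in RHS]/= hM /= ?mulrA //; exact/eqP/(svalP b).
have b1 := bal id (fun _ _ => erefl) (fun _ _ _ => erefl).
have b2 : _ := bal sR (rmorphD sR) _.
have {}b2 := b2 (fun b g hb => etrans (rmorphM sR b g) (congr1 (fun x => x * sR g) hb)).
pose m1 : RRs -> R := tens_rec (F id).
pose m2 : RRs -> R := tens_rec (F sR).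
have m1D x y : m1 (x + y) = m1 x + m1 y by exact: (tens_recD b1).
have m2D x y : m2 (x + y) = m2 x + m2 y by exact: (tens_recD b2).
have m1E f g : m1 (f \ot g) = f * g by exact: (tens_rec_pure _ _ b1).
have m2E f g : m2 (f \ot g) = f * sR g by exact: (tens_rec_pure _ _ b2).
have alE : dl - sR dl = alpha by rewrite Sact_gen_lam opprB addrCA subrr addr0.
have m11 a : m1 (a *< Cs_one) = a * alpha.
  rewrite lmulDr lmulNr !pureR_l m1D (additive_N m1D) !m1E !mulr1 -alE; ring.
have m1s a : m1 (a *< Cs_s) = 0.
  rewrite lmulDr lmulNr !pureR_l m1D (additive_N m1D) !m1E; ring.
have m21 a : m2 (a *< Cs_one) = 0.
  rewrite lmulDr lmulNr !pureR_l m2D (additive_N m2D) !m2E Sact_genK rmorph1; ring.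
have m2s a : m2 (a *< Cs_s) = a * alpha.
  rewrite lmulDr lmulNr !pureR_l m2D (additive_N m2D) !m2E rmorph1 -alE; ring.
have al_inj a : a * alpha = 0 -> a = 0.
  by move/eqP; rewrite mulf_eq0 (negbTE alpha_s_neq0) orbF => /eqP.
split.
- exact: graded_RRs.
- exact: left_fg_bimod left_fg_RRs.
- exact: flat_right_basis right_basis_RRs.
- move=> v m f /Cs_genE[[-> ->]|[-> ->]]; last exact: Cs_s_twist.
  by rewrite (Sact1 pre) Cs_one_twist.
- exists [:: 1%g; val s] => v m /Cs_genE[[-> _]|[-> _]] _.
    by rewrite mem_head.
  by rewrite !inE eqxx orbT.
- have C1s : Cs_one - Cs_s = 1 \ot alpha.
    rewrite /Cs_one /Cs_s -alE pureRDr (additive_N (pureRDr 1)) opprB.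
    by rewrite addrC -addrA [X in _ + X]addrA addNr add0r.
  move=> m; exists alpha; split.
    by rewrite -[root D s](wdual1 pre); exact: lunit_root.
  elim/pureR_ind: m => [f g|x y hx hy]; last by rewrite rmulDl; exact: addspanD.
  have -> : (f \ot g) >* alpha = (g *< (f *< Cs_one)) - (sR g *< (f *< Cs_s)).
    rewrite !(lmulC _ f) -Cs_one_twist -Cs_s_twist.
    rewrite -(lmulNr f) -(rmulNl _ g) -lmulDr -rmulDl C1s !pureR_r pureR_l mulr1.
    by rewrite [g * _]mulrC.
  rewrite !lmulA; apply: SpanB; apply: SpanG.
    exists 1%g; apply: SpanG; exists (g * f), Cs_one; split=> //.
    by apply/Cs_genE; left.
  exists (val s); apply: SpanG; exists (sR g * f), Cs_s; split=> //.
  by apply/Cs_genE; right.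
- move=> l n ul hn sum0 v vl; have [[e [a na]]|[e [a na]]|//] := lspan_Cs (hn v).
    have := congr1 m1 sum0; rewrite (additive_0 m1D) (big_morph m1 m1D (additive_0 m1D)).
    rewrite (bigD1_seq v) //= big1 => [|u /eqP uv].
      by rewrite addr0 na m11 => /al_inj ->; rewrite lmul0l.
    have [[eu _]|[_ [b ->]]|->] := lspan_Cs (hn u); last exact: additive_0.
      by case: uv; rewrite eu e.
    exact: m1s.
  have := congr1 m2 sum0; rewrite (additive_0 m2D) (big_morph m2 m2D (additive_0 m2D)).
  rewrite (bigD1_seq v) //= big1 => [|u /eqP uv].
    by rewrite addr0 na m2s => /al_inj ->; rewrite lmul0l.
  have [[_ [b ->]]|[eu _]|->] := lspan_Cs (hn u); last exact: additive_0.
    exact: m21.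
  by case: uv; rewrite eu e.
- have gp f g i j : SymGr i f -> SymGr j g -> i + j = 2%:Z ->
      Cs_gr (w := val s) 1 (f \ot g).
    by move=> hf hg e; apply: SpanG; exists i, j, f, g.
  have g1 : SymGr 0 (1 : R) by exact: SymGr1.
  have gl : SymGr 2 dl by exact: lin_SymGr.
  have gsl : SymGr 2 (sR dl) by exact: SymGr_act.
  have [dM _ _] := graded_RRs.
  move=> v m h; apply: SpanG; split=> //; exists 1.
  have [[_ ->]|[_ ->]] := (Cs_genE v m).1 h; apply: (direct_sumB dM).
  + by apply: gp gl g1 _; rewrite addr0.
  + by apply: gp g1 gsl _; rewrite add0r.
  + by apply: gp gl g1 _; rewrite addr0.
  + by apply: gp g1 gl _; rewrite add0r.
Qed.

End Reflection.
End ElementaryObjects.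

(** * The realization of the neutral group *)

Section EndoscopicPrerealization.
Variables (k : idomainType) (W : groupType) (S : {pred W}).
Variables (cox : coxeter_system S) (D : realdata k S) (pre : prerealization D).
Variables (o : wset W) (L : o).

Local Notation nS := (neutral_gens cox L).
Local Notation D' := (endo_realdata cox D L).
Local Notation dual := 'Hom(hspace D, k^o).

Let sg := coxeter_signed cox.

Lemma refl_root_coroot (r : gens nS) : exists (x : W) (s : gens S),
  [/\ val (val r) = (x * val s * x^-1)%g, refl_root D (val (val r)) = wdual x (root D s)
    & refl_coroot D (val (val r)) = hact D x (coroot D s)].
Proof.
have h := neutral_gen_refl_pres r; rewrite /refl_root /refl_coroot.
case: pselect => // h'; case: (cid h') => -[x s] /= [rE _].
by exists x, s.
Qed.

Lemma endo_prerealization : prerealization D'.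
Proof.
split=> [r|].
  have [x [s [_ r1 r2]]] := refl_root_coroot r.
  by rewrite /cartan /= r1 r2 wdualE (hactVK pre) (root_coroot pre).
split.
- exact: (hact1 pre).
- by move=> x y; exact: (hactM pre).
- move=> r v; have [x [s [rE r1 r2]]] := refl_root_coroot r.
  rewrite /= r1 r2 rE !(hactM pre) !comp_lfunE /= (hact_gen pre) linearB linearZ /=.
  by rewrite (hactKV pre).
- move=> r c; have [x [s [_ r1 _]]] := refl_root_coroot r.
  have [v <-] := root_surj pre s c; exists (hact D x v).
  by rewrite /= r1 wdualE (hactVK pre).
- move=> r c; have [x [s [_ _ r2]]] := refl_root_coroot r.
  have [l <-] := coroot_surj pre s c; exists (wdual x l : dual).
  by rewrite /= r2 wdualE (hactVK pre).
Qed.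

Lemma Sact_endo (w : neutral_group L cox) (f : Sym D) :
  Sact D' w f = Sact D (val w) f :> Sym D.
Proof.
elim/mpoly_ring_ind: f => [c|i|f g hf hg|f g hf hg].
- exact: etrans (@SactC k _ _ D' w c) (esym (SactC D (val w) c)).
- apply: etrans (@Sact_X k _ _ D' w i) (etrans _ (esym (Sact_X (val w) i))).
  by congr lin; apply/lfunP => v; rewrite !wdualE /= val_neutralV.
- apply: etrans (rmorphD (Sact D' w) f g) (etrans _ (esym (rmorphD (Sact D (val w)) f g))).
  exact: congr2 hf hg.
- apply: etrans (rmorphM (Sact D' w) f g) (etrans _ (esym (rmorphM (Sact D (val w)) f g))).
  exact: congr2 hf hg.
Qed.

Lemma wdual_endo (w : neutral_group L cox) (l : dual) :
  @wdual k _ _ D' w l = @wdual k _ _ D (val w) l.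
Proof.
apply/lfunP => v; rewrite !wdualE; congr (l (hact D _ v)); exact: val_neutralV.
Qed.

(** A root of the neutral group is w x alpha_s for some w, x in W, hence a root of W up to sign. *)
Lemma lunit_endo (d : Sym D) : lunit (toQ D') d -> lunit (toQ D) d.
Proof.
move=> /(lunit_den endo_prerealization)[f hf].
suff h : lunit (toQ D) ((d : Sym D) * (f : Sym D)) by exact: lunit_factor h.
elim: hf => [|a b [w [r [_ ->]]] _ hb]; first exact: lunit1.
have [x [s [_ r1 _]]] := refl_root_coroot r.
have e : lin (wdual w (root D' r)) = lin (wdual (val w * x)%g (root D s)) :> Sym D.
  by apply: (congr1 (@lin k W S D)); rewrite wdual_endo (wdualM pre) -r1.
apply: lunitM hb.
by rewrite [X in lunit _ X]e; apply: (lunit_root sg pre).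
Qed.

End EndoscopicPrerealization.

(** * Isomorphisms between tensor products *)

Section Isomorphisms.
Variable C : category.

Lemma isomorphic_refl (X : C) : isomorphic X X.
Proof. by exists (idc X), (idc X); split; rewrite cmp1l. Qed.
Lemma isomorphic_sym (X Y : C) : isomorphic X Y -> isomorphic Y X.
Proof. by move=> [f [g [h1 h2]]]; exists g, f. Qed.

Lemma inverse_comp (X Y Z : C) (f : hom X Y) f' (g : hom Y Z) g' :
  inverse f f' -> inverse g g' -> inverse (g \oc f) (f' \oc g').
Proof.
move=> [f1 f2] [g1 g2]; split.
  by rewrite -cmpA (cmpA g' g f) g1 cmp1l.
by rewrite -cmpA (cmpA f f' g') f2 cmp1l.
Qed.

Lemma isomorphic_trans (X Y Z : C) : isomorphic X Y -> isomorphic Y Z -> isomorphic X Z.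
Proof.
move=> [f [f' hf]] [g [g' hg]]; exists (g \oc f), (f' \oc g').
exact: inverse_comp.
Qed.
End Isomorphisms.

Section MonoidalIsomorphisms.
Variable C : monoidal.

Lemma isomorphic_ten (X X' Y Y' : C) :
  isomorphic X X' -> isomorphic Y Y' -> isomorphic (ten X Y) (ten X' Y').
Proof.
move=> [f [f' [f1 f2]]] [g [g' [g1 g2]]]; exists (tmap f g), (tmap f' g').
by split; rewrite -tmapM ?f1 ?g1 ?f2 ?g2 tmap1.
Qed.
Lemma isomorphic_assoc (X Y Z : C) : isomorphic (ten (ten X Y) Z) (ten X (ten Y Z)).
Proof. by exists (massoc X Y Z), (massoci X Y Z); exact: massocK. Qed.
Lemma isomorphic_lun (X : C) : isomorphic (ten munit X) X.
Proof. by exists (mlun X), (mluni X); exact: mlunK. Qed.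
Lemma isomorphic_run (X : C) : isomorphic (ten X munit) X.
Proof. by exists (mrun X), (mruni X); exact: mrunK. Qed.
End MonoidalIsomorphisms.

Section TwistedBimodules.
Variable R : comNzRingType.
Local Notation idR := (idfun : {rmorphism R -> R}).
Local Notation Rb a := (ring_bimod idR a).

Lemma twist_comp (a b c : {rmorphism R -> R}) : c =1 a \o b ->
  exists (F : bhom (tens (Rb a) (Rb b)) (Rb c)) (F' : bhom (Rb c) (tens (Rb a) (Rb b))),
    cancel F F' /\ cancel F' F.
Proof.
move=> cE; pose ff (f : Rb a) (g : Rb b) : Rb c := f * a g.
have bal : balanced ff.
  split=> [f f' g|f g g'|f r g]; rewrite /ff ?mulrDl ?rmorphD ?mulrDr //.
  by rewrite /= rmorphM mulrA.
have fl r m n : ff (r *< m) n = r *< ff m n by rewrite /ff /= mulrA.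
have fr m n r : ff m (n >* r) = ff m n >* r.
  by rewrite /ff /= rmorphM cE mulrA.
pose F := tens_hom bal fl fr.
pose gg (h : Rb c) : tens (Rb a) (Rb b) := tpure (h : Rb a) (1 : Rb b).
have gD h h' : gg (h + h') = gg h + gg h' by exact: tpureDl.
have gl r h : gg (r *< h) = r *< gg h by rewrite /gg tpure_l.
have gr h r : gg (h >* r) = gg h >* r.
  rewrite /gg tpure_r; have -> : (1 : Rb b) >* r = (b r : R) *< (1 : Rb b).
    by rewrite /= mul1r mulr1.
  by rewrite -tpureA /= cE.
pose F' := @BHom _ _ _ _ gg gD gl gr.
exists F, F'; split.
  apply: text => [u v|u v|m n]; rewrite ?bhD //.
  rewrite tens_homE /= /gg /ff -[m * _]/((m : Rb a) >* n) tpureA; congr tpure.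
  by rewrite /= mulr1.
by move=> h; rewrite [F' h]/(tpure _ _) tens_homE /ff rmorph1 mulr1.
Qed.

Section Conjugation.
Variables (A A' : comNzRingType) (i : {rmorphism A -> R}) (i' : {rmorphism A' -> R}).
Variables (y z : {rmorphism R -> R}) (yz : cancel z y) (zy : cancel y z).
Hypothesis iy : forall a, exists a', i' a' = y (i a).
Hypothesis iz : forall a', exists a, i a = z (i' a').

Local Notation Re := (tens (ring_bimod idR i) (ring_bimod i idR)).
Local Notation Re' := (tens (ring_bimod idR i') (ring_bimod i' idR)).
Local Notation pu g h := (tpure (g : ring_bimod idR i) (h : ring_bimod i idR)).
Local Notation pu' g h := (tpure (g : ring_bimod idR i') (h : ring_bimod i' idR)).

(** F sends f (x) (g (x) h) to (f y(g) (x) y(h)) (x) 1. In the application A and A' are the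
    invariants of s and of r = y s y^-1, which y exchanges; this is the content of [iy] and [iz].
    The last clause follows the generators of C_s. *)
Lemma twist_conj : exists (F : bhom (tens (Rb y) Re) (tens Re' (Rb y)))
    (F' : bhom (tens Re' (Rb y)) (tens (Rb y) Re)),
  [/\ cancel F F', cancel F' F & forall f a g h : R,
     F (tpure (f : Rb y) (a *< (pu g 1 - pu 1 h))) =
     (f * y a) *< tpure (pu' (y g) 1 - pu' 1 (y h)) (1 : Rb y)].
Proof.
have mid' (u v w : R) a : i' a = w -> pu' (u * w) v = pu' u (w * v).
  by move=> <-; exact: (tpureA (u : ring_bimod idR i') a (v : ring_bimod i' idR)).
have mid (u v w : R) a : i a = w -> pu (u * w) v = pu u (w * v).
  by move=> <-; exact: (tpureA (u : ring_bimod idR i) a (v : ring_bimod i idR)).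
pose f1 (f : R) (g : ring_bimod idR i) (h : ring_bimod i idR) : tens Re' (Rb y) :=
  tpure (pu' (f * y g) (y h)) (1 : Rb y).
have f1b f : balanced (f1 f).
  split=> [g g' h|g h h'|g a h]; rewrite /f1.
  - by rewrite rmorphD mulrDr !tpureDl.
  - by rewrite rmorphD tpureDr tpureDl.
  - have [a' a'E] := iy a; rewrite /= !rmorphM /= mulrA.
    by rewrite (mid' _ _ _ _ a'E).
pose f2 (f : Rb y) (t : Re) : tens Re' (Rb y) := tens_rec (f1 f) t.
have f2E f g h : f2 f (pu g h) = tpure (pu' (f * y g) (y h)) (1 : Rb y).
  exact: (tens_rec_pure _ _ (f1b f)).
have f2Dr f t t' : f2 f (t + t') = f2 f t + f2 f t' by exact: (tens_recD (f1b f)).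
have f2Dl f f' t : f2 (f + f') t = f2 f t + f2 f' t.
  move: t; apply: tind => [g h|t t' ht ht']; last by rewrite !f2Dr ht ht' addrACA.
  by rewrite !f2E mulrDl !tpureDl.
have f2A (f : Rb y) (r : R) t : f2 (f >* r) t = f2 f (r *< t).
  move: t; apply: tind => [g h|t t' ht ht']; last by rewrite lmulDr !f2Dr ht ht'.
  by rewrite tpure_l !f2E /= rmorphM mulrA.
have f2b : balanced f2 by split.
have f2l (a : R) f t : f2 (a *< f) t = a *< f2 f t.
  move: t; apply: tind => [g h|t t' ht ht']; last by rewrite !f2Dr lmulDr ht ht'.
  by rewrite !f2E !tpure_l /= mulrA.
have one_r (c : R) : (1 : Rb y) >* c = (y c : R) *< (1 : Rb y) by rewrite /= mul1r mulr1.
have f2r f t (c : R) : f2 f (t >* c) = f2 f t >* c.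
  move: t; apply: tind => [g h|t t' ht ht']; last by rewrite rmulDl !f2Dr rmulDl ht ht'.
  by rewrite tpure_r !f2E tpure_r one_r -tpureA tpure_r /= rmorphM.
pose g1 (w : R) (u : ring_bimod idR i') (v : ring_bimod i' idR) : tens (Rb y) Re :=
  tpure (1 : Rb y) (pu (z u) (z (v * w))).
have g1b w : balanced (g1 w).
  split=> [u u' v|u v v'|u a v]; rewrite /g1.
  - by rewrite rmorphD tpureDl tpureDr.
  - by rewrite mulrDl rmorphD !tpureDr.
  - have [a' a'E] := iz a; rewrite /= -mulrA !rmorphM /=.
    by rewrite (mid _ _ _ _ a'E).
pose g2 (t : Re') (w : Rb y) : tens (Rb y) Re := tens_rec (g1 w) t.
have g2E u v w : g2 (pu' u v) w = tpure (1 : Rb y) (pu (z u) (z (v * w))).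
  exact: (tens_rec_pure _ _ (g1b w)).
have g2Dl t t' w : g2 (t + t') w = g2 t w + g2 t' w by exact: (tens_recD (g1b w)).
have g2Dr t w w' : g2 t (w + w') = g2 t w + g2 t w'.
  move: t; apply: tind => [u v|t t' ht ht']; last by rewrite !g2Dl ht ht' addrACA.
  by rewrite !g2E mulrDr rmorphD !tpureDr.
have g2A t (r : R) (w : Rb y) : g2 (t >* r) w = g2 t (r *< w).
  move: t; apply: tind => [u v|t t' ht ht']; last by rewrite rmulDl !g2Dl ht ht'.
  by rewrite tpure_r !g2E /= mulrA.
have g2b : balanced g2 by split.
have g2l (a : R) t w : g2 (a *< t) w = a *< g2 t w.
  move: t; apply: tind => [u v|t t' ht ht']; last by rewrite lmulDr !g2Dl lmulDr ht ht'.
  rewrite tpure_l !g2E [RHS]tpure_l.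
  have -> : a *< (1 : Rb y) = (1 : Rb y) >* z a by rewrite /= yz mulr1 mul1r.
  by rewrite tpureA tpure_l /= rmorphM.
have g2r t (w : Rb y) (c : R) : g2 t (w >* c) = g2 t w >* c.
  move: t; apply: tind => [u v|t t' ht ht']; last by rewrite !g2Dl rmulDl ht ht'.
  by rewrite !g2E !tpure_r /= mulrA rmorphM /= zy.
exists (tens_hom f2b f2l f2r), (tens_hom g2b g2l g2r); split.
- apply: tens_ext3r => [u v|u v|f g h]; rewrite ?bhD //.
  rewrite (tens_homE f2b) f2E tens_homE g2E mulr1 zy rmorphM zy.
  have -> : f = (1 : Rb y) >* z f by rewrite /= yz mul1r.
  by rewrite tpureA tpure_l /= yz mul1r.
- apply: tens_ext3l => [u v|u v|u v w]; rewrite ?bhD //.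
  rewrite (tens_homE g2b) g2E tens_homE f2E mul1r !yz.
  rewrite -[pu' u (v * w)](tpure_r (u : ring_bimod idR i') (v : ring_bimod i' idR) w) tpureA.
  by rewrite /= mulr1.
- move=> f a g h; rewrite tens_homE lmulDr lmulNr !tpure_l f2Dr.
  rewrite (additive_N (f2Dr f)) !f2E rmorph1 !rmorphM rmorph1 !mulr1.
  by rewrite lmulDr lmulNr !tpure_l tpureBl /= mulr1 mulrA.
Qed.

End Conjugation.
End TwistedBimodules.

Section Words.
Variables (k : idomainType) (W : groupType) (S : {pred W}) (D : realdata k S).
Hypotheses (sg : signed_system S) (pre : prerealization D).

Local Notation R := (Sym D).
Local Notation Q := (locQ D).
Local Notation idR := (idfun : {rmorphism R -> R}).
Local Notation SymGr := (@SymGr k W S D).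
Local Notation QGr := (@QGr k W S D).
Local Notation Cm := (Cmon D).
Local Notation iso := (@isomorphic Cm).

Let st := realization_setting sg pre.

(** Left generation is carried along to make the condition stable under tensor products. *)
Definition goodL (X : Cobj D) : Prop := goodD X /\ left_fg (lb_M X).

Lemma goodL_ten (X Y : Cobj D) : goodL X -> goodL Y -> goodL (lten X Y).
Proof. by move=> [gX fX] [gY fY]; split; [exact: (goodC_lten st)|exact: left_fg_tens]. Qed.
Lemma goodL_one : goodL (@munit Cm).
Proof. by split; [exact: goodC_lone st|exact: left_fg_regular]. Qed.
Lemma goodL_R w : goodL (R_obj D w).
Proof. by split; [exact: (goodD_two sg pre (presented_R pre w))|exact: left_fg_regular]. Qed.
Lemma goodL_C s : goodL (C_obj D s).
Proof. by split; [exact: (goodD_two sg pre (presented_C sg pre s))|exact: (left_fg_RRs sg pre)]. Qed.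

Lemma lgens_R w : lgens (X := R_obj D w) (fun v _ => v = w).
Proof.
move=> v e he; have [d [t [hd ht ed]]] := lgens_two_obj sg pre (presented_R pre w) he.
by exists d, t; split=> //; apply: addspan_mono ht => _ [a [m [-> _]]].
Qed.

Section Support.
Variable o : wset W.

Lemma goodL_Bs (L : o) s : goodL (Bs D L s).
Proof. by rewrite /Bs; case: asboolP => _; [exact: goodL_C|exact: goodL_R]. Qed.

Lemma goodL_Bw (L : o) u : goodL (Bw D L u).
Proof.
elim: u L => [|s u IH] L; first exact: goodL_one.
exact: (goodL_ten (goodL_Bs L s) (IH _)).
Qed.

Definition moves (L L' : o) (X : Cobj D) : Prop :=
  forall w e, @lb_piece _ _ _ _ X w e -> e <> 0 -> ws_act L w = L'.

Lemma moves_ten (L L' L'' : o) (X Y : Cobj D) :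
  moves L L' X -> moves L' L'' Y -> moves L L'' (lten X Y).
Proof.
move=> hX hY w e he ne.
have [_ [x [y [a [b [<- ha hb ->]]]]] ne'] := addspan_neq0 he ne.
rewrite ws_actM (hX _ _ ha); first apply: (hY _ _ hb).
  by move=> b0; apply: ne'; rewrite b0 tpure0r.
by move=> a0; apply: ne'; rewrite a0 tpure0l.
Qed.

Lemma moves_one (L : o) : moves L L (@munit Cm).
Proof. by move=> w e [->|-> //] _; rewrite ws_act1. Qed.

Lemma moves_two (L L' : o) (M : bimod R R) (gM : int -> M -> Prop) (G : W -> M -> Prop) :
  (forall w m, G w m -> m <> 0 -> ws_act L w = L') -> moves L L' (two_obj gM G).
Proof.
move=> h w e he ne.
have [_ [q [q' [m [hm ->]]]] ne'] := addspan_neq0 he ne.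
apply: h hm _ => m0; apply: ne'; rewrite m0 /twoE_in tpure0l tpure0r lmul0r.
exact: rmul0l.
Qed.

Lemma moves_Bs (L : o) s : moves L (ws_act L (val s)) (Bs D L s).
Proof.
rewrite /Bs; case: asboolP => e; apply: moves_two => w m; last by move=> ->.
by move/(Cs_genE sg pre) => h _; have [[-> _]|[-> _]] := h; rewrite ?ws_act1 ?e.
Qed.

Lemma moves_Bw (L : o) u : moves L (ws_act L (wprod u)) (Bw D L u).
Proof.
elim: u L => [|s u IH] L; first by rewrite /= ws_act1; exact: moves_one.
rewrite [wprod _]/= ws_actM.
exact: (@moves_ten _ _ _ (Bs D L s) (Bw D (ws_act L (val s)) u) (@moves_Bs L s) (IH _)).
Qed.

Lemma xi_xim (X : Cobj D) t : xi X t = xim X t.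
Proof.
move: t; apply: text => [x y|x y|m q]; [exact: bhD|exact: bhD|].
transitivity ((lb_loc X m : lb_E X) >* (q : Q)); last exact/esym/ximE.
by rewrite /xi tens_homE.
Qed.

Lemma in_C_goodD (L L' : o) (X : Cobj D) : in_C L L' X <-> goodD X /\ moves L L' X.
Proof.
split=> [[h1 h2 h3 [h4 h5] [[g xK Kx] h6]]|[[h1 h2 h3 h4 [[g xK Kx] h6]] h5]].
  split; last exact: h5.
  split; [exact: h1|exact: h2|exact: h3|exact: h4|split].
    by exists g => t; rewrite -xi_xim; [exact: xK|exact: Kx].
  by move=> i t ht; rewrite -xi_xim; exact: h6.
split; [exact: h1|exact: h2|exact: h3|split; [exact: h4|exact: h5]|split].
  by exists g => t; rewrite xi_xim; [exact: xK|exact: Kx].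
by move=> i t ht; rewrite xi_xim; exact: h6.
Qed.

Lemma Bw_cat (L : o) u v :
  iso (Bw D L (u ++ v)) (@ten Cm (Bw D L u) (Bw D (ws_act L (wprod u)) v)).
Proof.
elim: u L => [|s u IH] L.
  by rewrite [wprod _]/= ws_act1; exact: (isomorphic_sym (@isomorphic_lun Cm _)).
rewrite [wprod _]/= ws_actM.
apply: (@isomorphic_trans Cm _ (@ten Cm (Bs D L s) (@ten Cm (Bw D (ws_act L (val s)) u)
  (Bw D (ws_act (ws_act L (val s)) (wprod u)) v)))).
  exact: (@isomorphic_ten Cm _ _ _ _ (@isomorphic_refl Cm _) (IH _)).
exact: (isomorphic_sym (@isomorphic_assoc Cm _ _ _)).
Qed.

End Support.

Lemma iso_bhom (X Y : Cobj D) (f : bhom (lb_M X) (lb_M Y)) (f' : bhom (lb_M Y) (lb_M X))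
    (G : W -> lb_M X -> Prop) : goodL X -> goodL Y -> cancel f f' -> cancel f' f ->
  lgens G -> (forall w m, G w m -> lpart w (f m)) -> iso X Y.
Proof. by move=> gX gY; exact: (lgens_isomorphic st gX.1 gY.1). Qed.

Local Notation Rb w := (ring_bimod idR (Sact D w)).

Lemma lpart_ten (X Y : Cobj D) v w (m : lb_M X) (n : lb_M Y) :
  lpart v m -> lpart w n -> lpart (X := lten X Y) (v * w)%g (tpure m n).
Proof.
move=> hm hn; rewrite /lpart [lb_loc _ _]loc_tensE; apply: SpanG.
by exists v, w, (lb_loc X m : lb_E X), (lb_loc Y n : lb_E Y).
Qed.

Lemma iso_R1 : iso (R_obj D 1%g) (@munit Cm).
Proof.
have r1 (m : R) (b : R) : m * Sact D 1%g b = m * b by rewrite Sact1.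
pose f : bhom (Rb 1%g) (regular_bimod R) :=
  @BHom _ _ (Rb 1%g) (regular_bimod R) id (fun _ _ => erefl) (fun _ _ => erefl) r1.
pose f' : bhom (regular_bimod R) (Rb 1%g) :=
  @BHom _ _ (regular_bimod R) (Rb 1%g) id (fun _ _ => erefl) (fun _ _ => erefl)
    (fun m b => esym (r1 m b)).
apply: (iso_bhom (X := R_obj D 1%g) (Y := @munit Cm) (f := f) (f' := f')
  (goodL_R _) goodL_one _ _ (@lgens_R _)) => // w m ->.
by left.
Qed.

Lemma iso_RR x y : iso (@ten Cm (R_obj D x) (R_obj D y)) (R_obj D (x * y)%g).
Proof.
have [F [F' [FK F'K]]] := twist_comp (SactM pre x y).
have gR := goodL_ten (goodL_R x) (goodL_R y).
apply: (iso_bhom (X := lten (R_obj D x) (R_obj D y)) (Y := R_obj D (x * y)%g)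
  (f := F) (f' := F') gR (goodL_R _) FK F'K
  (lgens_lten st (goodL_R y).1 (@lgens_R x) (@lgens_R y) _)) => //.
by move=> w t [u [v [m [n [<- -> -> _]]]]]; exact: lpart_two_obj.
Qed.

End Words.

Section PresentedParts.
Variables (R Q : comNzRingType) (iota : {rmorphism R -> Q}) (W : groupType).
Variables (act : W -> {rmorphism R -> R}).
Variables (grR : int -> R -> Prop) (grQ : int -> Q -> Prop).
Hypothesis st : setting iota act grR grQ.
Variables (X : lbimod iota W) (gX : goodC act grR grQ X).

Lemma lspan_lpart w m : lspan (@lpart _ _ _ _ X) w m <-> lpart w m.
Proof.
split=> [|h]; last by apply: SpanG; exists 1, m; rewrite lmul1.
by apply: lpart_span => _ [a [n [hn ->]]]; exact: lpart_l.
Qed.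

Lemma lpart_indep (s : seq W) (n : W -> lb_M X) : uniq s -> (forall w, lpart w (n w)) ->
  \sum_(w <- s) n w = 0 -> forall w, w \in s -> n w = 0.
Proof.
move=> us hn e w ws; apply: (loc_eq0 st gX); have [_ _ _ ind] := good_dpiece gX.
apply: (ind s (fun w => lb_loc X (n w) : lb_E X) us hn _ w ws).
by rewrite -(big_morph (lb_loc X) (bhD _) (bh0 _)) e bh0.
Qed.

Lemma lpart_twist w m f : lpart (X := X) w m -> m >* f = act w f *< m.
Proof. by move=> h; apply: (loc_inj st gX); rewrite bhr bhl; exact: (good_twist gX). Qed.

(** A good object is presented by its own parts, so its bimodule can be localized anew, for another
    group and other denominators. *)
Lemma presented_lpart : presented iota act grR (@lb_gr _ _ _ _ X) (@lpart _ _ _ _ X).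
Proof.
have [[grX fgX flX] [grEX dX subX] twX [sX sXP] [bX _]] := gX.
split=> //.
- by move=> w m f; exact: lpart_twist.
- exists sX => w m hm m0; apply: sXP hm _ => e; apply: m0; exact: (loc_eq0 st gX).
- move=> m; have [d [hd h]] := lpart_decomp st gX m; exists d; split=> //.
  by apply: addspan_mono h => t [w hw]; exists w; exact/lspan_lpart.
- by move=> s n us hn; apply: lpart_indep => // w; exact/lspan_lpart.
- have [dM _ _] := grX; have [dE _ _] := grEX.
  move=> w m hm; rewrite [m](dcomp_sum dM).
  elim/big_ind: _ => [|x y|i _]; [exact: Span0|exact: addspanD|apply: SpanG].
  split; last by exists i; exact: dcompP.
  rewrite /lpart -(dcomp_map dM dE (bhD (lb_loc X)) (@loc_gr _ _ _ _ _ _ _ st _ gX)).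
  apply: (dcomp_graded_sub dE _ _ _ (subX w) hm); [exact: piece_0|exact: pieceB].
Qed.

Lemma lpart_lgens_unit G w m : lgens G -> lpart w m ->
  exists d, lunit iota d /\ addspan (G w) (m >* d :> lb_M X).
Proof.
move=> hG hm; have [d [t [hd ht e]]] := hG _ _ hm; exists d; split=> //.
by rewrite (_ : m >* d = t) //; apply: (loc_inj st gX); rewrite bhr.
Qed.

End PresentedParts.

(** * Passing from the neutral group to W *)

Section Transfer.
Variables (k : idomainType) (W : groupType) (S : {pred W}).
Variables (cox : coxeter_system S) (D : realdata k S) (pre : prerealization D).
Variables (o : wset W) (L : o).

Local Notation nG := (neutral_group L cox).
Local Notation nS := (neutral_gens cox L).
Local Notation D' := (endo_realdata cox D L).
Local Notation R := (Sym D).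
Local Notation goodE := (@goodL k nG nS D').

Let sg := coxeter_signed cox.
Let sg' := neutral_signed cox L.
Let pre' := endo_prerealization cox pre L.
Let st := realization_setting sg pre.
Let st' := realization_setting sg' pre'.

Section Push.
Variables (M : bimod R R) (gM : int -> M -> Prop) (G : nG -> M -> Prop).

Definition push_part (w : W) (m : M) : Prop := exists w' : nG, val w' = w /\ G w' m.

Lemma lspan_push w m : lspan push_part w m ->
  m = 0 \/ exists w' : nG, val w' = w /\ lspan G w' m.
Proof.
elim=> [|_ [a [n [[w' [<- hn]] ->]]]|x y _ [->|[w' [<- hx]]] _ [->|[v [e hy]]]].
- by left.
- by right; exists w'; split=> //; apply: SpanG; exists a, n.
- by left; rewrite subrr.
- right; exists v; split=> //; apply: SpanB hy; exact: Span0.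
- by right; exists w'; rewrite subr0.
- by right; exists w'; split=> //; move: hy; rewrite (val_inj e) => hy; exact: SpanB.
Qed.

Lemma lspan_push_in (w : nG) m : lspan G w m -> lspan push_part (val w) m.
Proof.
by apply: addspan_mono => _ [a [n [hn ->]]]; exists a, n; split=> //; exists w.
Qed.

Lemma presented_push : @presentedD k _ _ D' M gM G -> @presentedD k _ _ D M gM push_part.
Proof.
move=> [grM fgM flM tw [s hs] dense ind hom]; split=> //.
- by move=> _ m f [w [<- hm]]; rewrite -Sact_endo; exact: tw.
- by exists [seq val w | w <- s] => _ m [w [<- hm]] m0; apply: map_f; exact: hs hm m0.
- move=> m; have [d [hd h]] := dense m; exists d; split; first exact: lunit_endo hd.
  by apply: addspan_mono h => t [w hw]; exists (val w); exact: lspan_push_in.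
- move=> s' n us hn sum0 w ws.
  have [//|[w' [e _]]] := lspan_push (hn w).
  (* Only the indices in the neutral group matter: the terms at the others vanish. *)
  pose t := pmap (insub : W -> option nG) s'.
  have ht v : lspan G v (n (val v)).
    have [->|[u [/val_inj -> //]]] := lspan_push (hn (val v)); exact: Span0.
  have sumt : \sum_(v <- t) n (val v) = 0.
    transitivity (\sum_(v <- s') n v) => //.
    rewrite -(big_map val xpredT n) (pmap_filter (insubK _)) big_filter big_mkcond /=.
    apply: eq_bigr => v _; case: insubP => [//|/negP nv] /=.
    by have [->//|[u [eu _]]] := lspan_push (hn v); case: nv; rewrite -eu; exact: (valP u).
  have ut : uniq t by exact: pmap_sub_uniq.
  rewrite -e; apply: (ind t (fun v => n (val v)) ut ht sumt w' _).
  by rewrite mem_pmap_sub e.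
- move=> _ m [w [<- hm]]; apply: addspan_mono (hom _ _ hm) => t [ht gt].
  by split=> //; exists w.
Qed.

End Push.

Section Pull.
Variables (M : bimod R R) (gM : int -> M -> Prop) (G : W -> M -> Prop).

Definition pull_part (w : nG) : M -> Prop := G (val w).

(** Density is the one property that is not inherited, because fewer denominators are available over
    the neutral group; it is therefore assumed. *)
Lemma presented_pull : @presentedD k _ _ D M gM G ->
  (forall m, exists d : R, lunit (toQ D') d /\
    addspan (fun t => exists w : nG, lspan G (val w) t) (m >* d)) ->
  @presentedD k _ _ D' M gM pull_part.
Proof.
move=> [grM fgM flM tw [s hs] dense ind hom] dense'; split=> //.
- by move=> w m f hm; rewrite Sact_endo; exact: tw.
- exists (pmap insub s) => w m hm m0; rewrite mem_pmap_sub; exact: hs hm m0.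
- move=> s' n us hn sum0 w ws.
  pose n' v := if insub v is Some u then n u else 0.
  have n'E v : n' (val v) = n v by rewrite /n' valK.
  rewrite -n'E; apply: (ind [seq val w | w <- s'] n').
  + by rewrite map_inj_uniq //; exact: val_inj.
  + move=> v; rewrite /n'; case: insubP => [u _ <-|_]; [exact: hn|exact: Span0].
  + by rewrite big_map -[RHS]sum0; apply: eq_bigr => v _; exact: n'E.
  + exact: map_f.
- by move=> w m hm; exact: hom.
Qed.

End Pull.

(* The pieces are extended by 0 outside of the neutral group, and the remaining
   roots are inverted. *)
Definition push (X : Cobj D') : Cobj D :=
  @two_obj k W S D (lb_M X) (@lb_gr _ _ _ _ X) (push_part (@lpart _ _ _ _ X)).

Section PushObject.
Variables (X : Cobj D') (gX : goodE X).

Lemma push_presented :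
  @presentedD k _ _ D (lb_M X) (@lb_gr _ _ _ _ X) (push_part (@lpart _ _ _ _ X)).
Proof. exact: presented_push (presented_lpart st' gX.1). Qed.

Lemma goodL_push : goodL (push X).
Proof. by split; [exact: (goodD_two sg pre push_presented)|case: gX]. Qed.

Lemma lpart_push_in (w : nG) (m : lb_M X) : lpart w m -> lpart (X := push X) (val w) m.
Proof. by move=> h; apply: lpart_two_obj; exists w. Qed.

(** Inverting more roots adds nothing to the parts. For some denominator d of W, the element m d is
    0 or lies in a part of X, and right multiplication by d is injective on M and then on the
    localization of X. So the other components of m, killed by d, vanish. *)
Lemma lpart_push w (m : lb_M X) : lpart (X := push X) w m ->
  m = 0 \/ exists w' : nG, val w' = w /\ lpart w' m.
Proof.
move=> hm; have gF := goodL_push.1.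
have [d [hd hmd]] := lpart_lgens_unit st gF (lgens_two_obj sg pre push_presented) hm.
have rinj (n : lb_M X) : n >* d = 0 -> n = 0.
  move=> e; apply: (loc_eq0 st gF); have [c dc] := hd; apply: (rmul_inj dc).
  rewrite rmul0l -[LHS](bhr (lb_loc (push X))) (_ : n >* d = 0) ?bh0 //.
have [/rinj|[w' [e hw]]] := lspan_push hmd; first by left.
right; exists w'; split=> //; have {}hw := (lspan_lpart _ _).1 hw.
have dX := good_dpiece gX.1.
(* Injectivity passes from M to the localization of X by clearing denominators of the neutral
   group. *)
have xinj (x : lb_E X) : x >* toQ D' d = 0 -> x = 0.
  move=> e0; have [n [c [[c' cc] xc]]] := loc_frac st' gX.1 x.
  apply: (rmul_inj cc); rewrite rmul0l xc.
  suff -> : n = 0 by rewrite bh0.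
  apply: rinj; apply: (loc_eq0 st' gX.1).
  have h : lb_loc X (n >* d) = (lb_loc X n : lb_E X) >* toQ D' d by exact: bhr.
  by rewrite [LHS]h -xc rmulC e0 rmul0l.
pose x : lb_E X := lb_loc X m.
have hxd : lb_piece w' (x >* toQ D' d) by move: hw; rewrite /lpart bhr.
suff E : x = dcomp dX x w' by rewrite /lpart -/x E; exact: dcompP.
apply/eqP; rewrite -subr_eq0; apply/eqP/xinj; rewrite rmulDl rmulNl.
have rD : forall y z : lb_E X, (y + z) >* toQ D' d = y >* toQ D' d + z >* toQ D' d.
  by move=> y z; exact: rmulDl.
rewrite -(dcomp_map dX dX rD); last by move=> v y; exact: piece_r.
by rewrite (dcomp_hom dX _ hxd) eqxx subrr.
Qed.

Lemma lpart_push_iff (w : nG) (m : lb_M X) :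
  lpart (X := push X) (val w) m <-> lpart (X := X) w m.
Proof.
split=> [/lpart_push[->|[v [/val_inj -> //]]]|]; [exact: lpart0|exact: lpart_push_in].
Qed.

End PushObject.

Section PushMap.
Variables (X Y : Cobj D') (gX : goodE X).

Lemma push_cond (f : lhom X Y) : @lhom_cond _ _ (toQ D) W (push X) (push Y) (sval f).
Proof.
apply: (lhom_cond_lgens st (goodL_push gX).1 (lgens_two_obj sg pre (push_presented gX))).
move=> w _ [a [m [[v [<- hm]] ->]]].
rewrite bhl; apply: lpart_l; apply: lpart_two_obj; exists v; split=> //.
exact: (@lhom_lpart _ _ _ _ X Y f v m hm).
Qed.

Hypothesis gY : goodE Y.

(** This gives fullness: the parts before and after the extension agree by [lpart_push_iff]. *)
Lemma pull_cond (f : lhom (push X) (push Y)) : @lhom_cond _ _ (toQ D') nG X Y (sval f).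
Proof.
apply: (lhom_cond_lgens st' gX.1 (lgens_lpart st' gX.1)) => w m hm.
apply/(lpart_push_iff gY); apply: (@lhom_lpart _ _ _ _ (push X) (push Y) f).
exact: lpart_push_in.
Qed.

End PushMap.

Local Notation loneD := (lone (toQ D) W (@SymGr k W S D) (@QGr k W S D)).
Local Notation loneE := (lone (toQ D') nG (@SymGr k _ nS D') (@QGr k _ nS D')).

Lemma push_one_cond : @lhom_cond _ _ (toQ D) W loneD (push loneE) (bhid _).
Proof.
apply: (lhom_cond_lgens st (goodL_one sg pre).1 (lgens_lone st)) => w m ->.
by apply: lpart_two_obj; exists 1%g; split=> //; left.
Qed.

Lemma push_one_condi : @lhom_cond _ _ (toQ D) W (push loneE) loneD (bhid _).
Proof.
pose f : lhom loneD (push loneE) := exist _ _ push_one_cond.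
exact: (@lhom_cond_inv _ _ _ _ _ _ _ st _ _ f (bhid _) (goodL_one sg pre).1 (goodL_push (goodL_one sg' pre')).1).
Qed.

Section PushTensor.
Variables (X Y : Cobj D') (gX : goodE X) (gY : goodE Y).

Lemma push_ten_cond :
  @lhom_cond _ _ (toQ D) W (lten (push X) (push Y)) (push (lten X Y)) (bhid _).
Proof.
have lX := lgens_two_obj sg pre (push_presented gX).
have lY := lgens_two_obj sg pre (push_presented gY).
have gXY := goodL_ten sg pre (goodL_push gX) (goodL_push gY).
apply: (lhom_cond_lgens st gXY.1 (lgens_lten st (goodL_push gY).1 lX lY _)).
- move=> w _ b [a [m [[v [<- hm]] ->]]]; exists (a * Sact D (val v) b), m.
  have hv : push_part (@lpart _ _ _ _ Y) (val v) m by exists v.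
  by split=> //; rewrite lrmulA (pr_twist (push_presented gY) b hv) lmulA.
- move=> w _ [x [y [m [n [<- [a [m' [[v [<- hm]] ->]]] [b [n' [[u [<- hn]] ->]]] ->]]]]].
  apply: lpart_two_obj; exists (v * u)%g; split=> //.
  rewrite /lpart [lb_loc _ _]loc_tensE; apply: SpanG.
  exists v, u, (lb_loc X (a *< m') : lb_E X), (lb_loc Y (b *< n') : lb_E Y).
  by split=> //; [exact: lpart_l hm|exact: lpart_l hn].
Qed.

Lemma push_ten_condi :
  @lhom_cond _ _ (toQ D) W (push (lten X Y)) (lten (push X) (push Y)) (bhid _).
Proof.
pose f : lhom (lten (push X) (push Y)) (push (lten X Y)) := exist _ _ push_ten_cond.
exact: (@lhom_cond_inv _ _ _ _ _ _ _ st _ _ f (bhid _)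
  (goodL_ten sg pre (goodL_push gX) (goodL_push gY)).1 (goodL_push (goodL_ten sg' pre' gX gY)).1).
Qed.

End PushTensor.
End Transfer.

Section Evaluation.
Variables (k : idomainType) (W : groupType) (S : {pred W}) (D : realdata k S).
Local Notation Cm := (Cmon D).

Lemma cmpE (X Y Z : Cm) (g : hom Y Z) (f : hom X Y) m :
  sval (g \oc f) m = sval g (sval f m).
Proof. by []. Qed.
Lemma tmapE (X X' Y Y' : Cm) (f : hom X X') (g : hom Y Y') m n :
  sval (@tmap Cm _ _ _ _ f g) (tpure m n) = tpure (sval f m) (sval g n).
Proof. exact: tens_mapE. Qed.
Lemma massocE (X Y Z : Cm) (m : lb_M X) (n : lb_M Y) (p : lb_M Z) :
  sval (@massoc Cm X Y Z) (tpure (tpure m n : lb_M (@ten Cm X Y)) p) =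
    tpure m (tpure n p : lb_M (@ten Cm Y Z)).
Proof. exact: tassocE. Qed.
Lemma mlunE (X : Cm) (r : lb_M (@munit Cm)) (m : lb_M X) :
  sval (@mlun Cm X) (tpure r m) = (r : Sym D) *< m.
Proof. exact: tlunE. Qed.
Lemma mrunE (X : Cm) (m : lb_M X) (r : lb_M (@munit Cm)) :
  sval (@mrun Cm X) (tpure m r) = m >* (r : Sym D).
Proof. exact: trunE. Qed.
End Evaluation.

(** * The extension as a monoidal functor *)

Section PushFunctor.
Variables (k : idomainType) (W : groupType) (S : {pred W}).
Variables (cox : coxeter_system S) (D : realdata k S) (pre : prerealization D).
Variables (o : wset W) (L : o).

Local Notation D' := (endo_realdata cox D L).
Local Notation goodE := (@goodL k _ _ D').
Local Notation Cm := (Cmon D).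
Local Notation Cm' := (Cmon D').

Definition push_map (X Y : Cm') (gX : goodE X) (f : hom X Y) :
    @hom Cm (push X) (push Y) :=
  exist _ _ (push_cond pre gX f).

Lemma push_map1 (X : Cm') (gX : goodE X) :
  push_map gX (idc X) = idc (push X : Cm).
Proof. by apply: lhomP => m; change (m = m). Qed.

Lemma push_mapE (X Y : Cm') (gX : goodE X) (f : hom X Y) (m : lb_M X) :
  sval (push_map gX f) m = sval f m.
Proof. by []. Qed.

Lemma push_mapM (X Y Z : Cm') (gX : goodE X) (gY : goodE Y) (g : hom Y Z) (f : hom X Y) :
  push_map gX (g \oc f) = push_map gY g \oc push_map gX f.
Proof.
apply: lhomP => m.
exact: etrans (push_mapE gX (g \oc f) m) (etrans (cmpE g f m)
  (esym (etrans (cmpE (push_map gY g) (push_map gX f) m)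
   (push_mapE gY g (sval f m))))).
Qed.

Definition push_mu (X Y : Cm') (gX : goodE X) (gY : goodE Y) :
    @hom Cm (@ten Cm (push X) (push Y)) (push (@ten Cm' X Y)) :=
  exist _ _ (push_ten_cond pre gX gY).
Definition push_eps : @hom Cm (@munit Cm) (push (@munit Cm')) :=
  exist _ _ (push_one_cond cox pre L).

Lemma push_mu_iso (X Y : Cm') (gX : goodE X) (gY : goodE Y) :
  exists mui, inverse (push_mu gX gY) mui.
Proof. by exists (exist _ _ (push_ten_condi pre gX gY)); split; apply: lhomP. Qed.

Lemma push_eps_iso : exists epsi, inverse push_eps epsi.
Proof. by exists (exist _ _ (push_one_condi cox pre L)); split; apply: lhomP. Qed.

Lemma push_mu_nat (X X' Y Y' : Cm') (gX : goodE X) (gX' : goodE X') (gY : goodE Y)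
    (gY' : goodE Y') (gXY : goodE (@ten Cm' X Y)) (f : hom X X') (g : hom Y Y') :
  push_mu gX' gY' \oc @tmap Cm _ _ _ _ (push_map gX f) (push_map gY g) =
  push_map gXY (@tmap Cm' _ _ _ _ f g) \oc push_mu gX gY.
Proof.
apply: lhomP; apply: text => [x y|x y|m n]; [exact: bhD|exact: bhD|].
apply: etrans (etrans (cmpE (push_mu gX' gY') _ _) (tmapE (push_map gX f) (push_map gY g) m n)) _.
apply: esym; apply: etrans (cmpE (push_map gXY _) (push_mu gX gY) (tpure m n)) _.
exact: etrans (push_mapE gXY (@tmap Cm' _ _ _ _ f g) (tpure m n)) (tmapE f g m n).
Qed.

Section Coherence.
Variables (X Y Z : Cm') (gX : goodE X) (gY : goodE Y) (gZ : goodE Z).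
Variables (gXY : goodE (@ten Cm' X Y)) (gYZ : goodE (@ten Cm' Y Z)).
Variables (gXYZ : goodE (@ten Cm' (@ten Cm' X Y) Z)) (g1 : goodE (@munit Cm')).
Variables (g1X : goodE (@ten Cm' munit X)) (gX1 : goodE (@ten Cm' X munit)).

(** The goodness proofs of the tensor products are parameters because they occur inside the
    morphisms; the identity then applies to the proofs that the objects of the block carry. *)
Lemma push_mu_assoc :
  push_map gXYZ (@massoc Cm' X Y Z) \oc push_mu gXY gZ \oc
    @tmap Cm _ _ _ _ (push_mu gX gY) (idc (push Z : Cm)) =
  push_mu gX gYZ \oc @tmap Cm _ _ _ _ (idc (push X : Cm)) (push_mu gY gZ) \oc
    @massoc Cm (push X) (push Y) (push Z).
Proof.
apply: lhomP; apply: tens_ext3l => [x y|x y|m n p]; [exact: bhD|exact: bhD|].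
pose t : lb_M (@ten Cm (@ten Cm (push X) (push Y)) (push Z)) := tpure (tpure m n) p.
apply: etrans (cmpE (push_map gXYZ (@massoc Cm' X Y Z) \oc push_mu gXY gZ)
  (@tmap Cm _ _ _ _ (push_mu gX gY) (idc (push Z : Cm))) t) _.
apply: etrans (congr1 (sval (push_map gXYZ (@massoc Cm' X Y Z) \oc push_mu gXY gZ)) (tmapE (push_mu gX gY) (idc (push Z : Cm)) (tpure m n) p)) _.
apply: etrans (cmpE (push_map gXYZ (@massoc Cm' X Y Z)) (push_mu gXY gZ) t) _.
apply: etrans (push_mapE gXYZ (@massoc Cm' X Y Z) (tpure (tpure m n) p)) _.
apply: etrans (@massocE _ _ _ D' X Y Z m n p) _; apply: esym.
apply: etrans (cmpE (push_mu gX gYZ \oc @tmap Cm _ _ _ _ (idc (push X : Cm)) (push_mu gY gZ))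
  (@massoc Cm (push X) (push Y) (push Z)) t) _.
apply: etrans (congr1 (sval (push_mu gX gYZ \oc @tmap Cm _ _ _ _ (idc (push X : Cm)) (push_mu gY gZ))) (@massocE _ _ _ D (push X) (push Y) (push Z) m n p)) _.
apply: etrans (cmpE (push_mu gX gYZ)
  (@tmap Cm _ _ _ _ (idc (push X : Cm)) (push_mu gY gZ)) _) _.
exact: (tmapE (idc (push X : Cm)) (push_mu gY gZ) m (tpure n p)).
Qed.

Lemma push_mu_lun :
  push_map g1X (@mlun Cm' X) \oc push_mu g1 gX \oc
    @tmap Cm _ _ _ _ push_eps (idc (push X : Cm)) = @mlun Cm (push X).
Proof.
apply: lhomP; apply: text => [x y|x y|r m]; [exact: bhD|exact: bhD|].
apply: etrans (cmpE (push_map g1X (@mlun Cm' X) \oc push_mu g1 gX)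
  (@tmap Cm _ _ _ _ push_eps (idc (push X : Cm))) (tpure r m)) _.
apply: etrans (congr1 (sval (push_map g1X (@mlun Cm' X) \oc push_mu g1 gX)) (tmapE push_eps (idc (push X : Cm)) r m)) _.
apply: etrans (cmpE (push_map g1X (@mlun Cm' X)) (push_mu g1 gX) (tpure r m)) _.
apply: etrans (push_mapE g1X (@mlun Cm' X) (tpure r m)) _.
apply: etrans (@mlunE _ _ _ D' X r m) _.
exact: esym (@mlunE _ _ _ D (push X) r m).
Qed.

Lemma push_mu_run :
  push_map gX1 (@mrun Cm' X) \oc push_mu gX g1 \oc
    @tmap Cm _ _ _ _ (idc (push X : Cm)) push_eps = @mrun Cm (push X).
Proof.
apply: lhomP; apply: text => [x y|x y|m r]; [exact: bhD|exact: bhD|].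
apply: etrans (cmpE (push_map gX1 (@mrun Cm' X) \oc push_mu gX g1)
  (@tmap Cm _ _ _ _ (idc (push X : Cm)) push_eps) (tpure m r)) _.
apply: etrans (congr1 (sval (push_map gX1 (@mrun Cm' X) \oc push_mu gX g1)) (tmapE (idc (push X : Cm)) push_eps m r)) _.
apply: etrans (cmpE (push_map gX1 (@mrun Cm' X)) (push_mu gX g1) (tpure m r)) _.
apply: etrans (push_mapE gX1 (@mrun Cm' X) (tpure m r)) _.
apply: etrans (@mrunE _ _ _ D' X m r) _.
exact: esym (@mrunE _ _ _ D (push X) m r).
Qed.

End Coherence.
End PushFunctor.

(** The constant i a is moved across the tensor sign in the second term. This serves to rescale
    delta in a generator of C_r. *)
Lemma tens_unit_scale (A R : comNzRingType) (i : {rmorphism A -> R}) (a : A) (c x z : R) :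
  i a * c = 1 ->
  let pu g h := tpure (g : ring_bimod (idfun : {rmorphism R -> R}) i)
                      (h : ring_bimod i (idfun : {rmorphism R -> R})) in
  pu x 1 - pu 1 z = (i a : R) *< (pu (c * x) 1 - pu 1 (c * z)).
Proof.
move=> ac pu; rewrite lmulDr lmulNr !tpure_l /= mulrA ac mul1r; congr (_ - _).
have -> : (i a * 1 : R) = (1 : ring_bimod idfun i) >* a by rewrite /= mulrC.
by rewrite tpureA /= mulrA ac mul1r.
Qed.

(** * Conjugating C_s into C_r *)

Section Conjugates.
Variables (k : idomainType) (W : groupType) (S : {pred W}).
Variables (cox : coxeter_system S) (D : realdata k S) (pre : prerealization D).
Variables (o : wset W) (L : o).

Local Notation nG := (neutral_group L cox).
Local Notation nS := (neutral_gens cox L).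
Local Notation D' := (endo_realdata cox D L).
Local Notation goodE := (@goodL k _ _ D').
Local Notation R := (Sym D).
Local Notation dual := 'Hom(hspace D, k^o).
Local Notation iso := (@isomorphic (Cmon D)).
Local Notation push := (push (cox:=cox) (D:=D) (L:=L)).

Let sg := coxeter_signed cox.
Let sg' := neutral_signed cox L.
Let pre' := endo_prerealization cox pre L.
Let st := realization_setting sg pre.

Section Conjugation.
Variables (y : W) (s : gens S) (r : gens nS).
Hypothesis rE : val (val r) = (y * val s * y^-1)%g.

(** Both pairs of root and coroot write 1 - r as the same rank-one map. Each root takes the value 1
    somewhere, so each coroot is a multiple of the other; a linear form with value 1 on a coroot
    shows that the two constants are inverse to each other. *)
Lemma conj_coroot : exists c c' : k, c * c' = 1 /\
  hact D y (coroot D s) = c *: coroot D' r.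
Proof.
pose a : dual := wdual y (root D s); pose av := hact D y (coroot D s).
pose b : dual := root D' r; pose bv : hspace D := coroot D' r.
have E v : (a v : k) *: av = (b v : k) *: bv.
  have e1 : hact D' (val r) v = v - (b v : k) *: bv by exact: (hact_gen pre').
  have e2 : hact D' (val r) v = v - (a v : k) *: av.
    rewrite -[hact D' _]/(hact D (val (val r))) rE !(hactM pre) !comp_lfunE (hact_gen pre).
    by rewrite linearB linearZ /= (hactKV pre); congr (_ - _ *: _).
  by apply/oppr_inj/(addrI v); rewrite -e1 -e2.
have [v bv1] := root_surj pre' r 1; have [u au] := root_surj pre s 1.
have a1 : a (hact D y u) = 1 by rewrite /a wdualE (hactVK pre).
have avE : av = (b (hact D y u) : k) *: bv by rewrite -E a1 scale1r.
have bvE : bv = (a v : k) *: av by rewrite E [b v]bv1 scale1r.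
have [l l1] := coroot_surj pre s 1.
exists (b (hact D y u)), (a v); split=> //.
have : (wdual y l : dual) av = 1 by rewrite wdualE (hactVK pre).
rewrite {1}avE bvE scalerA linearZ /= wdualE (hactVK pre) l1.
by rewrite -[_ *: _]/(_ * _) mulr1.
Qed.

Local Notation dl := (lin (lam pre s) : R).
Local Notation "f \ot g" := (@RRs_pure k nG nS D' (val r) (f : R) (g : R)) (at level 40).

Lemma Sact_conj (f : R) : Sact D' (val r) (Sact D y f) = Sact D y (Sact D (val s) f) :> R.
Proof.
have e : (val (val r) * y = y * val s)%g by rewrite rE mulgVK.
rewrite Sact_endo.
exact: etrans (esym (SactM pre _ _ f)) (etrans (congr1 (fun w => Sact D w f) e) (SactM pre _ _ f)).
Qed.

Local Notation pd f g := ((f \ot 1 : RRs D' (val r)) - (1 \ot g : RRs D' (val r)) : RRs D' (val r)).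

(** Conjugation produces y delta, whose value on the coroot of r is c^-1 rather than 1. Rescaled by
    c it becomes admissible in [Cs_gen], and the constant is absorbed by the left action. *)
Lemma conj_parts :
  @lpart _ _ _ _ (C_obj D' r) 1%g (pd (Sact D y dl) (Sact D y (Sact D (val s) dl))) /\
  @lpart _ _ _ _ (C_obj D' r) (val r) (pd (Sact D y dl) (Sact D y dl)).
Proof.
have [c [c' [cc' cE]]] := conj_coroot.
pose d : dual := c *: wdual y (lam pre s).
have d1 : d (coroot D' r) = 1.
  have e : (wdual y (lam pre s) : dual) (hact D y (coroot D s)) = 1.
    by rewrite wdualE (hactVK pre); exact: (lamE pre s).
  by rewrite cE linearZ in e; rewrite scale_lfunE.
pose cR : R := c%:MP; pose cR' : R := c'%:MP.
have cR1 : cR' * cR = 1 by rewrite /cR' /cR -mpolyCM mulrC cc' mpolyC1.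
have dE : lin d = cR * Sact D y dl :> R.
  by rewrite Sact_lin /cR mul_mpolyC; exact: (linZ (D := D)).
have inv g : Sact D' (val r) (cR * g) = cR * Sact D' (val r) g :> R.
  apply: etrans (rmorphM (Sact D' (val r)) cR g) _.
  by congr (_ * _); exact: (SactC D').
have ia : Sact D' (val r) cR' == cR' :> R by apply/eqP; exact: (SactC D').
pose a : invR D' (val r) := exist _ cR' ia.
have gen v m : Cs_gen (D := D') (s := r) v m -> lpart (X := C_obj D' r) v m.
  exact: lpart_two_obj.
split.
- have -> : pd (Sact D y dl) (Sact D y (Sact D (val s) dl)) =
      cR' *< pd (lin d : R) (Sact D' (val r) (lin d : R)).
    rewrite -Sact_conj dE inv.
    exact: (tens_unit_scale (i := invR_val D' (val r)) (a := a) (c := cR) _ _ cR1).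
  apply: lpart_l; apply: gen; exists d; split=> //; left; split=> //.
- have -> : pd (Sact D y dl) (Sact D y dl) = cR' *< pd (lin d : R) (lin d : R).
    rewrite dE.
    exact: (tens_unit_scale (i := invR_val D' (val r)) (a := a) (c := cR) _ _ cR1).
  apply: lpart_l; apply: gen; exists d; split=> //; right; split=> //.
Qed.

Lemma iso_conj :
  iso (@ten (Cmon D) (R_obj D y) (C_obj D s)) (@ten (Cmon D) (push (C_obj D' r)) (R_obj D y)).
Proof.
have yz : cancel (Sact D y^-1%g) (Sact D y) by exact: (Sact_KV pre).
have zy : cancel (Sact D y) (Sact D y^-1%g) by exact: (Sact_VK pre).
have iy (a : invR D (val s)) : exists a' : invR D' (val r),
    invR_val D' (val r) a' = Sact D y (invR_val D (val s) a).
  have h0 : Sact D (val s) (sval a) = sval a by exact/eqP/(svalP a).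
  have h1 := etrans (Sact_conj _) (congr1 (Sact D y) h0).
  have h : Sact D' (val r) (Sact D y (sval a)) == Sact D y (sval a).
    exact: introT eqP h1.
  by exists (exist (fun f : Sym D' => Sact D' (val r) f == f) _ h).
have iz (a' : invR D' (val r)) : exists a : invR D (val s),
    invR_val D (val s) a = Sact D y^-1%g (invR_val D' (val r) a').
  have h : Sact D (val s) (Sact D y^-1%g (sval a')) == Sact D y^-1%g (sval a').
    have h0 : Sact D' (val r) (sval a') = sval a' by exact/eqP/(svalP a').
    apply/eqP; apply: (can_inj zy); apply: etrans (esym (Sact_conj _)) _.
    by rewrite yz h0.
  by exists (exist (fun f : Sym D => Sact D (val s) f == f) _ h).
have [F [F' [FK F'K FE]]] := twist_conj yz zy iy iz.
have gC : goodE (C_obj D' r) by exact: (goodL_C sg' pre').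
have gP := goodL_push pre gC.
have pC := presented_C sg pre s.
have gRC := goodL_ten sg pre (goodL_R sg pre y) (goodL_C sg pre s).
have gCR := goodL_ten sg pre gP (goodL_R sg pre y).
have [p1 ps] := conj_parts.
apply: (iso_bhom sg pre (X := lten (R_obj D y) (C_obj D s))
  (Y := lten (push (C_obj D' r)) (R_obj D y)) (f := F) (f' := F') gRC gCR FK F'K
  (lgens_lten st (goodL_C sg pre s).1 (@lgens_R _ _ _ _ sg pre y)
     (lgens_two_obj sg pre pC) _)).
  move=> w _ b [a [m [hm ->]]]; exists (a * Sact D w b), m.
  by split=> //; rewrite lrmulA (pr_twist pC b hm) lmulA.
move=> w _ [u [v [f [_ [<- -> [a [m [/(Cs_genE sg pre) hm ->]]] ->]]]]].
have one : lpart (X := R_obj D y) y (1 : R) by exact: lpart_two_obj.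
pose P w := @lpart _ _ _ _ (lten (push (C_obj D' r)) (R_obj D y)) w.
(* The parts on both sides are matched through y 1 = 1 y and y s = r y. *)
case: hm => -[-> ->].
- have -> : (y * 1 = val (1 : nG) * y)%g by rewrite mulg1 val_neutral1 mul1g.
  refine (eq_ind_r (P _) _ (FE f a dl (Sact D (val s) dl))); apply: lpart_l.
  apply: (fun h => lpart_ten (X := push (C_obj D' r)) (Y := R_obj D y) h one).
  exact: (lpart_push_in (X := C_obj D' r)).
- have -> : (y * val s = val (val r) * y)%g by rewrite rE mulgVK.
  refine (eq_ind_r (P _) _ (FE f a dl dl)); apply: lpart_l.
  apply: (fun h => lpart_ten (X := push (C_obj D' r)) (Y := R_obj D y) h one).
  exact: (lpart_push_in (X := C_obj D' r)).
Qed.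

End Conjugation.
End Conjugates.

(** * Reduction of words to the neutral group *)

Section NeutralWords.
Variables (k : idomainType) (W : groupType) (S : {pred W}).
Variables (cox : coxeter_system S) (D : realdata k S) (pre : prerealization D).
Variables (o : wset W) (L : o).

Local Notation nS := (neutral_gens cox L).
Local Notation D' := (endo_realdata cox D L).
Local Notation goodE := (@goodL k _ _ D').
Local Notation Cm := (Cmon D).
Local Notation iso := (@isomorphic (Cmon D)).
Local Notation push := (push (cox:=cox) (D:=D) (L:=L)).
Local Notation Bx := (Bx (cox:=cox) D (L:=L)).

Let sg := coxeter_signed cox.
Let sg' := neutral_signed cox L.
Let pre' := endo_prerealization cox pre L.

Lemma goodE_Bx x : goodE (Bx x).
Proof. exact: (goodL_Bw sg' pre'). Qed.

Lemma iso_push_one : iso (@munit Cm) (push (@munit (Cmon D'))).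
Proof. by have [e he] := push_eps_iso cox pre L; exists (push_eps cox pre L), e. Qed.

Lemma iso_push_ten (X Y : Cobj D') : goodE X -> goodE Y ->
  iso (@ten Cm (push X) (push Y)) (push (@ten (Cmon D') X Y)).
Proof.
by move=> gX gY; have [m hm] := push_mu_iso pre gX gY; exists (push_mu pre gX gY), m.
Qed.

Lemma Bx_cons r x : Bx (r :: x) = @ten (Cmon D') (C_obj D' r) (Bx x).
Proof. by rewrite /Bx /= {1}/Bs asboolT. Qed.

(* The letters moving the parameter are collected on the right, conjugating the
   others into generators of the neutral group. *)
Lemma Bw_conj (v u : seq (gens S)) : ellL_word L v = 0%N ->
  exists x : seq (gens nS), [/\ size x = ellL_word (ws_act L (wprod v)) u,
    (wprod v * wprod u = val (wprod x) * (wprod v * bword (ws_act L (wprod v)) u))%g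
    & iso (@ten Cm (R_obj D (wprod v)) (Bw D (ws_act L (wprod v)) u))
        (@ten Cm (push (Bx x)) (R_obj D (wprod v * bword (ws_act L (wprod v)) u)%g))].
Proof.
elim: u v => [|s u IH] v h.
  exists [::]; split; [by []|by rewrite val_neutral1 mul1g|].
  rewrite {1}/bword /= mulg1; apply: isomorphic_trans (@isomorphic_run Cm _) _.
  apply: isomorphic_trans (isomorphic_sym (@isomorphic_lun Cm _)) _.
  exact: (@isomorphic_ten Cm _ _ _ _ iso_push_one (isomorphic_refl _)).
have [e|ne] := pselect (ws_act (ws_act L (wprod v)) (val s) = ws_act L (wprod v)).
  have [r rE] := clean_conj_gen cox h e; have [x [sx xE xi]] := IH v h.
  have bE : bword (ws_act L (wprod v)) (s :: u) = bword (ws_act L (wprod v)) u.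
    by rewrite /bword /= asboolT //= e.
  exists (r :: x); rewrite bE; split.
  - by rewrite /ellL_word /= asboolT // e sx.
  - by rewrite /= rE -!mulgA -xE mulKg.
  rewrite /= {1}/Bs asboolT // e Bx_cons.
  apply: isomorphic_trans (isomorphic_sym (@isomorphic_assoc Cm _ _ _)) _.
  apply: isomorphic_trans (@isomorphic_ten Cm _ _ _ _ (iso_conj pre rE) (isomorphic_refl _)) _.
  apply: isomorphic_trans (@isomorphic_assoc Cm _ _ _) _.
  apply: isomorphic_trans (@isomorphic_ten Cm _ _ _ _ (isomorphic_refl _) xi) _.
  apply: isomorphic_trans (isomorphic_sym (@isomorphic_assoc Cm _ _ _)) _.
  apply: (@isomorphic_ten Cm _ _ _ _ _ (isomorphic_refl _)).
  exact: iso_push_ten (goodL_C sg' pre' r) (goodE_Bx x).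
have h' : ellL_word L (v ++ [:: s]) = 0%N.
  by rewrite ellL_word_cat h /ellL_word /= asboolF.
have vs : wprod (v ++ [:: s]) = (wprod v * val s)%g by rewrite wprod_cat /= mulg1.
have [x [sx xE xi]] := IH _ h'; rewrite vs ws_actM in sx xE xi.
have bE : bword (ws_act L (wprod v)) (s :: u) =
    (val s * bword (ws_act (ws_act L (wprod v)) (val s)) u)%g.
  by rewrite /bword /= asboolF.
exists x; rewrite bE; split.
- by rewrite sx /ellL_word /= asboolF.
- by rewrite !mulgA xE !mulgA.
have -> : Bw D (ws_act L (wprod v)) (s :: u) = @ten Cm (R_obj D (val s))
    (Bw D (ws_act (ws_act L (wprod v)) (val s)) u) by rewrite /= /Bs asboolF.
rewrite mulgA; apply: isomorphic_trans (isomorphic_sym (@isomorphic_assoc Cm _ _ _)) _.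
exact: isomorphic_trans (@isomorphic_ten Cm _ _ _ _ (iso_RR sg pre _ _) (isomorphic_refl _)) xi.
Qed.

Lemma Bw_neutral (u : seq (gens S)) : neutral S L (wprod u) -> exists x : seq (gens nS),
  [/\ size x = ellL_word L u, val (wprod x) = wprod u & iso (Bw D L u) (push (Bx x))].
Proof.
move=> /(neutral_wprod cox)[_ b]; have [x []] := @Bw_conj [::] u erefl.
rewrite /= ws_act1 b !mul1g mulg1 => sx xE xi; exists x; split=> //.
have i1 X := @isomorphic_ten Cm _ _ _ _ (iso_R1 sg pre) (isomorphic_refl X).
have i2 X := @isomorphic_ten Cm _ _ _ _ (isomorphic_refl X) (iso_R1 sg pre).
apply: isomorphic_trans (isomorphic_trans (isomorphic_trans _ xi) (i2 _)) (@isomorphic_run Cm _).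
apply: isomorphic_sym; exact: isomorphic_trans (i1 _) (@isomorphic_lun Cm _).
Qed.

(* A reduced word of a generator stays once, so it is sent to a single letter. *)
Lemma Bw_gen (r : gens nS) (e : seq (gens S)) : reduced e -> wprod e = val (val r) ->
  iso (Bw D L e) (push (C_obj D' r)).
Proof.
move=> red eE; have /asboolP[u [ru uE lu]] := valP r.
have le : ellL_word L e = 1%N by apply: (ellL_word1_reduced cox _ red lu); rewrite uE eE.
have ne : neutral S L (wprod e) by rewrite eE; apply/asboolP; exact: (svalP (val r)).
have [[|t [|t' x]] [sx xE xi]] := Bw_neutral ne; rewrite ?le // in sx.
have <- : t = r by do 2!apply: val_inj; rewrite -eE -xE /= mulg1.
apply: isomorphic_trans xi _; rewrite Bx_cons.
have gC : goodE (C_obj D' t) := goodL_C sg' pre' t.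
apply: isomorphic_trans (isomorphic_sym (iso_push_ten gC (goodE_Bx [::]))) _.
apply: isomorphic_trans _ (@isomorphic_run Cm _).
exact: (@isomorphic_ten Cm _ _ _ _ (isomorphic_refl _) (isomorphic_sym iso_push_one)).
Qed.

Lemma neutral_expands (x : seq (gens nS)) x' : expands x x' -> wprod x' = val (wprod x).
Proof.
move=> [v [sv -> h]]; elim: x v sv h => [|r x IH] [|e v] //= [sv] h.
have [_ [[<-] red eE]] := h 0%N r erefl.
by rewrite wprod_cat eE (IH v sv (fun i => h i.+1)).
Qed.

Lemma Bx_expands (x : seq (gens nS)) x' : expands x x' -> iso (push (Bx x)) (Bw D L x').
Proof.
move=> [v [sv -> h]]; elim: x v sv h => [|r x IH] [|e v] //=.
  by move=> _ _; exact: isomorphic_sym iso_push_one.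
move=> [sv] h; have [_ [[<-] red eE]] := h 0%N r erefl.
have Le : ws_act L (wprod e) = L.
  by rewrite eE; have /asboolP[] := svalP (val r).
apply: isomorphic_sym; apply: isomorphic_trans (Bw_cat D L _ _) _; rewrite Le Bx_cons.
apply: isomorphic_trans _ (iso_push_ten (goodL_C sg' pre' r) (goodE_Bx x)).
exact: (@isomorphic_ten Cm _ _ _ _ (Bw_gen red eE)
  (isomorphic_sym (IH v sv (fun i => h i.+1)))).
Qed.

Lemma expands_ex (x : seq (gens nS)) : exists x', expands x x'.
Proof.
have h (r : gens nS) : exists e : seq (gens S), reduced e /\ wprod e = val (val r).
  by have /asboolP[e [red eE _]] := valP r; exists e.
have [f fP] := choice h.
exists (flatten (map f x)), (map f x); split; rewrite ?size_map // => i r.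
by rewrite onth_map => -> /=; exists (f r); have [] := fP r.
Qed.

End NeutralWords.

(** * Direct sums and blocks *)

Section Biproducts.
Variables (k : idomainType) (W : groupType) (S : {pred W}) (D : realdata k S).

Local Notation Cm := (Cmon D).
Local Notation iso := (@isomorphic Cm).

Lemma biproduct_iso n (Y Y' : 'I_n -> Cm) (X X' : Cm) :
  (forall j, iso (Y j) (Y' j)) -> iso X X' -> is_biproduct Y X -> is_biproduct Y' X'.
Proof.
move=> hY [h [h' [hh hh']]] [i [p [ip off dec]]].
have hf j : {f : hom (Y j) (Y' j) & {f' : hom (Y' j) (Y j) | inverse f f'}}.
  by have [f /cid] := cid (hY j); exists f.
pose f j := projT1 (hf j); pose f' j := sval (projT2 (hf j)).
have fP j : inverse (f j) (f' j) by exact: svalP (projT2 (hf j)).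
exists (fun j => h \oc i j \oc f' j), (fun j => f j \oc p j \oc h'); split.
- move=> j; have [e1 e2] := fP j.
  rewrite -!cmpA (cmpA h' h) ?(cmpA h') hh ?cmp1l.
  by rewrite (cmpA (p j)) ip cmp1l e2.
- move=> j l jl y; pose y' : lb_M (Y j) := sval (f' j) y.
  have e x : sval h' (sval h x) = x by exact: (congr1 (fun g : hom X X => sval g x) hh).
  change (sval (f l) (sval (p l) (sval h' (sval h (sval (i j) y')))) = 0).
  rewrite e; have -> : sval (p l) (sval (i j) y') = 0 by exact: off.
  exact: bh0.
- move=> x; pose x' : lb_M X := sval h' x.
  have e : sval h x' = x by exact: (congr1 (fun g : hom X' X' => sval g x) hh').
  rewrite -[LHS]e [x' in LHS](dec x') (big_morph (sval h) (bhD _) (bh0 _)).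
  apply: eq_bigr => j _.
  change (sval h (sval (i j) (sval (p j) x')) =
    sval h (sval (i j) (sval (f' j) (sval (f j) (sval (p j) x'))))).
  congr (sval h (sval (i j) _)); have [e1 _] := fP j.
  by rewrite -[LHS](congr1 (fun g : hom (Y j) (Y j) => sval g (sval (p j) x')) e1).
Qed.

Lemma biproduct1 (X : Cm) : is_biproduct (fun _ : 'I_1 => X) X.
Proof.
exists (fun _ => idc X), (fun _ => idc X); split.
- by move=> j; rewrite cmp1l.
- by move=> j l; rewrite !ord1 eqxx.
- by move=> x; rewrite big_ord1.
Qed.

Lemma biproduct_ten n n' (Y : 'I_n -> Cm) (Y' : 'I_n' -> Cm) (X X' : Cm) :
  is_biproduct Y X -> is_biproduct Y' X' ->
  is_biproduct (fun j : 'I_#|{: 'I_n * 'I_n'}| =>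
    @ten Cm (Y (enum_val j).1) (Y' (enum_val j).2)) (@ten Cm X X').
Proof.
move=> [i [p [ip off dec]]] [i' [p' [ip' off' dec']]].
exists (fun j => @tmap Cm _ _ _ _ (i (enum_val j).1) (i' (enum_val j).2)).
exists (fun j => @tmap Cm _ _ _ _ (p (enum_val j).1) (p' (enum_val j).2)).
split.
- by move=> j; rewrite -tmapM ip ip' tmap1.
- move=> j l jl y; rewrite -tmapM.
  have : (enum_val j).1 != (enum_val l).1 \/ (enum_val j).2 != (enum_val l).2.
    apply/orP; rewrite -negb_and -xpair_eqE -!surjective_pairing.
    by rewrite (inj_eq enum_val_inj).
  move=> h; elim/tind: y => [m m'|x y hx hy]; last by rewrite bhD hx hy addr0.
  rewrite [LHS]tens_mapE; case: h => h.
    by rewrite off // tpure0l.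
  by rewrite off' // tpure0r.
- move=> x; elim/tind: x => [m m'|x y hx hy]; last first.
    rewrite {1}hx {1}hy -big_split; apply: eq_bigr => j _; exact/esym/bhD.
  rewrite {1}(dec m) {1}(dec' m') tpure_suml.
  under eq_bigr => j _ do rewrite tpure_sumr.
  rewrite pair_bigA.
  transitivity (\sum_(q in {: 'I_n * 'I_n'})
      (tpure (sval (i q.1 \oc p q.1) m) (sval (i' q.2 \oc p' q.2) m') :
        lb_M (@ten Cm X X'))); first exact: eq_bigl.
  rewrite big_enum_val; apply: eq_bigr => j _; rewrite -tmapM; exact/esym/tens_mapE.
Qed.

Lemma biproduct_left_fg n (Y : 'I_n -> Cm) (X : Cm) :
  (forall j, left_fg (lb_M (Y j))) -> is_biproduct Y X -> left_fg (lb_M X).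
Proof.
move=> hY [i [p [_ _ dec]]].
pose c j := sval (cid (hY j)); pose hc j := svalP (cid (hY j)).
pose g j := sval (cid (hc j)); have gP j := svalP (cid (hc j)).
pose T := {j : 'I_n & 'I_(c j)}.
exists #|{: T}|, (fun t => sval (i (tag (enum_val t))) (g _ (tagged (enum_val t)))) => m.
pose a j := sval (cid (gP j (sval (p j) m))); have aP j := svalP (cid (gP j (sval (p j) m))).
exists (fun t => a (tag (enum_val t)) (tagged (enum_val t))).
transitivity (\sum_(t in {: T})
    (a (tag t) (tagged t) *< (sval (i (tag t)) (g _ (tagged t)) : lb_M X))).
  transitivity (\sum_(t : T | true && true)
    (a (tag t) (tagged t) *< (sval (i (tag t)) (g _ (tagged t)) : lb_M X))).
    rewrite -(sig_big_dep (fun _ => true) (fun _ _ => true)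
      (fun j t => a j t *< (sval (i j) (g j t) : lb_M X))) {1}(dec m).
    apply: eq_bigr => j _.
    transitivity (sval (i j) (\sum_t a j t *< g j t)).
      by rewrite [in RHS]/a -[in RHS]aP.
    rewrite (big_morph (sval (i j)) (bhD _) (bh0 _)).
    by apply: eq_bigr => t _; exact: bhl.
  exact: eq_bigl.
by rewrite big_enum_val.
Qed.

End Biproducts.

Section NeutralBlocks.
Variables (k : idomainType) (W : groupType) (S : {pred W}) (D : realdata k S).
Hypotheses (sg : signed_system S) (pre : prerealization D).
Variables (o : wset W) (L : o).
(** Kept abstract so as to cover both (W, S) and the neutral group over one point, where every word
    is neutral. *)
Hypothesis neutral_cat : forall u v : seq (gens S),
  neutral S L (wprod u) -> neutral S L (wprod v) -> neutral S L (wprod (u ++ v)).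

Local Notation Cm := (Cmon D).
Local Notation block := (@in_neutral_block k W S D o L).

Lemma block_goodL X : block X -> goodL X.
Proof.
move=> [/(in_C_goodD L L X)[gX _] [n [u [_ hX]]]]; split=> //.
by apply: biproduct_left_fg hX => j; have [] := goodL_Bw sg pre L (u j).
Qed.

Lemma block_moves X : block X -> moves L L X.
Proof. by move=> [/(in_C_goodD L L X)[]]. Qed.

Lemma neutral1 : neutral S L 1%g.
Proof. by split; [rewrite ws_act1|exists [::]]. Qed.

Lemma block_intro (X : Cm) n (Y : 'I_n -> Cm) (u : 'I_n -> seq (gens S)) :
  goodL X -> moves L L X -> (forall j, neutral S L (wprod (u j))) ->
  (forall j, @isomorphic Cm (Y j) (Bw D L (u j))) -> is_biproduct Y X -> block X.
Proof.
move=> gX mX nu uY hX; split; first by apply/(in_C_goodD L L X); split; case: gX.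
exists n, u; split=> //; exact: biproduct_iso uY (isomorphic_refl X) hX.
Qed.

Lemma block_Bw u : neutral S L (wprod u) -> block (Bw D L u).
Proof.
move=> nu; apply: (@block_intro _ 1 (fun _ => Bw D L u) (fun _ => u)) => //.
- exact: goodL_Bw.
- by have := @moves_Bw _ _ _ _ sg pre _ L u; case: nu => ->.
- by move=> j; exact: isomorphic_refl.
- exact: biproduct1.
Qed.

Lemma block_tensor_closed : tensor_closed block.
Proof.
split; first exact: (@block_Bw [::] neutral1).
move=> X Y hX hY; have [_ [n [u [nu bX]]]] := hX; have [_ [m [v [nv bY]]]] := hY.
apply: (@block_intro _ _ _ (fun j => u (enum_val j).1 ++ v (enum_val j).2) _ _ _ _
  (biproduct_ten bX bY)).
- exact: goodL_ten sg pre _ _ (block_goodL hX) (block_goodL hY).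
- exact: moves_ten (block_moves hX) (block_moves hY).
- by move=> j; exact: neutral_cat.
- move=> j; apply: isomorphic_sym; apply: isomorphic_trans (Bw_cat D L _ _) _.
  by case: (nu (enum_val j).1) => -> _; exact: isomorphic_refl.
Qed.

End NeutralBlocks.

Section PushBlock.
Variables (k : idomainType) (W : groupType) (S : {pred W}).
Variables (cox : coxeter_system S) (D : realdata k S) (pre : prerealization D).
Variables (o : wset W) (L : o).

Local Notation nG := (neutral_group L cox).
Local Notation nS := (neutral_gens cox L).
Local Notation D' := (endo_realdata cox D L).
Local Notation goodE := (@goodL k _ _ D').
Local Notation Cm := (Cmon D).
Local Notation push := (push (cox:=cox) (D:=D) (L:=L)).
Local Notation Bx := (Bx (cox:=cox) D (L:=L)).
Local Notation blockE := (@in_endo_block k W S cox D o L).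
Local Notation blockN := (@in_neutral_block k W S D o L).

Let sg := coxeter_signed cox.
Let sg' := neutral_signed cox L.
Let pre' := endo_prerealization cox pre L.

Lemma neutral_word_cat (u v : seq (gens S)) :
  neutral S L (wprod u) -> neutral S L (wprod v) -> neutral S L (wprod (u ++ v)).
Proof.
move=> /(neutral_wprod cox)[a b] /(neutral_wprod cox)[c d]; apply/(neutral_wprod cox).
by rewrite {1}wprod_cat ws_actM a c bword_cat a b d mul1g.
Qed.

Lemma neutral_pt (u : seq (gens nS)) : neutral nS (tt : pt_wset nG) (wprod u).
Proof.
split=> //; exists u; split=> //; elim: u => [|r u IH] //.
by rewrite /bword /= asboolT.
Qed.

Lemma endo_block_closed : tensor_closed blockE.
Proof. by apply: (block_tensor_closed sg' pre') => u v _ _; exact: neutral_pt. Qed.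
Lemma neutral_block_closed : tensor_closed blockN.
Proof. exact: (block_tensor_closed sg pre neutral_word_cat). Qed.

Lemma goodE_block X : blockE X -> goodE X.
Proof. exact: (block_goodL sg' pre'). Qed.

Section PushBiproduct.
Variables (n : nat) (Y : 'I_n -> Cobj D') (X : Cobj D').
Hypotheses (gY : forall j, goodE (Y j)) (gX : goodE X).

(** Inclusions and projections correspond by full faithfulness, and the identities between them
    concern only the underlying bimodule maps, which are unchanged. *)
Lemma push_biproduct : @is_biproduct k nG nS D' n Y X <->
  @is_biproduct k W S D n (fun j => push (Y j)) (push X).
Proof.
split=> [[i [p [ip off dec]]]|[i [p [ip off dec]]]].
- exists (fun j => exist _ _ (push_cond pre (gY j) (i j))).
  exists (fun j => exist _ _ (push_cond pre gX (p j))); split=> //.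
  move=> j; apply: lhomP => m.
  exact: (congr1 (fun f : @hom (Cmon D') (Y j) (Y j) => sval f m) (ip j)).
- exists (fun j => exist _ _ (pull_cond pre (gY j) gX (i j))).
  exists (fun j => exist _ _ (pull_cond pre gX (gY j) (p j))); split=> //.
  move=> j; apply: lhomP => m.
  exact: (congr1 (fun f : @hom Cm (push (Y j)) (push (Y j)) => sval f m) (ip j)).
Qed.

End PushBiproduct.

Lemma moves_push (X : Cobj D') : moves L L (push X).
Proof.
apply: moves_two => w m [w' [<- _]] _.
by have /asboolP[] := svalP w'.
Qed.

Lemma push_block X : blockE X -> blockN (push X).
Proof.
move=> hX; have gX := goodE_block hX; have [_ [n [x [_ bX]]]] := hX.
have [f fP] := choice (fun j => expands_ex (x j)).
apply: (@block_intro _ _ _ _ _ _ _ _ (fun j => push (Bx (x j))) f).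
- exact: goodL_push.
- exact: moves_push.
- by move=> j; rewrite (neutral_expands (fP j)); apply/asboolP; exact: (svalP (wprod (x j))).
- by move=> j; exact: Bx_expands.
- by apply/push_biproduct => // j; exact: goodE_Bx.
Qed.

Lemma Bx_block (x : seq (gens nS)) : blockE (Bx x).
Proof. by apply: (block_Bw sg' pre'); exact: neutral_pt. Qed.

Lemma Bw_block (x : seq (gens nS)) x' : expands x x' -> blockN (Bw D L x').
Proof.
move=> h; apply: (block_Bw sg pre); rewrite (neutral_expands h); apply/asboolP.
exact: (svalP (wprod x)).
Qed.

End PushBlock.

(** * Essential surjectivity *)

Section EssentialSurjectivity.
Variables (k : idomainType) (W : groupType) (S : {pred W}).
Variables (cox : coxeter_system S) (D : realdata k S) (pre : prerealization D).
Variables (o : wset W) (L : o).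

Local Notation nG := (neutral_group L cox).
Local Notation nS := (neutral_gens cox L).
Local Notation D' := (endo_realdata cox D L).
Local Notation goodE := (@goodL k _ _ D').
Local Notation iso := (@isomorphic (Cmon D)).
Local Notation push := (push (cox:=cox) (D:=D) (L:=L)).
Local Notation Bx := (Bx (cox:=cox) D (L:=L)).
Local Notation blockE := (@in_endo_block k W S cox D o L).

Let sg := coxeter_signed cox.
Let sg' := neutral_signed cox L.
Let pre' := endo_prerealization cox pre L.
Let st := realization_setting sg pre.
Let st' := realization_setting sg' pre'.

Variables (Y : Cobj D) (gY : goodL Y) (n : nat) (x : 'I_n -> seq (gens nS)).
Hypothesis bY : @is_biproduct k W S D n (fun j => push (Bx (x j))) Y.

(** Same bimodule, with only the parts at neutral elements kept; [pull_dense] shows that these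
    suffice over the smaller localization. *)
Definition pull : Cobj D' :=
  @two_obj k nG nS D' (lb_M Y) (@lb_gr _ _ _ _ Y) (pull_part (@lpart _ _ _ _ Y)).

Lemma addspan_rmul (V : bimod (Sym D) (Sym D)) (P : nG -> V -> Prop) (m : V) (c : Sym D) :
  (forall w t, P w t -> P w (t >* c)) ->
  addspan (fun t => exists w, P w t) m -> addspan (fun t => exists w, P w t) (m >* c).
Proof.
move=> h; apply: (addspan_map (f := fun u => u >* c) (fun x y => rmulDl x y c)).
- exact: Span0.
- exact: SpanB.
by move=> v [w hv]; apply: SpanG; exists w; exact: h.
Qed.

(* The point is that only roots of the neutral group get inverted: this holds for
   the summands, which come from that group. *)
Lemma pull_dense (m : lb_M Y) : exists d : Sym D, lunit (toQ D') d /\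
  addspan (fun t => exists w : nG, lpart (X := Y) (val w) t) (m >* d).
Proof.
have [i [p [_ _ dec]]] := bY.
suff H (s : seq 'I_n) : exists d : Sym D, lunit (toQ D') d /\
    addspan (fun t => exists w : nG, lpart (X := Y) (val w) t)
      ((\sum_(j <- s) sval (i j) (sval (p j) m) : lb_M Y) >* d).
  by rewrite (dec m); exact: H.
have rm c t := @addspan_rmul (lb_M Y) (fun w => lpart (X := Y) (val w)) t c.
elim: s => [|j s [d [hd IH]]].
  by exists 1; split; [exact: lunit1|rewrite big_nil rmul0l; exact: Span0].
have [c [hc hj]] := lpart_decomp st' (goodE_Bx pre (x j)).1 (sval (p j) m).
exists (d * c); split; first exact: lunitM.
rewrite big_cons rmulDl; apply: addspanD; last first.
  by rewrite -rmulA; apply: rm IH => w t; exact: lpart_r.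
rewrite mulrC -rmulA; apply: rm; first by move=> w t; exact: lpart_r.
rewrite -[_ >* c](bhr (sval (i j))).
apply: (addspan_map (bhD (sval (i j))) _ _ _ hj); [exact: Span0|exact: SpanB|].
move=> t [w ht]; apply: SpanG; exists w; apply: (lhom_lpart (i j)).
exact: (lpart_push_in (X := Bx (x j))).
Qed.

Lemma presented_pull_obj :
  @presentedD k _ _ D' (lb_M Y) (@lb_gr _ _ _ _ Y) (pull_part (@lpart _ _ _ _ Y)).
Proof.
apply: presented_pull (presented_lpart st gY.1) _ => m.
have [d [hd h]] := pull_dense m; exists d; split=> //.
by apply: addspan_mono h => t [w hw]; exists w; exact/lspan_lpart.
Qed.

Lemma goodE_pull : goodE pull.
Proof. by split; [exact: (goodD_two sg' pre' presented_pull_obj)|case: gY]. Qed.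

Lemma push_pull_cond : @lhom_cond _ _ (toQ D) W (push pull) Y (bhid _).
Proof.
apply: (lhom_cond_lgens st (goodL_push pre goodE_pull).1
  (lgens_two_obj sg pre (push_presented pre goodE_pull))).
move=> w _ [a [m [[v [<- hm]] ->]]]; apply: lpart_l.
(* A part of [pull] is, up to a denominator of the neutral group, spanned by elements of the
   corresponding part of Y, and that denominator is also invertible over W. *)
have [d [hd h]] := lpart_lgens_unit st' goodE_pull.1
  (lgens_two_obj sg' pre' presented_pull_obj) hm.
apply: (lpart_unit (X := Y) (lunit_endo pre hd)).
by apply: (@lpart_span _ _ _ _ Y (val v) _ _ _ h) => _ [b [t' [ht ->]]]; exact: lpart_l.
Qed.

Lemma iso_push_pull : iso (push pull) Y.
Proof.
pose f : lhom (push pull) Y := exist _ _ push_pull_cond.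
have h := @lhom_cond_inv _ _ _ _ _ _ _ st _ _ f (bhid _) (goodL_push pre goodE_pull).1 gY.1
  (fun _ => erefl) (fun _ => erefl).
by exists f, (exist _ _ h); split; apply: lhomP.
Qed.

Lemma block_pull : blockE pull.
Proof.
apply: (@block_intro _ _ _ _ _ _ _ n (fun j => Bx (x j)) x).
- exact: goodE_pull.
- by [].
- by move=> j; exact: neutral_pt.
- by move=> j; exact: isomorphic_refl.
(* The decomposition of Y is moved to [push pull] and then reflected back to the neutral group. *)
apply/(push_biproduct pre (fun j => goodE_Bx pre (x j)) goodE_pull).
apply: biproduct_iso (isomorphic_sym iso_push_pull) bY => j; exact: isomorphic_refl.
Qed.

End EssentialSurjectivity.

Section Surjectivity.
Variables (k : idomainType) (W : groupType) (S : {pred W}).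
Variables (cox : coxeter_system S) (D : realdata k S) (pre : prerealization D).
Variables (o : wset W) (L : o).

Lemma push_surj Y : @in_neutral_block k W S D o L Y -> exists X,
  @in_endo_block k W S cox D o L X /\ @isomorphic (Cmon D) (push X) Y.
Proof.
move=> hY; have gY := block_goodL (coxeter_signed cox) pre hY.
have [_ [n [u [nu bY]]]] := hY.
have [x xP] := choice (fun j => Bw_neutral cox pre (nu j)).
have bY' : @is_biproduct k W S D n (fun j => push (Bx D (x j))) Y.
  by apply: biproduct_iso (isomorphic_refl _) bY => j; case: (xP j).
by exists (pull cox L Y); split; [exact: (block_pull pre gY bY')|exact: (iso_push_pull pre gY bY')].
Qed.

End Surjectivity.

(** * The equivalence *)

Section Equivalence.
Variables (C D : category) (F : functor C D).
Hypothesis faithful : forall (X Y : C) (f g : hom X Y), fmap F f = fmap F g -> f = g.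
Hypothesis full : forall (X Y : C) (g : hom (F X) (F Y)), exists f, fmap F f = g.
Hypothesis surj : forall Y : D, exists X, isomorphic (F X) Y.

Let G0 (Y : D) : C := sval (cid (surj Y)).
Let isoG Y : isomorphic (F (G0 Y)) Y := svalP (cid (surj Y)).
Let a Y : hom (F (G0 Y)) Y := sval (cid (isoG Y)).
Let b Y : hom Y (F (G0 Y)) := sval (cid (svalP (cid (isoG Y)))).
Let ab Y : inverse (a Y) (b Y) := svalP (cid (svalP (cid (isoG Y)))).
Let lift X Y (g : hom (F X) (F Y)) : hom X Y := sval (cid (full g)).
Let liftK X Y (g : hom (F X) (F Y)) : fmap F (lift g) = g := svalP (cid (full g)).

Lemma fully_faithful_equivalence : is_equivalence F.
Proof.
pose G1 X Y (f : hom X Y) : hom (G0 X) (G0 Y) := lift (b Y \oc f \oc a X).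
have G11 X : G1 _ _ (idc X) = idc (G0 X).
  by apply: faithful; rewrite liftK cmp1r fmap1; case: (ab X).
have G1M X Y Z (g : hom Y Z) (f : hom X Y) : G1 _ _ (g \oc f) = G1 _ _ g \oc G1 _ _ f.
  apply: faithful; rewrite fmapM !liftK !cmpA; congr (_ \oc _ \oc _).
  by rewrite -(cmpA _ (a Y)); case: (ab Y) => _ ->; rewrite cmp1r.
exists (Functor G11 G1M); split.
- exists (fun X => lift (a (F X))), (fun X => lift (b (F X))); split=> [X|X Y f].
    by case: (ab (F X)) => h1 h2; split; apply: faithful;
      rewrite fmapM !liftK fmap1.
  apply: faithful; rewrite !fmapM /= !liftK !cmpA.
  by case: (ab (F Y)) => _ ->; rewrite cmp1l.
- exists a, b; split=> // X Y f; rewrite /= liftK !cmpA.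
  by case: (ab Y) => _ ->; rewrite cmp1l.
Qed.

End Equivalence.

Section Psi.
Variables (k : idomainType) (W : groupType) (S : {pred W}).
Variables (cox : coxeter_system S) (D : realdata k S) (pre : prerealization D).
Variables (o : wset W) (L : o).

Local Notation D' := (endo_realdata cox D L).
Local Notation goodE := (@goodL k _ _ D').
Local Notation Cm' := (Cmon D').
Local Notation hE := (endo_block_closed cox pre L).
Local Notation hN := (neutral_block_closed cox pre L).
Local Notation ME := (full_monoidal hE).
Local Notation MN := (full_monoidal hN).

Let gE (X : ME) : goodE (sval X) := goodE_block pre (svalP X).

Definition psi : functor ME MN :=
  @Functor ME MN (fun X => exist _ _ (push_block pre (svalP X)))
    (fun X Y f => push_map pre (gE X) f)
    (fun X => push_map1 pre (gE X))
    (fun X Y Z g f => push_mapM pre (gE X) (gE Y) g f).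

(* The conversions between [ten X Y] in the full subcategory and in [Cmon D'] are
   left to the kernel. *)
Definition gE_ten (X Y : ME) : goodE (@ten Cm' (sval X) (sval Y)).
Proof. exact_no_check (gE (ten X Y)). Defined.
Definition gE_ten3 (X Y Z : ME) : goodE (@ten Cm' (@ten Cm' (sval X) (sval Y)) (sval Z)).
Proof. exact_no_check (gE (ten (ten X Y) Z)). Defined.
Definition gE_one : goodE (@munit Cm').
Proof. exact_no_check (gE munit). Defined.
Definition gE_lun (X : ME) : goodE (@ten Cm' munit (sval X)).
Proof. exact_no_check (gE (ten munit X)). Defined.
Definition gE_run (X : ME) : goodE (@ten Cm' (sval X) munit).
Proof. exact_no_check (gE (ten X munit)). Defined.

Definition psi_mu (X Y : ME) : @hom MN (ten (psi X) (psi Y)) (psi (ten X Y)) :=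
  push_mu pre (gE X) (gE Y).
Definition psi_eps : @hom MN munit (psi munit) := push_eps cox pre L.

Lemma psi_mu_iso (X Y : ME) : exists mui, inverse (psi_mu X Y) mui.
Proof. exact: (push_mu_iso pre (gE X) (gE Y)). Qed.

Lemma psi_eps_iso : exists epsi, inverse psi_eps epsi.
Proof. exact: (push_eps_iso cox pre L). Qed.

Lemma psi_mu_nat X X' Y Y' (f : hom X X') (g : hom Y Y') :
  psi_mu X' Y' \oc tmap (fmap psi f) (fmap psi g) = fmap psi (tmap f g) \oc psi_mu X Y.
Proof.
exact_no_check (push_mu_nat pre (gE X) (gE X') (gE Y) (gE Y') (gE_ten X Y) f g).
Qed.

Lemma psi_mu_assoc X Y Z :
  fmap psi (massoc X Y Z) \oc psi_mu (ten X Y) Z \oc tmap (psi_mu X Y) (idc (psi Z))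
  = psi_mu X (ten Y Z) \oc tmap (idc (psi X)) (psi_mu Y Z)
    \oc massoc (psi X) (psi Y) (psi Z).
Proof.
exact_no_check (push_mu_assoc pre (gE X) (gE Y) (gE Z) (gE_ten X Y) (gE_ten Y Z)
  (gE_ten3 X Y Z)).
Qed.

Lemma psi_mu_lun X :
  fmap psi (mlun X) \oc psi_mu munit X \oc tmap psi_eps (idc (psi X)) = mlun (psi X).
Proof. exact_no_check (push_mu_lun pre (gE X) gE_one (gE_lun X)). Qed.

Lemma psi_mu_run X :
  fmap psi (mrun X) \oc psi_mu X munit \oc tmap (idc (psi X)) psi_eps = mrun (psi X).
Proof. exact_no_check (push_mu_run pre (gE X) gE_one (gE_run X)). Qed.

Definition psi_monoidal : monoidal_functor ME MN :=
  @MonoidalFunctor ME MN psi psi_mu psi_mu_iso psi_mu_nat psi_eps psi_eps_iso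
    psi_mu_assoc psi_mu_lun psi_mu_run.

Lemma psi_equivalence : is_equivalence psi.
Proof.
apply: fully_faithful_equivalence => [X Y f g e|X Y g|Y].
- apply: lhomP => m; exact: (congr1 (fun h : @hom MN (psi X) (psi Y) => sval h m) e).
- exists (exist _ _ (pull_cond pre (gE X) (gE Y) g)); exact: lhomP.
- have [X [hX [f [f' h]]]] := push_surj cox pre (svalP Y).
  by exists (exist _ X hX), f, f'.
Qed.

End Psi.

Theorem proposition1p3p1 (k : idomainType) (W : groupType) (S : {pred W})
    (cox : coxeter_system S) (o : wset W) (D : realdata k S)
    (hAbe : reflection_stable_Abe D) (hbal : reflection_balanced D) (L : o) :
  exists (hE : tensor_closed (@in_endo_block k W S cox D o L))
         (hN : tensor_closed (@in_neutral_block k W S D o L))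
         (Psi : monoidal_functor (full_monoidal hE) (full_monoidal hN)),
    is_equivalence Psi /\
    forall (x : seq (gens (neutral_gens cox L))) (x' : seq (gens S)),
      expands x x' ->
      exists (hx : in_endo_block (Bx D x)) (hx' : in_neutral_block L (Bw D L x')),
        @isomorphic (full_monoidal hN)
          (Psi (exist _ (Bx D x) hx)) (exist _ (Bw D L x') hx').
Proof.
have [pre _] := hAbe.
exists (endo_block_closed cox pre L), (neutral_block_closed cox pre L), (psi_monoidal cox pre L).
split=> [|x x' h]; first exact: psi_equivalence.
exists (Bx_block pre x), (Bw_block pre h); exact: (Bx_expands pre h).
Qed.
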